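(* Let $\alpha\ge0$, $X$ recurrent, $n\in\mathfrak N$, and let $\bar X^n$ be the path $\bar X_{[0,\bar\tau_{n(x_0)}]}$ conditioned on $\bar{\mathcal N}=n$ (see context). The law of $\bar X^n$ can be described as follows. It starts from $x_0$. Conditionally on $(\bar X^n_k:0\le k\le l)$ with $l<T^{\bar X^n}$ and $\bar X^n_l=x$: (1) if $\check\Theta_l(x)>0$, it jumps to a neighbour $y$ of $x$ with probability $\check\Theta_l(xy)/\check\Theta_l(x)$; (2) if $\check\Theta_l(x)=0$ and $x\ne x_0$, it jumps to the parent of $x$. Finally, $\bar X^n$ stops at time $T^{\bar X^n}$. Here $$\Theta_l(xy)=n(xy)-\#\{0\le k\le l-1:\bar X^n_k=x,\ \bar X^n_{k+1}=y\},\qquad T^{\bar X^n}=\inf\{k\ge0:\bar X^n_k=x_0,\ \Theta_k(x_0)=0\}.$$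
   Context: Setting. $\mathbb T=(V,E)$ is a finite or countable tree with all degrees finite, with root $x_0$; $\vec E$ is the set of directed edges, $xy=(x,y)$ for $x\sim y$, $\mathfrak p(x)$ is the parent of $x\ne x_0$. $X$ is the continuous-time Markov chain on $V$ started at $x_0$ which at $x$ jumps to $y\sim x$ with rate $C_{xy}>0$ (not necessarily symmetric); $X$ is assumed recurrent (so there is no killing). $\bar X$ is the jump chain of $X$. Networks. A network is $n=(n(xy))_{xy\in\vec E}\in\mathbb N^{\vec E}$, $\mathbb N=\{0,1,2,\dots\}$. It is sourceless ($\partial n=\emptyset$) if $n(xy)=n(yx)$ for all edges. For a network, $\check n(xy)=n(xy)+(\alpha-1)1_{\{y=\mathfrak p(x)\}}$, $n(x)=\sum_{y\sim x}n(xy)$, $\check n(x)=\sum_{y\sim x}\check n(xy)$; these notations are applied to $\Theta_l$ viewed as a network. $\mathfrak N=\{n:\partial n=\emptyset\}$ if $\alpha>0$; $\mathfrak N=\{n:\partial n=\emptyset,\ \mathrm{supp}(n)\text{ connected and finite}\}$ if $\alpha=0$. For a collection of (discrete or continuous-time) paths or loops $\mathscr L$, $\theta(\mathscr L)(xy)$ is the number of crossings from $x$ to $y$ by $\mathscr L$. Loop soup. The loop measure of $X$ is the image, under the map forgetting the root, of $\sum_x\int_0^\infty\frac1tP^x(X_{[0,t]}\in\cdot,X_t=x)\,dt$; $\mathcal L^{(0)}$ is the collection of loops not visiting $x_0$ in a Poisson point process with intensity $\alpha$ times this measure ($\mathcal L^{(0)}=\emptyset$ if $\alpha=0$). $\bar{\mathcal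 L}^{(0)}$ has the law of the discrete loop soup induced by $\mathcal L^{(0)}$ (its loops with holding times forgotten) and is independent of $\bar X$. For $k\ge1$, $\bar\tau_k=\inf\{l>0:\#\{1\le j\le l:\bar X_j=x_0\}=k\}$ (and $\bar\tau_0=0$). With $m=n(x_0)$, $\bar{\mathcal N}=\theta(\bar X_{[0,\bar\tau_m]})+\theta(\bar{\mathcal L}^{(0)})$. Conditional laws are regular conditional distributions. *)

(* Defs.v *)
From HB Require Import structures.
From mathcomp Require Import all_boot all_order all_algebra.
From mathcomp Require Import all_classical all_reals all_analysis.
From mathcomp Require Import measurable_realfun.

Set Implicit Arguments.
Unset Strict Implicit.
Unset Printing Implicit Defensive.

Import Order.TTheory GRing.Theory Num.Theory.
Local Open Scope classical_set_scope.
Local Open Scope ring_scope.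

(* MathComp-Analysis only endows pointed types with sigma-algebras. *)
HB.instance Definition _ (T : choiceType) := isPointed.Build (seq T) [::].

(** ** Locally finite trees, given by adjacency lists *)

Record tree (V : countType) := Tree {
  nbr : V -> seq V;
  nbr_uniq : forall x, uniq (nbr x);
  nbr_irrefl : forall x, x \notin nbr x;
  nbr_sym : forall x y, (y \in nbr x) = (x \in nbr y);
  tree_connected : forall x y,
    exists p, path (fun u v => v \in nbr u) x p /\ last x p = y;
  (* a cycle of size 2 is an edge travelled back and forth *)
  tree_acyclic : forall c,
    ucycle (fun u v => v \in nbr u) c -> (size c <= 2)%N }.

(* [y] is the first vertex after [x] on the simple path from [x] to [x0];
   there is no such [y] when [x = x0]. *)
Definition is_parent (V : countType) (T : tree V) (x0 x y : V) : Prop :=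
  exists p, [/\ path (fun u v => v \in nbr T u) x (y :: p),
                uniq (x :: y :: p) & last y p = x0].

(** ** Networks *)

(* The product sigma-algebra on [V -> V -> nat] is generated by [net_cyl].
   A network on the directed edges is extended by 0 to all pairs. *)
Definition net_cyl (V : countType) : set (set (V -> V -> nat)) :=
  [set A | exists x y k, A = [set n | n x y = k]].

Definition network (V : countType) := g_sigma_algebraType (@net_cyl V).

Definition net_at (V : countType) (T : tree V) (n : network V) (x : V) : nat :=
  (\sum_(y <- nbr T x) n x y)%N.

Definition on_edges (V : countType) (T : tree V) (n : network V) : Prop :=
  forall x y, y \notin nbr T x -> n x y = 0%N.

Definition sourceless (V : countType) (n : network V) : Prop :=
  forall x y, n x y = n y x.

Definition supp_connected (V : countType) (n : network V) : Prop :=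
  forall u v, (exists y, 0 < n u y)%N -> (exists y, 0 < n v y)%N ->
  exists p, path (fun x y => (0 < n x y) || (0 < n y x))%N u p /\ last u p = v.

Definition supp_finite (V : countType) (n : network V) : Prop :=
  finite_set [set e : V * V | (0 < n e.1 e.2)%N].

Definition frakN (R : realType) (V : countType) (T : tree V) (alpha : R)
    (n : network V) : Prop :=
  [/\ on_edges T n, sourceless n &
      alpha = 0 -> supp_connected n /\ supp_finite n].

(** ** The continuous-time Markov chain, by its jumps and holding times *)

Section Chain.
Context (R : realType) (V : countType) (T : tree V) (C : V -> V -> R).

Definition rate (x : V) : R := \sum_(y <- nbr T x) C x y.

(* The first branch only occurs for the tree reduced to one vertex. *)
Definition jump_prob (x y : V) : R :=
  if nbr T x is [::] then (y == x)%:R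
  else if y \in nbr T x then C x y / rate x else 0.

Context (d : measure_display) (Omega : measurableType d).

(* [Y k] is the k-th visited state and [H k] the time spent there. [H k] is
   extended-real valued, since a state of rate 0 is held for ever. *)
Record is_ctmc (P : V -> probability Omega R) (Y : nat -> Omega -> V)
    (H : nat -> Omega -> \bar R) : Prop := IsCTMC {
  ctmc_mY : forall k v, measurable [set w | Y k w = v];
  ctmc_mH : forall k, measurable_fun [set: Omega] (H k);
  ctmc_law : forall (x : V) (k : nat) (z : nat -> V) (s : nat -> R),
    (forall i, 0 <= s i) ->
    P x [set w | forall i, (i <= k)%N -> Y i w = z i /\ ((s i)%:E < H i w)%E] =
    ((z 0%N == x)%:R * \prod_(i < k) jump_prob (z i) (z i.+1)
       * \prod_(i < k.+1) expR (- (rate (z i) * s i)))%:E }.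

Context (Y : nat -> Omega -> V) (H : nat -> Omega -> \bar R).

Definition jump_time (k : nat) (w : Omega) : \bar R :=
  (\sum_(i < k) H i w)%E.

Definition in_sojourn (k : nat) (t : R) (w : Omega) : Prop :=
  (jump_time k w <= t%:E)%E /\ (t%:E < jump_time k.+1 w)%E.

Definition X_at (t : R) (w : Omega) (x : V) : Prop :=
  exists k, in_sojourn k t w /\ Y k w = x.

Definition recurrent (P : V -> probability Omega R) : Prop :=
  forall x, {ae P x, forall w, forall M : R, exists t, M <= t /\ X_at t w x}.

(* The trajectory on [0, t], where t is in the k-th sojourn, as the list of
   visited states with the durations of the visits. *)
Definition X_upto (k : nat) (t : R) (w : Omega) : seq (V * R) :=
  rcons (mkseq (fun i => (Y i w, fine (H i w))) k)
        (Y k w, t - fine (jump_time k w)).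

End Chain.

(** ** Loops *)

(* An unrooted continuous-time loop is a list of (state, holding time) read
   cyclically, an unrooted discrete loop is a list of states read cyclically.
   "Up to rotation" is imposed through the sigma-algebra: only sets that are
   invariant under [rot] are measurable. *)
Definition rot_inv (T : Type) (A : set (seq T)) : Prop :=
  forall s i, A s -> A (rot i s).

Definition cloop_boxes (R : realType) (V : countType) : set (set (seq (V * R))) :=
  [set A | exists (z : seq V) (t : seq R),
    A = [set g | map fst g = z /\ all2 <=%R (map snd g) t]].

Definition cloop_events (R : realType) (V : countType) : set (set (seq (V * R))) :=
  [set A | <<s @cloop_boxes R V >> A /\ rot_inv A].

Definition cloop (R : realType) (V : countType) :=
  g_sigma_algebraType (@cloop_events R V).

Definition dloop (V : countType) :=
  g_sigma_algebraType [set A : set (seq V) | rot_inv A].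

(* The root of a closed trajectory lies inside a visit; forgetting it merges
   the first and last pieces of that visit. *)
Definition unroot (R : realType) (V : countType) (g : seq (V * R)) : cloop R V :=
  match g with
  | p :: q :: g' => (p.1, p.2 + (last q g').2) :: belast q g'
  | _ => g
  end.

Definition loop_measure (R : realType) (V : countType) (d : measure_display)
    (Omega : measurableType d) (P : V -> probability Omega R)
    (Y : nat -> Omega -> V) (H : nat -> Omega -> \bar R)
    (A : set (cloop R V)) : \bar R :=
  (\esum_(x in [set: V]) \int[lebesgue_measure]_(t in `]0%R, +oo[)
     ((t^-1)%:E * P x [set w | exists k,
        [/\ in_sojourn H k t w, Y k w = x & A (unroot (X_upto Y H k t w))]]))%E.

(** ** Poisson point processes, as random counting measures *)

Record is_point_process (R : realType) (d d' : measure_display)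
    (Omega : measurableType d) (T : measurableType d')
    (N : Omega -> {measure set T -> \bar R}) : Prop := IsPointProcess {
  pp_measurable : forall A, measurable A -> measurable_fun [set: Omega] (fun w => N w A);
  pp_counting : forall w A, measurable A ->
    N w A = +oo%E \/ exists k : nat, N w A = k%:R%:E }.

Record is_poisson_process (R : realType) (d d' : measure_display)
    (Omega : measurableType d) (P : probability Omega R)
    (T : measurableType d') (N : Omega -> {measure set T -> \bar R})
    (mu : set T -> \bar R) : Prop := IsPoissonProcess {
  ppp_point : is_point_process N;
  ppp_fin : forall A, measurable A -> (mu A < +oo)%E -> forall k : nat,
    P [set w | N w A = k%:R%:E] =
    (fine (mu A) ^+ k / k`!%:R * expR (- fine (mu A)))%:E;
  ppp_infty : forall A, measurable A -> mu A = +oo%E ->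
    P [set w | N w A = +oo%E] = 1%E;
  ppp_indep : forall (k : nat) (A : 'I_k -> set T) (a : 'I_k -> \bar R),
    (forall i, measurable (A i)) -> trivIset setT A ->
    P [set w | forall i, N w (A i) = a i] =
    (\prod_(i < k) P [set w | N w (A i) = a i])%E }.

(* The discrete loops induced by the loops of [L] that do not visit [x0]. *)
Definition discrete_soup0 (R : realType) (V : countType) (x0 : V)
    (L : set (cloop R V) -> \bar R) (A : set (dloop V)) : \bar R :=
  L [set g | A (map fst g) /\ x0 \notin map fst g].

Definition same_law (R : realType) (d1 d2 d : measure_display)
    (Omega1 : measurableType d1) (P1 : probability Omega1 R)
    (Omega2 : measurableType d2) (P2 : probability Omega2 R)
    (T : measurableType d) (N1 : Omega1 -> set T -> \bar R)
    (N2 : Omega2 -> set T -> \bar R) : Prop :=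
  forall (k : nat) (A : 'I_k -> set T) (B : 'I_k -> set (\bar R)),
    (forall i, measurable (A i)) -> (forall i, measurable (B i)) ->
    P1 [set w | forall i, B i (N1 w (A i))] =
    P2 [set w | forall i, B i (N2 w (A i))].

(* [Lbar], on the space of [P], is distributed as the discrete loops avoiding
   [x0] of a Poisson process of continuous-time loops on the space of [PL]. *)
Definition is_discrete_soup0 (R : realType) (V : countType) (x0 : V)
    (mu : set (cloop R V) -> \bar R) (d dL : measure_display)
    (Omega : measurableType d) (P : probability Omega R)
    (OmegaL : measurableType dL) (PL : probability OmegaL R)
    (L : OmegaL -> {measure set (cloop R V) -> \bar R})
    (Lbar : Omega -> {measure set (dloop V) -> \bar R}) : Prop :=
  [/\ is_poisson_process PL L mu,
      is_point_process Lbar &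
      same_law P PL (fun w => Lbar w : set (dloop V) -> \bar R)
                    (fun w => discrete_soup0 x0 (L w))].

(** ** The jump chain and the total crossing network *)

Definition is_jump_chain (R : realType) (V : countType)
    (dX d : measure_display)
    (OmegaX : measurableType dX) (PX : probability OmegaX R)
    (Y : nat -> OmegaX -> V)
    (Omega : measurableType d) (P : probability Omega R)
    (Xbar : nat -> Omega -> V) : Prop :=
  (forall k v, measurable [set w | Xbar k w = v]) /\
  forall (k : nat) (z : nat -> V),
    P [set w | forall i, (i <= k)%N -> Xbar i w = z i] =
    PX [set w | forall i, (i <= k)%N -> Y i w = z i].

Definition independent (R : realType) (V : countType) (d : measure_display)
    (Omega : measurableType d) (P : probability Omega R)
    (Xbar : nat -> Omega -> V)
    (Lbar : Omega -> {measure set (dloop V) -> \bar R}) : Prop :=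
  forall E F : set Omega,
    <<s [set E | exists k v, E = [set w | Xbar k w = v]] >> E ->
    <<s [set F | exists (A : set (dloop V)) (B : set (\bar R)),
           [/\ measurable A, measurable B & F = [set w | B (Lbar w A)]]] >> F ->
    P (E `&` F) = (P E * P F)%E.

Definition visits (V : countType) (x0 : V) (x : nat -> V) (l : nat) : nat :=
  (\sum_(1 <= j < l.+1) (x j == x0))%N.

(* All finite words, with the discrete sigma-algebra. *)
Definition word (V : countType) := g_sigma_algebraType [set: set (seq V)].

(* The path up to tau_m as the word of its successive states; it is the empty
   word when tau_m is infinite, a null event for a recurrent chain. *)
Definition path_upto_tau (V : countType) (x0 : V) (m : nat) (x : nat -> V) :
    word V :=
  if m is 0%N then [:: x 0%N] else
  match pselect (exists l, (0 < l)%N && (visits x0 x l == m)) with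
  | left tau_fin => mkseq x (ex_minn tau_fin).+1
  | right _ => [::]
  end.

Definition crossings (V : countType) (g : seq V) (x y : V) : nat :=
  count (pred1 (x, y)) (zip g (behead g)).

Definition loop_crossings (V : countType) (z : dloop V) (x y : V) : nat :=
  count (pred1 (x, y)) (zip z (rot 1 z)).

Definition soup_crossings (R : realType) (V : countType)
    (L : {measure set (dloop V) -> \bar R}) (x y : V) : \bar R :=
  (\int[L]_z (loop_crossings z x y)%:R%:E)%E.

(* [soup_crossings] is infinite on an edge only on a null event, where the
   truncation below returns the junk value 0. *)
Definition total_crossings (R : realType) (V : countType) (T : tree V) (x0 : V)
    (m : nat) (d : measure_display) (Omega : measurableType d)
    (Xbar : nat -> Omega -> V)
    (Lbar : Omega -> {measure set (dloop V) -> \bar R}) (w : Omega) : network V :=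
  fun x y => if y \in nbr T x then
      (crossings (path_upto_tau x0 m (fun k => Xbar k w)) x y
       + Num.truncn (fine (soup_crossings (Lbar w) x y)))%N
    else 0%N.

(** ** Regular conditional distributions *)

Definition is_rcd (R : realType) (d d1 d2 : measure_display)
    (Omega : measurableType d) (P : probability Omega R)
    (T1 : measurableType d1) (T2 : measurableType d2)
    (f : Omega -> T1) (g : Omega -> T2) (kappa : R.-pker T2 ~> T1) : Prop :=
  [/\ measurable_fun [set: Omega] f, measurable_fun [set: Omega] g &
      forall (A : set T1) (B : set T2), measurable A -> measurable B ->
      P (f @^-1` A `&` g @^-1` B) = (\int[P]_(w in g @^-1` B) kappa (g w) A)%E].

(** ** The self-interacting process *)

Section Process.
Context (R : realType) (V : countType) (T : tree V) (x0 : V) (alpha : R)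
  (n : network V).

(* [g] is the word of the states visited up to the current time. *)
Definition Theta (g : seq V) (x y : V) : R :=
  (n x y)%:R - (crossings g x y)%:R.

Definition Theta_at (g : seq V) (x : V) : R := \sum_(y <- nbr T x) Theta g x y.

Definition cTheta (g : seq V) (x y : V) : R :=
  Theta g x y + (alpha - 1) * (`[< is_parent T x0 x y >])%:R.

Definition cTheta_at (g : seq V) (x : V) : R :=
  \sum_(y <- nbr T x) cTheta g x y.

Definition exhausted (g : seq V) (k : nat) : Prop :=
  nth x0 g k = x0 /\ Theta_at (take k.+1 g) x0 = 0.

Definition is_T (g : seq V) (k : nat) : Prop :=
  exhausted g k /\ forall j, (j < k)%N -> ~ exhausted g j.

(* Conditional probabilities given [prefix (rcons z x)] are multiplied out by
   the probability of the conditioning event. *)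
Record is_process_law (nu : set (word V) -> \bar R) : Prop := IsProcessLaw {
  law_start : nu [set g | ohead g = Some x0] = 1%E;
  law_jump : forall (z : seq V) (x y : V),
    (forall k, (k <= size z)%N -> ~ exhausted (rcons z x) k) ->
    0 < cTheta_at (rcons z x) x -> y \in nbr T x ->
    nu [set g | prefix (rcons (rcons z x) y) g] =
    ((cTheta (rcons z x) x y / cTheta_at (rcons z x) x)%:E
       * nu [set g | prefix (rcons z x) g])%E;
  law_parent : forall (z : seq V) (x y : V),
    (forall k, (k <= size z)%N -> ~ exhausted (rcons z x) k) ->
    cTheta_at (rcons z x) x = 0 -> x != x0 -> is_parent T x0 x y ->
    nu [set g | prefix (rcons (rcons z x) y) g] =
    nu [set g | prefix (rcons z x) g];
  law_stop : nu [set g | is_T g (size g).-1] = 1%E }.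

End Process.

(* Main.v *)
(* Fix a beginning [g] of the path, from [x0] to [x], a child [y] of [x], and
   write [gy] for [g] followed by a step to [y]. Given all crossing numbers, the
   [t] crossings of [xy] that remain after [g] belong to the rest of the path or
   to the loops; mark one of them.
   - If it belongs to the path, the path returns to [x] after it, since [x]
     separates [y] from the root. Moving this excursion to the front changes
     neither the weight nor the crossings, and gives a path continuing [gy] with
     a marked visit to [x].
   - If it belongs to a loop, the Mecke formula for the Poisson soup inserts a
     loop rooted at [x] that starts with [xy]. Moving its first excursion to the
     path gives a path continuing [gy] and a rooted loop at [x], possibly empty;
     nonempty rooted loops at [x] are again marked crossings of the soup, and
     the empty one contributes [alpha].
   Counting the marks gives [t * P(g) = (Theta(x) + alpha - 1) * P(gy)] if
   [x <> x0], without [alpha - 1] if [x = x0]. This is the jump probability to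
   the children; the parent gets the complement. Boxes fixing finitely many
   crossing numbers form a pi-system, so the identity passes to the conditional
   law given the whole network. *)

Require Import Defs.
From HB Require Import structures.
From mathcomp Require Import all_boot all_order all_algebra.
From mathcomp Require Import all_classical all_reals all_analysis.
From mathcomp Require Import measurable_realfun.
From mathcomp Require Import zify ring lra.

Set Implicit Arguments.
Unset Strict Implicit.
Unset Printing Implicit Defensive.

Import Order.TTheory GRing.Theory Num.Theory numFieldNormedType.Exports.
Local Open Scope classical_set_scope.
Local Open Scope ring_scope.

(** * Exponential holding times *)

(** The obstacle is that soup loops are unrooted, carry holding times and come with the density
    [1/t], whereas excursions are weighted by jump probabilities. On a rotation class of words, the
    holding times integrate out: summed over the possible roots, what remains is exactly the product
    of the jump probabilities round the loop. Hence the intensity of a class times its number of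
    crossings of [xy] is the sum of the weights of its distinct rotations rooted at [x] that start
    with [xy], with no symmetry factor even for periodic loops. A second difficulty is that the
    Mecke formula is applied on events fixing several crossing numbers. Each of these is an infinite
    sum over classes, while independence is given for finitely many counts; it is extended by
    monotone limits of events defined by inequalities. The complement rule for the parent needs the
    next-step probabilities to add up to 1. This holds because recurrence makes the stopped path
    finite almost surely, so that the conditional law charges only complete tree paths. *)

Lemma measurable_forall_le d (T : measurableType d) (k : nat)
    (Q : nat -> T -> Prop) : (forall i, measurable [set w | Q i w]) ->
  measurable [set w | forall i, (i <= k)%N -> Q i w].
Proof.
move=> mQ; rewrite (_ : mkset _ = \bigcap_(i in `I_k.+1) [set w | Q i w])//.
by rewrite bigcap_mkcond; apply: bigcapT_measurable => i; case: ifPn.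
Qed.

Lemma measure_negligible_eq d (T : measurableType d) (R : realType)
    (mu : {measure set T -> \bar R}) (A B : set T) :
  measurable A -> measurable B -> B `<=` A -> mu.-negligible (A `\` B) ->
  mu A = mu B.
Proof.
move=> mA mB BA /measure_negligible => /(_ (measurableD mA mB)) h.
rewrite -(setDUK BA) measureU//; first by rewrite h adde0.
- exact: measurableD.
- by rewrite setDE setICA setICr setI0.
Qed.

Lemma measure_eq_mod_null d (T : measurableType d) (R : realType)
    (mu : {measure set T -> \bar R}) (A B N : set T) :
  measurable A -> measurable B -> measurable N -> mu N = 0%E ->
  (forall w, ~ N w -> A w <-> B w) -> mu A = mu B.
Proof.
move=> mA mB mN N0 AB; rewrite (measureDI mu mA mN) (measureDI mu mB mN).
rewrite (subset_measure0 _ _ (@subIsetr _ A N))//; [|exact: measurableI].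
rewrite (subset_measure0 _ _ (@subIsetr _ B N))//; [|exact: measurableI].
congr (mu _ + _)%E; apply/seteqP; split => w [ABw Nw]; split => //; exact/AB.
Qed.

Section FTC.
Context {R : realType}.
Implicit Types (f F : R -> R) (b l a lam : R).

Lemma integral_FTCy f F b l :
  (forall x, b <= x -> 0 <= f x) ->
  (forall x, b <= x -> is_derive x 1 F (f x)) ->
  (forall x, b <= x -> {for x, continuous f}) ->
  F x @[x --> +oo] --> l ->
  (\int[lebesgue_measure]_(x in `[b, +oo[) (f x)%:E = (l - F b)%:E)%E.
Proof.
move=> f0 dF cf Fl.
rewrite (@ge0_continuous_FTC2y _ f F b l) ?EFinB//.
- apply: continuous_in_subspaceT => x.
  by rewrite inE/= in_itv/= andbT => /cf.
- by move=> x bx; have := dF x (ltW bx).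
- apply: cvg_at_right_filter; have := dF b (lexx b) => -[db _].
  exact/differentiable_continuous/derivable1_diffP.
- move=> x; rewrite in_itv/= andbT => bx; rewrite derive1E.
  by have := dF x (ltW bx) => -[].
Qed.

Lemma cvg_expRN_y a : 0 < a -> expR (- (a * x)) @[x --> +oo] --> (0 : R).
Proof.
move=> a0.
rewrite (_ : (fun x => _) = (fun z => expR (- z)) \o (fun z => a * z))//.
apply: (@cvg_comp _ _ _ _ _ _ (pinfty_nbhs R)); last exact: cvgr_expR.
exact: gt0_cvgMry.
Qed.

Lemma continuous_expRN a (x : R) : {for x, continuous (fun x => expR (- (a * x)))}.
Proof.
apply: continuous_comp; last exact: continuous_expR.
by apply: continuousN; apply: continuousM; [exact: cst_continuous|].
Qed.

Lemma is_derive_expRN a (x : R) :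
  is_derive x 1 (fun x : R => - expR (- (a * x)) ) (a * expR (- (a * x))).
Proof.
have d1 : is_derive x 1 (fun x : R => - (a * x)) (- a).
  by apply: is_derive_eq; rewrite /GRing.scale/= mulr1.
have d2 := @is_derive1_comp _ expR (fun x : R => - (a * x)) _ _ _
  (is_derive_expR (- (a * x))) d1.
rewrite (_ : (fun _ => _) = - (expR \o (fun x : R => - (a * x))))//.
by apply: is_derive_eq; rewrite mulrN opprK mulrC.
Qed.

Lemma integral_exp a b : 0 < a ->
  (\int[lebesgue_measure]_(s in `[b, +oo[) (a * expR (- (a * s)))%:E
   = (expR (- (a * b)))%:E)%E.
Proof.
move=> a0; rewrite -[in RHS](opprK (expR _)) -sub0r.
apply: (@integral_FTCy _ (fun x => - expR (- (a * x)))).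
- by move=> x _; rewrite mulr_ge0 ?expR_ge0 ?ltW.
- by move=> x _; exact: is_derive_expRN.
- move=> x _; apply: continuousM; first exact: cst_continuous.
  exact: continuous_expRN.
- by rewrite -oppr0; apply: cvgN; exact: cvg_expRN_y.
Qed.
End FTC.

Lemma measurable_bool_natr d (T : measurableType d) (R : realType)
    (g : T -> bool) : measurable_fun [set: T] g ->
  measurable_fun [set: T] (fun x => (g x)%:R : R).
Proof. by move=> mg; apply: (measurableT_comp (f := fun b : bool => b%:R : R)). Qed.

Lemma tonelli_on d1 d2 (T1 : measurableType d1) (T2 : measurableType d2)
    (R : realType) (m1 : {sigma_finite_measure set T1 -> \bar R})
    (m2 : {sigma_finite_measure set T2 -> \bar R}) (A : set T1) (B : set T2)
    (f : T1 -> T2 -> \bar R) :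
  measurable A -> measurable B ->
  measurable_fun [set: T1 * T2] (fun z => f z.1 z.2) ->
  (forall x y, A x -> B y -> 0 <= f x y)%E ->
  (\int[m1]_(x in A) \int[m2]_(y in B) f x y =
   \int[m2]_(y in B) \int[m1]_(x in A) f x y)%E.
Proof.
move=> mA mB mf f0.
pose g (z : T1 * T2) := (f z.1 z.2 * (\1_A z.1)%:E * (\1_B z.2)%:E)%E.
have mg : measurable_fun [set: T1 * T2] g.
  apply: emeasurable_funM; first apply: emeasurable_funM => //.
  - by apply/measurable_EFinP; apply: measurableT_comp.
  - by apply/measurable_EFinP; apply: measurableT_comp.
have g0 z : (0 <= g z)%E.
  rewrite /g !indicE; have [/set_mem Az|_] := boolP (z.1 \in A); last first.
    by rewrite mule0 mul0e.
  have [/set_mem Bz|_] := boolP (z.2 \in B); last by rewrite mule0.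
  by rewrite !mule1 f0.
have := @fubini_tonelli _ _ _ _ _ m1 m2 g mg g0.
rewrite /g/=; move=> h.
rewrite [LHS]integral_mkcond [RHS]integral_mkcond.
transitivity (\int[m1]_x \int[m2]_y (f x y * (\1_A x)%:E * (\1_B y)%:E))%E.
  apply: eq_integral => x _; rewrite patchE; case: ifPn => xA.
    rewrite integral_mkcond; apply: eq_integral => y _.
    by rewrite patchE !indicE xA mule1; case: ifPn => yB; rewrite ?mule1 ?mule0.
  rewrite integral0_eq// => y _.
  by rewrite indicE (negbTE xA) mule0 mul0e.
rewrite h; apply: eq_integral => y _; rewrite patchE; case: ifPn => yB.
  rewrite [RHS]integral_mkcond; apply: eq_integral => x _.
  by rewrite patchE !indicE yB mule1; case: ifPn => xA; rewrite ?mule1 ?mule0.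
by rewrite integral0_eq// => x _; rewrite [\1_B _]indicE (negbTE yB) mule0.
Qed.

Ltac nonneg := repeat first
  [exact: ltW | exact: expR_ge0 | exact: ler0n | apply: mulr_ge0 | apply: prodr_ge0].

(** Solves for [u] without knowing that it is finite. Integral identities below are therefore
    prepared with a sum on the left, never a difference. *)
Lemma mulD_eq_fin (R : realType) (a y z : R) (u : \bar R) : 0 < a ->
  (a%:E * u + y%:E = z%:E)%E -> u = ((z - y) / a)%:E.
Proof.
move=> a0; case: u => [r| |]; rewrite ?gt0_muley ?gt0_muleNy ?lte_fin//.
by rewrite -EFinM -EFinD => -[<-]; rewrite addrK mulrC mulKf// gt_eqF.
Qed.

(** * Laplace representation of the density 1/t *)

Section log_integral.
Context {R : realType}.
Implicit Types (a b c t : R).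
Local Notation leb := (@lebesgue_measure R).

Lemma integral_invr t : 0 < t ->
  (\int[leb]_(a in `]0%R, +oo[) (expR (- (a * t)))%:E = (t^-1)%:E)%E.
Proof.
move=> t0.
have := integral_exp 0 t0; rewrite mulr0 oppr0 expR0.
have mexp : measurable_fun [set: R] (fun a => (expR (- (t * a)))%:E).
  apply/measurable_EFinP; apply: measurableT_comp => //.
  by apply: measurableT_comp => //; exact: measurable_funM.
rewrite -integral_itv_obnd_cbnd; last first.
  apply: measurable_funTS; apply/measurable_EFinP; apply: measurable_funM => //.
  exact/measurable_EFinP.
under eq_integral do rewrite EFinM.
rewrite ge0_integralZl ?lee_fin ?ltW//; last exact: measurable_funTS.
under eq_integral do rewrite mulrC.
set I := (X in (_ * X)%E).
move=> h.
rewrite -[LHS]mul1e -[X in (X * _)%E](_ : (t^-1)%:E * t%:E = 1)%E; last first.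
  by rewrite -EFinM mulVf// gt_eqF.
by rewrite -muleA h mule1.
Qed.

Lemma integral_tail (f : R -> R) b : 0 < b -> measurable_fun [set: R] f ->
  (\int[leb]_(t in `]0%R, +oo[) (f t * (b <= t)%R%:R)%:E =
   \int[leb]_(t in `[b, +oo[) (f t)%:E)%E.
Proof.
move=> b0 mf.
rewrite [LHS]integral_mkcond [RHS]integral_mkcond.
apply: eq_integral => t _; rewrite !patchE !mem_setE !in_itv/= !andbT.
case: (leP b t) => bt; last by rewrite mulr0 if_same.
by rewrite (lt_le_trans b0 bt) mulr1.
Qed.

Lemma measurable_expRM d (T : measurableType d) (f g : T -> R) :
  measurable_fun [set: T] f -> measurable_fun [set: T] g ->
  measurable_fun [set: T] (fun x => expR (- (f x * g x))).
Proof.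
move=> mf mg; apply: measurableT_comp => //; apply: measurableT_comp => //.
exact: measurable_funM.
Qed.

Lemma integral_exp_itv a b c : 0 < a -> 0 < b -> b <= c ->
  (\int[leb]_(t in `]0%R, +oo[) (expR (- (a * t)) * (b <= t < c)%R%:R)%:E =
   ((expR (- (a * b)) - expR (- (a * c))) / a)%:E)%E.
Proof.
move=> a0 b0 bc; have c0 := lt_le_trans b0 bc.
have mf : measurable_fun [set: R] (fun t => a * expR (- (a * t))).
  by apply: measurable_funM => //; exact: measurable_expRM.
have mb x : measurable_fun [set: R] (fun t => (x <= t)%R%:R : R).
  by apply: measurable_bool_natr; exact: measurable_fun_ler.
have mbc : measurable_fun [set: R]
    (fun t => (expR (- (a * t)) * (b <= t < c)%R%:R)%:E).
  apply/measurable_EFinP; apply: measurable_funM; first exact: measurable_expRM.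
  apply: measurable_bool_natr; apply: measurable_and.
    exact: measurable_fun_ler.
  exact: measurable_fun_ltr.
have := integral_exp b a0; have := integral_exp c a0.
rewrite -!integral_tail// => hc hb.
have h : (a%:E * (\int[leb]_(t in `]0%R, +oo[)
    (expR (- (a * t)) * (b <= t < c)%R%:R)%:E) + (expR (- (a * c)))%:E =
  (expR (- (a * b)))%:E)%E.
  rewrite -hc -hb -ge0_integralZl ?lee_fin ?ltW//; last exact: measurable_funTS.
  rewrite -ge0_integralD//; last 4 first.
  - by move=> t _; rewrite -EFinM lee_fin; nonneg.
  - by apply: measurable_funTS; apply: emeasurable_funM.
  - by move=> t _; rewrite lee_fin; nonneg.
  - apply: measurable_funTS; apply/measurable_EFinP.
    by apply: measurable_funM; [exact: mf|exact: mb].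
  apply: eq_integral => t _; rewrite -EFinM -EFinD; congr (_%:E).
  rewrite mulrA -mulrDr; congr (_ * _).
  case: (leP c t) => ct; first by rewrite (le_trans bc ct) andbF add0r.
  by rewrite addr0 andbT.
exact: mulD_eq_fin h.
Qed.

(** Both sides integrate [expR (- (a * t))] over [b <= t < c] and [a > 0]. With [b] and [c]
    successive jump times, only exponentials of jump times are left to average. *)
Lemma integral_invr_itv b c : 0 < b -> b <= c ->
  (\int[leb]_(t in `]0%R, +oo[) (t^-1 * (b <= t < c)%R%:R)%:E =
   \int[leb]_(a in `]0%R, +oo[) ((expR (- (a * b)) - expR (- (a * c))) / a)%:E)%E.
Proof.
move=> b0 bc.
transitivity (\int[leb]_(t in `]0%R, +oo[) \int[leb]_(a in `]0%R, +oo[)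
    (expR (- (a * t)) * (b <= t < c)%R%:R)%:E)%E.
  apply: eq_integral => t; rewrite inE/= in_itv/= andbT => t0.
  rewrite EFinM -integral_invr//.
  under [RHS]eq_integral do rewrite mulrC EFinM.
  rewrite ge0_integralZl ?lee_fin//; first by rewrite muleC.
  by apply: measurable_funTS; apply/measurable_EFinP; exact: measurable_expRM.
rewrite tonelli_on//.
- apply: eq_integral => a; rewrite inE/= in_itv/= andbT => a0.
  exact: integral_exp_itv.
- apply/measurable_EFinP; apply: measurable_funM; first exact: measurable_expRM.
  apply: measurable_bool_natr; apply: measurable_and.
    exact: measurable_fun_ler.
  exact: measurable_fun_ltr.
Qed.
End log_integral.

(** * Laplace transforms of sums of exponential times *)

Section tilt.
Context d (T : measurableType d) {R : realType} (P : probability T R).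
Implicit Types (F g : T -> R) (a lam c : R).
Local Notation leb := (@lebesgue_measure R).

(** [c - c * expR (- (lam * s))] is the mass of the event that an exponential time of rate [lam] is
    at most [s], so [lam / (lam + a)] is the chance that it rings before an independent one of rate
    [a]. *)
Lemma integral_exp_exp a lam c : 0 < a -> 0 < lam -> 0 <= c ->
  (\int[leb]_(s in `]0%R, +oo[)
    (a * expR (- (a * s)) * (c - c * expR (- (lam * s))))%:E =
   (c * (lam / (lam + a)))%:E)%E.
Proof.
move=> a0 lam0 c0; have la0 : 0 < a + lam by rewrite addr_gt0.
have n1 : a + lam != 0 by rewrite gt_eqF.
have n2 : lam + a != 0 by rewrite addrC.
rewrite integral_itv_obnd_cbnd; last first.
  apply: measurable_funTS; apply/measurable_EFinP; apply: measurable_funM.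
    by apply: measurable_funM => //; exact: measurable_expRM.
  apply: measurable_funB => //; apply: measurable_funM => //.
  exact: measurable_expRM.
pose F s := (a * c) / (a + lam) * expR (- ((a + lam) * s))
            + c * - expR (- (a * s)).
rewrite (_ : c * (lam / (lam + a)) = 0 - F 0); last first.
  rewrite /F !mulr0 oppr0 expR0 !mulr1 mulrN1 sub0r opprD opprK.
  by field; rewrite ?n1 ?n2.
apply: integral_FTCy.
- move=> s s0; apply: mulr_ge0; first by nonneg.
  rewrite subr_ge0 ler_piMr// -expR0 ler_expR oppr_le0; nonneg => //.
- move=> s _.
  have d1 := is_derive_expRN (a + lam) s.
  have d2 := is_derive_expRN a s.
  rewrite /F (_ : (fun _ => _) =
    (- ((a * c) / (a + lam))) \*: (fun s : R => - expR (- ((a + lam) * s)))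
    + c \*: (fun s : R => - expR (- (a * s)))); last first.
    by apply/funext => t; rewrite /GRing.add/= /GRing.scale/= mulrNN.
  apply: is_derive_eq; rewrite /GRing.scale/= mulrBr.
  rewrite (_ : expR (- ((a + lam) * s)) = expR (- (a * s)) * expR (- (lam * s))).
    by field; rewrite ?n1 ?n2.
  by rewrite -expRD; congr expR; ring.
- move=> s _; apply: continuousM.
    by apply: continuousM; [exact: cst_continuous|exact: continuous_expRN].
  apply: continuousB; first exact: cst_continuous.
  by apply: continuousM; [exact: cst_continuous|exact: continuous_expRN].
- rewrite -[X in _ --> X](addr0 0); apply: cvgD.
    rewrite -[X in _ --> X](mulr0 (a * c / (a + lam))); apply: cvgM; first exact: cvg_cst.
    exact: cvg_expRN_y.
  rewrite -[X in _ --> X](mulr0 c); apply: cvgM; first exact: cvg_cst.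
  by rewrite -oppr0; apply: cvgN; exact: cvg_expRN_y.
Qed.

(** [expR (- (a * g w))] is the integral of [a * expR (- (a * s))] over [s >= g w], so after an
    exchange of integrals only the tails of [g] under the density [F] enter. Keeping [F] general
    lets the holding times be integrated out one at a time. *)
Lemma exp_tilt F g a lam c : 0 < a -> 0 < lam -> 0 <= c ->
  measurable_fun [set: T] F -> measurable_fun [set: T] g ->
  (forall w, 0 <= F w) -> (forall w, g w <= 0 -> F w = 0) ->
  (forall s, 0 <= s -> (\int[P]_w (F w * (s < g w)%R%:R)%:E)%E =
                       (c * expR (- (lam * s)))%:E) ->
  (\int[P]_w (F w * expR (- (a * g w)))%:E = (c * (lam / (lam + a)))%:E)%E.
Proof.
move=> a0 lam0 c0 mF mg F0 Fg hF.
transitivity (\int[P]_w \int[leb]_(s in `]0%R, +oo[)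
    (F w * (a * expR (- (a * s)) * (g w <= s)%R%:R))%:E)%E.
  apply: eq_integral => w _.
  have [gw|gw] := lerP (g w) 0.
    by rewrite Fg// mul0r integral0_eq// => s _; rewrite mul0r.
  have mf : measurable_fun [set: R] (fun s => a * expR (- (a * s))).
    by apply: measurable_funM => //; exact: measurable_expRM.
  under [RHS]eq_integral do rewrite EFinM.
  rewrite ge0_integralZl ?lee_fin//; first by rewrite integral_tail// integral_exp.
  - apply: measurable_funTS; apply/measurable_EFinP; apply: measurable_funM => //.
    by apply: measurable_bool_natr; exact: measurable_fun_ler.
  - by move=> s _; rewrite lee_fin; nonneg.
rewrite (@tonelli_on _ _ _ _ _ P leb)//; last 2 first.
- apply/measurable_EFinP; apply: measurable_funM.
    exact: measurableT_comp.
  apply: measurable_funM.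
    by apply: measurable_funM => //; exact: measurable_expRM.
  apply: measurable_bool_natr; apply: measurable_fun_ler => //.
  exact: measurableT_comp.
- by move=> w s _ _; rewrite lee_fin; apply: mulr_ge0 => //; nonneg.
rewrite -integral_exp_exp//; apply: eq_integral => s.
rewrite inE/= in_itv/= andbT => s0.
have mFs : measurable_fun [set: T] (fun w => F w * (s < g w)%R%:R).
  apply: measurable_funM => //; apply: measurable_bool_natr.
  exact: measurable_fun_ltr.
have mFs' : measurable_fun [set: T] (fun w => F w * (g w <= s)%R%:R).
  apply: measurable_funM => //; apply: measurable_bool_natr.
  exact: measurable_fun_ler.
have FE : (\int[P]_w (F w)%:E = c%:E)%E.
  rewrite -[c]mulr1 -expR0 -oppr0 -(mulr0 lam) -hF//.
  apply: eq_integral => w _; case: (ltrP 0 (g w)) => gw; rewrite ?mulr1 ?mulr0//.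
  by rewrite Fg.
under eq_integral do rewrite mulrCA EFinM.
rewrite ge0_integralZl ?lee_fin//; last 3 first.
- exact/measurable_EFinP.
- by move=> w _; rewrite lee_fin; apply: mulr_ge0.
- by nonneg.
have : (\int[P]_w (F w * (g w <= s)%R%:R)%:E + (c * expR (- (lam * s)))%:E =
    c%:E)%E.
  rewrite -hF ?ltW// -ge0_integralD//; last 4 first.
  - by move=> w _; rewrite lee_fin; apply: mulr_ge0.
  - exact/measurable_EFinP.
  - by move=> w _; rewrite lee_fin; apply: mulr_ge0.
  - exact/measurable_EFinP.
  rewrite -FE; apply: eq_integral => w _; rewrite -EFinD -mulrDr.
  by case: ltrP; rewrite ?addr0 ?add0r mulr1.
rewrite -[X in (X + _)%E]mul1e => /(mulD_eq_fin ltr01) ->.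
by rewrite -EFinM divr1.
Qed.
End tilt.

Section hypoexp.
Context {R : realType}.
Implicit Types (l : seq R) (a : R).
Local Notation leb := (@lebesgue_measure R).

(** The Laplace transform at [a] of a sum of independent exponential times with rates [l]. *)
Definition laplace l a : R := \prod_(x <- l) (x / (x + a)).

Lemma ratio_ge0 (x a : R) : 0 < x -> 0 <= a -> 0 <= x / (x + a).
Proof.
by move=> x0 a0; apply: divr_ge0; [exact: ltW|apply: addr_ge0 => //; exact: ltW].
Qed.

Lemma laplace_ge0 l a : {in l, forall x, 0 < x} -> 0 <= a -> 0 <= laplace l a.
Proof.
move=> l0 a0; rewrite /laplace big_seq; apply: prodr_ge0 => x /l0 x0.
exact: ratio_ge0.
Qed.

Lemma is_derive_laplace l a : {in l, forall x, 0 < x} -> 0 <= a ->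
  is_derive a 1 (fun a : R => - laplace l a)
    (laplace l a * \sum_(x <- l) (x + a)^-1).
Proof.
move=> l0 a0; elim: l l0 => [|x l IH] l0.
  rewrite big_nil mulr0 (_ : (fun _ => _) = cst (-1)); first exact: is_derive_cst.
  by apply/funext => t; rewrite /laplace big_nil.
have x0 : 0 < x by apply: l0; rewrite mem_head.
have {}IH := IH (fun y yl => l0 y (mem_behead (s := x :: l) yl)).
have xa : x + a != 0 by rewrite gt_eqF// ltr_pwDl.
have d1 : is_derive a 1 (fun b : R => x + b) 1.
  have := @is_deriveD _ _ _ (cst x) id a (1 : R) 0 1 _ _.
  by rewrite add0r; apply.
have d2 := @is_deriveV _ (fun b : R => x + b) a 1 _ xa d1.
rewrite (_ : (fun _ => _) =
   x *: ((fun b : R => (x + b)^-1) * (fun b : R => - laplace l b))); last first.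
  by apply/funext => t; rewrite /laplace big_cons -mulrN -mulrA.
apply: is_derive_eq.
rewrite /GRing.scale/= /laplace !big_cons -/(laplace l a).
by field.
Qed.

Lemma cvg_laplace l : {in l, forall x, 0 < x} -> l != [::] ->
  - laplace l a @[a --> +oo] --> (0 : R).
Proof.
case: l => // x l l0 _; have x0 : 0 < x by apply: l0; rewrite mem_head.
rewrite -oppr0; apply: cvgN.
apply: (@squeeze_cvgr _ _ _ _ (cst 0) (fun a => x / (x + a))).
- near=> a; have a0 : 0 <= a by near: a; apply: nbhs_pinfty_ge.
  rewrite laplace_ge0//= /laplace big_cons ler_piMr//.
    exact: ratio_ge0.
  rewrite big_seq; apply: prodr_ile1 => y yl.
  have y0 : 0 < y by apply: l0; rewrite inE yl orbT.
  by rewrite ratio_ge0//= ler_pdivrMr ?ltr_pwDl// mul1r lerDl.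
- exact: cvg_cst.
- rewrite -[X in _ --> X](mulr0 x); apply: cvgM; first exact: cvg_cst.
  apply/gtr0_cvgV0; last exact: cvg_addrl.
  near=> a; have a0 : 0 <= a by near: a; apply: nbhs_pinfty_ge.
  by rewrite ltr_pwDl.
Unshelve. all: by end_near. Qed.
End hypoexp.

Section holding.
Context {R : realType}.
Local Notation leb := (@lebesgue_measure R).

(** The integrand is the derivative of [- laplace l], which goes from -1 at 0 to 0 at infinity; for
    empty [l] it would stay at -1. *)
Lemma integral_laplace (l : seq R) : {in l, forall x, 0 < x} -> l != [::] ->
  (\int[leb]_(a in `]0%R, +oo[)
    (laplace l a * \sum_(x <- l) (x + a)^-1)%:E = 1)%E.
Proof.
move=> l0 nl.
have cl (a : R) : 0 <= a ->
    {for a, continuous (fun a : R => laplace l a * \sum_(x <- l) (x + a)^-1)}.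
  move=> a0; apply: continuousM.
    have [db _] := is_derive_laplace l0 a0.
    rewrite (_ : laplace l = - (fun a : R => - laplace l a)); last first.
      by apply/funext => b; rewrite /GRing.opp/= opprK.
    by apply/continuousN/differentiable_continuous/derivable1_diffP.
  elim: (l) l0 => [|x l' IH] l0'.
    have -> : (fun b : R => \sum_(x <- [::]) (x + b)^-1) = cst 0.
      by apply/funext => b; rewrite big_nil.
    exact: cst_continuous.
  have -> : (fun b : R => \sum_(y <- x :: l') (y + b)^-1) =
      (fun b => (x + b)^-1 + \sum_(y <- l') (y + b)^-1).
    by apply/funext => b; rewrite big_cons.
  apply: continuousD; last first.
    by apply: IH => y yl; apply: l0'; rewrite inE yl orbT.
  apply: continuousV; first by rewrite gt_eqF// ltr_pwDl ?l0' ?mem_head.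
  by apply: continuousD; [exact: cst_continuous|exact: cvg_id].
rewrite integral_itv_obnd_cbnd; last first.
  apply/measurable_EFinP; apply: open_continuous_measurable_fun => // a.
  by rewrite inE/= in_itv/= andbT => /ltW/cl.
rewrite (_ : 1 = 0 - (- laplace l 0))%R; last first.
  rewrite opprK add0r /laplace big_seq big1// => x /l0 x0.
  by rewrite addr0 divff// gt_eqF.
apply: (@integral_FTCy _ _ (fun a : R => - laplace l a)).
- move=> a a0; apply: mulr_ge0; first exact: laplace_ge0.
  rewrite big_seq; apply: sumr_ge0 => x /l0 x0.
  by rewrite invr_ge0; apply: addr_ge0 => //; exact: ltW.
- by move=> a; exact: is_derive_laplace.
- by move=> a; exact: cl.
- exact: cvg_laplace.
Qed.

Lemma measurable_invr (D : set R) : measurable_fun D (@GRing.inv R).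
Proof.
apply: measurable_funTS; rewrite -(setUv [set 0%R]).
apply/measurable_funU => //; first exact: measurableC.
split; first exact: measurable_fun_set1.
apply: open_continuous_measurable_fun.
  by apply/closed_openC; exact: closed_eq.
by move=> x; rewrite inE/= => /eqP x0; exact: inv_continuous.
Qed.

Context d (T : measurableType d) (P : probability T R) (H : nat -> T -> \bar R)
  (k : nat) (lam : nat -> R) (c : R) (E : set T).
Hypotheses (mH : forall i, measurable_fun [set: T] (H i)) (mE : measurable E)
  (lam0 : forall i, 0 < lam i) (c0 : 0 <= c) (k0 : (0 < k)%N)
  (PE : P E = c%:E)
  (law : forall s : nat -> R, (forall i, 0 <= s i) ->
    P (E `&` [set w | forall i, (i <= k)%N -> ((s i)%:E < H i w)%E]) =
    (c * \prod_(i < k.+1) expR (- (lam i * s i)))%:E).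

Let finH := [set w | forall i, (i <= k)%N -> (0 < H i w < +oo)%E].
Let E0 := E `&` finH.
Let h i w := fine (H i w).
Let J j w := \sum_(0 <= i < j) h i w.

Let mlt (s : nat -> R) :
  measurable [set w | forall i, (i <= k)%N -> ((s i)%:E < H i w)%E].
Proof.
apply: measurable_forall_le => i; rewrite -[X in measurable X]setTI.
exact: emeasurable_fun_o_infty.
Qed.

Let mfinH : measurable finH.
Proof.
apply: measurable_forall_le => i.
rewrite (_ : mkset _ = [set w | 0 < H i w]%E `&` [set w | H i w < +oo]%E); last first.
  by apply/seteqP; split => w /= => [/andP[]|[-> ->]].
apply: measurableI; rewrite -[X in measurable X]setTI.
  exact: emeasurable_fun_o_infty.
exact: emeasurable_fun_infty_o.
Qed.

Let mE0 : measurable E0. Proof. exact: measurableI. Qed.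

Let PE0pos : P (E `&` [set w | forall i, (i <= k)%N -> (0%:E < H i w)%E]) = c%:E.
Proof.
rewrite (law (s := fun=> 0))// big1 ?mulr1// => i _.
by rewrite mulr0 oppr0 expR0.
Qed.

Let Hy_null i : (i <= k)%N ->
  P (E `&` [set w | forall i, (i <= k)%N -> (0%:E < H i w)%E]
       `&` [set w | H i w = +oo%E]) = 0%E.
Proof.
move=> ik.
have my : measurable [set w | H i w = +oo%E].
  rewrite -[X in measurable X]setTI.
  exact: (mH i) measurableT _ (emeasurable_set1 _).
set A := (X in P X).
have Ab x : 0 <= x -> (P A <= (c * expR (- (lam i * x)))%:E)%E.
  move=> x0; pose s j := if j == i then x else 0.
  have s0 j : 0 <= s j by rewrite /s; case: ifP.
  have -> : (c * expR (- (lam i * x)))%:E =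
      P (E `&` [set w | forall i, (i <= k)%N -> ((s i)%:E < H i w)%E]).
    rewrite law// (bigD1 (Ordinal (ik : i < k.+1)%N))//= /s eqxx big1 ?mulr1//.
    move=> j; rewrite -val_eqE/= => /negbTE ->.
    by rewrite mulr0 oppr0 expR0.
  apply: le_measure; rewrite ?inE.
  - by apply: measurableI => //; apply: measurableI.
  - exact: measurableI.
  - move=> w [[Ew Hw] /= wy]; split => //= j jk; rewrite /s.
    by case: eqP => [->|_]; [rewrite wy ltry|exact: Hw].
apply/eqP; rewrite eq_le measure_ge0 andbT.
have fA : P A \is a fin_num.
  by apply: fin_num_measure; apply: measurableI => //; exact: measurableI.
have cv : c * expR (- (lam i * x)) @[x --> +oo] --> (0 : R).
  rewrite -[X in _ --> X](mulr0 c); apply: cvgM; first exact: cvg_cst.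
  exact: cvg_expRN_y.
rewrite -(fineK fA) lee_fin; apply: (cvgr_to_ge cv).
near=> x; have x0 : 0 <= x by near: x; exact: nbhs_pinfty_ge.
by rewrite -lee_fin fineK// Ab.
Unshelve. all: by end_near. Qed.

(** [law] at thresholds 0 gives back the mass [c] of [PE], so on [E] the times are positive almost
    surely; letting one threshold grow rules out infinite times. *)
Let PE0 (B : set T) : measurable B -> P (E `&` B) = P (E0 `&` B).
Proof.
move=> mB; apply: measure_negligible_eq; try exact: measurableI.
  by apply: setSI; exact: subIsetl.
set N := E `&` [set w | forall i, (i <= k)%N -> (0%:E < H i w)%E].
have mN : measurable N by exact: measurableI.
apply: (@negligibleS _ _ _ _ ((E `\` N) `|`
    \bigcup_(i in `I_k.+1) (N `&` [set w | H i w = +oo%E]))).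
  move=> w [[Ew Bw] nEw].
  have [Nw|Nw] := pselect (N w); last by left.
  right; apply: contrapT => nw; apply: nEw; split => //; split => //= i ik.
  rewrite Nw.2//= ltey; apply/negP => /eqP wy; apply: nw; exists i => //.
apply: negligibleU.
  exists (E `\` N); split => //; first exact: measurableD.
  rewrite measureD//; last by rewrite ltey_eq fin_num_measure.
  rewrite setIidr; last exact: subIsetl.
  by rewrite [X in (X - _)%E]PE [X in (_ - X)%E]PE0pos subee.
rewrite bigcup_mkcond; apply: negligible_bigcup => i.
case: ifPn => [|_]; last exact: negligible_set0.
rewrite inE/= => ik; exists (N `&` [set w | H i w = +oo%E]); split => //.
  apply: measurableI => //; rewrite -[X in measurable X]setTI.
  exact: (mH i) measurableT _ (emeasurable_set1 _).
exact: Hy_null.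
Qed.

Lemma holding_fin_null :
  P (E `&` ~` [set w | forall i, (i <= k)%N -> (0 < H i w < +oo)%E]) = 0%E.
Proof. by rewrite PE0 -?setIA ?setICr ?setI0 ?measure0//; exact: measurableC. Qed.

Let hE i w : E0 w -> (i <= k)%N -> H i w = (h i w)%:E /\ 0 < h i w.
Proof.
move=> [_ /(_ i)] /[swap] ik /(_ ik); rewrite /h.
by case: (H i w) => [r| |] //= /andP[]; rewrite ?lte_fin.
Qed.

Let mh i : measurable_fun [set: T] (h i).
Proof. by apply: measurableT_comp. Qed.

Let mJ j : measurable_fun [set: T] (J j).
Proof. exact: measurable_sum. Qed.

(** Interpolates between [law], which knows the times through their tails ([j = 0]), and the Laplace
    transform of their sum ([j = k.+1]). *)
Let F (s : nat -> R) (a : R) (j : nat) w : R :=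
  \1_E0 w * expR (- (a * J j w)) * \prod_(j <= i < k.+1) (s i < h i w)%R%:R.

Let laplace_J (a : R) j s : 0 < a -> (j <= k.+1)%N -> (forall i, 0 <= s i) ->
  (\int[P]_w (F s a j w)%:E =
   (c * laplace [seq lam i | i <- iota 0 j] a *
    \prod_(j <= i < k.+1) expR (- (lam i * s i)))%:E)%E.
Proof.
move=> a0; elim: j s => [|j IH] s jk s0.
  rewrite /laplace big_nil mulr1 big_mkord -law// PE0//.
  rewrite -[X in P X]setIT -integral_indic//; last exact: measurableI.
  apply: eq_integral => w _; congr (_%:E).
  rewrite /F /J big_nil mulr0 oppr0 expR0 mulr1 indicI/= [\1_E0 w]indicE.
  have [/set_mem Ew|_] := boolP (w \in E0); last by rewrite !mul0r.
  rewrite !mul1r indicE big_mkord; have [Bw|nB] := boolP (w \in _).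
    rewrite big1// => i _; rewrite -lte_fin; have ik : (i <= k)%N by rewrite -ltnS.
    by have [<- _] := hE Ew ik; move/set_mem : Bw => ->.
  have [i si] : exists i : 'I_k.+1, h i w <= s i.
    apply: contrapT => /forallNP hs; move/negP : nB; apply; apply/mem_set => i ik.
    have [-> _] := hE Ew ik; have := hs (Ordinal (ik : i < k.+1)%N).
    by move/negP; rewrite -ltNge lte_fin.
  by rewrite (bigD1 i)//= ltNge si mul0r.
have sj0 : 0 <= \prod_(j.+1 <= i < k.+1) expR (- (lam i * s i)).
  by apply: prodr_ge0 => i _; exact: expR_ge0.
have lap0 : 0 <= laplace [seq lam i | i <- iota 0 j] a.
  by apply: laplace_ge0; [move=> _ /mapP[i _ ->]|exact: ltW].
rewrite -addn1 iotaD map_cat /laplace big_cat/= big_seq1 add0n -/(laplace _ _).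
rewrite [X in X%:E](_ : _ = c * laplace [seq lam i | i <- iota 0 j] a
   * \prod_(j.+1 <= i < k.+1) expR (- (lam i * s i)) * (lam j / (lam j + a)));
  last by rewrite addn1; ring.
transitivity (\int[P]_w (\1_E0 w * expR (- (a * J j w)) *
   \prod_(j.+1 <= i < k.+1) (s i < h i w)%R%:R * expR (- (a * h j w)))%:E)%E.
  apply: eq_integral => w _; rewrite /F addn1 /J big_nat_recr//= mulrDr opprD expRD.
  by congr (_%:E); ring.
apply: exp_tilt => //.
- by apply: mulr_ge0 => //; apply: mulr_ge0.
- apply: measurable_funM; last first.
    apply: measurable_prod => i _; apply: measurable_bool_natr.
    exact: measurable_fun_ltr.
  by apply: measurable_funM => //; exact: measurable_expRM.
- move=> w; apply: mulr_ge0; last by apply: prodr_ge0.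
  by apply: mulr_ge0 => //; exact: expR_ge0.
- move=> w hw; rewrite indicE memNset ?mul0r// => /hE/(_ jk)[_].
  by rewrite ltNge hw.
(* The tail hypothesis of [exp_tilt] at level [r] is the induction hypothesis with the [j]-th
   threshold replaced by [r]. *)
move=> r r0; pose s' i := if i == j then r else s i.
have s'0 i : 0 <= s' i by rewrite /s'; case: ifP.
have := IH s' (ltnW jk) s'0.
rewrite big_ltn// {2}/s' eqxx.
under eq_big_nat.
  move=> i /andP[ji _]; rewrite /s' (gtn_eqF ji); over.
move=> IHj; transitivity (\int[P]_w (F s' a j w)%:E)%E; last first.
  by rewrite IHj; congr (_%:E); rewrite /=; ring.
apply: eq_integral => w _; congr (_%:E).
rewrite /F [in RHS]big_ltn// [s' j]/s' eqxx.
under [in RHS]eq_big_nat.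
  move=> i /andP[ji _]; rewrite /s' (gtn_eqF ji); over.
by rewrite /=; ring.
Qed.

(* With [1/t] written as the integral of [expR (- (a * t))] over [a], only Laplace
   transforms of sums of exponential times are involved. *)
Lemma integral_holding :
  (\int[leb]_(t in `]0%R, +oo[)
     ((t^-1)%:E * P (E `&` [set w | in_sojourn H k t w])) =
   \int[leb]_(a in `]0%R, +oo[)
     (c * laplace [seq lam i | i <- iota 0 k] a * (lam k + a)^-1)%:E)%E.
Proof.
pose ind t w : R := \1_E0 w * (J k w <= t < J k.+1 w)%R%:R.
have JE j w : E0 w -> (j <= k.+1)%N -> jump_time H j w = (J j w)%:E.
  move=> Ew jk; rewrite /jump_time /J big_mkord -sumEFin.
  apply: eq_bigr => i _.
  by have [] := hE Ew (leq_trans (ltn_ord i) jk : (i.+1 <= k.+1)%N).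
(* Here [k0] matters: the sojourn begins after a positive time, away from the singularity of
   [1/t]. *)
have Jk0 w : E0 w -> 0 < J k w.
  move=> Ew; rewrite /J -(prednK k0) big_nat_recl//=.
  apply: ltr_pwDl; first by have [] := hE Ew (leq0n k).
  rewrite big_nat; apply: sumr_ge0 => i /andP[_ ik].
  have [] := @hE i.+1 w Ew; last by move=> _ /ltW.
  by rewrite (leq_trans ik)// leq_pred.
have Jkk w : E0 w -> J k w <= J k.+1 w.
  by move=> Ew; rewrite /J big_nat_recr//= lerDl ltW//; have [] := hE Ew (leqnn k).
have mind : measurable_fun [set: R * T] (fun z => ind z.1 z.2).
  apply: measurable_funM; first exact: measurableT_comp.
  apply: measurable_bool_natr; apply: measurable_and.
    by apply: measurable_fun_ler => //; exact: measurableT_comp.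
  by apply: measurable_fun_ltr => //; exact: measurableT_comp.
transitivity (\int[leb]_(t in `]0%R, +oo[) \int[P]_w ((t^-1 * ind t w)%:E))%E.
  apply: eq_integral => t; rewrite inE/= in_itv/= andbT => t0.
  under [RHS]eq_integral do rewrite EFinM.
  rewrite ge0_integralZl//; last 3 first.
  - apply/measurable_EFinP; apply: measurable_funM => //.
    apply: measurable_bool_natr; apply: measurable_and.
      exact: measurable_fun_ler.
    exact: measurable_fun_ltr.
  - by move=> w _; rewrite lee_fin; apply: mulr_ge0.
  - by rewrite lee_fin invr_ge0 ltW.
  congr (_ * _)%E.
  have mS : measurable [set w | in_sojourn H k t w].
    have mjt j : measurable_fun [set: T] (jump_time H j).
      exact: emeasurable_sum.
    apply: measurableI; rewrite -[X in measurable X]setTI.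
      exact: emeasurable_fun_infty_c.
    exact: emeasurable_fun_o_infty.
  rewrite PE0// -[X in P X]setIT -integral_indic//; last exact: measurableI.
  apply: eq_integral => w _; rewrite /ind indicI/=; congr (_%:E).
  rewrite [\1_E0 w]indicE.
  have [/set_mem Ew|_] := boolP (w \in E0); last by rewrite !mul0r.
  congr (_ * _); rewrite indicE; congr (nat_of_bool _)%:R.
  apply/idP/idP => [/set_mem[]|/andP[h1 h2]].
    by rewrite !JE// ?lee_fin ?lte_fin => -> ->.
  by apply/mem_set; split; rewrite JE// ?lee_fin ?lte_fin.
rewrite (@tonelli_on _ _ _ _ _ leb P)//; last 2 first.
- apply/measurable_EFinP; apply: measurable_funM => //.
  by apply: measurableT_comp => //; exact: measurable_invr.
- move=> t w /=; rewrite in_itv/= andbT => t0 _; rewrite lee_fin.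
  by apply: mulr_ge0; [rewrite invr_ge0 ltW|apply: mulr_ge0].
pose f (a : R) w := (expR (- (a * J k w)) - expR (- (a * J k.+1 w))) / a.
have f0 a w : E0 w -> 0 < a -> 0 <= f a w.
  move=> Ew a0; apply: mulr_ge0; last by rewrite invr_ge0 ltW.
  by rewrite subr_ge0 ler_expR lerN2 ler_pM2l// Jkk.
transitivity (\int[P]_w \int[leb]_(a in `]0%R, +oo[) (\1_E0 w * f a w)%:E)%E.
  apply: eq_integral => w _.
  under eq_integral do rewrite mulrCA EFinM.
  under [RHS]eq_integral do rewrite EFinM.
  have [/set_mem Ew|nE] := boolP (w \in E0); last first.
    rewrite indicE (negbTE nE).
    by rewrite !integral0_eq// => t _; rewrite mul0e.
  have -> : \1_E0 w = 1 :> R by rewrite indicE mem_set.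
  under eq_integral do rewrite mul1e.
  under [RHS]eq_integral do rewrite mul1e.
  by rewrite integral_invr_itv ?Jk0 ?Jkk.
rewrite (@tonelli_on _ _ _ _ _ P leb)//; last 2 first.
- apply/measurable_EFinP; apply: measurable_funM; first exact: measurableT_comp.
  apply: measurable_funM; last first.
    by apply: measurableT_comp => //; exact: measurable_invr.
  by apply: measurable_funB; apply: measurable_expRM => //; exact: measurableT_comp.
- move=> w a _ /=; rewrite in_itv/= andbT => a0; rewrite lee_fin indicE.
  have [/set_mem Ew|_] := boolP (w \in E0); last by rewrite mul0r.
  by rewrite mul1r f0.
apply: eq_integral => a; rewrite inE/= in_itv/= andbT => a0.
have mEe j : measurable_fun [set: T] (fun w => \1_E0 w * expR (- (a * J j w))).
  by apply: measurable_funM => //; exact: measurable_expRM.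
have Ek : (\int[P]_w (\1_E0 w * expR (- (a * J k w)))%:E =
    (c * laplace [seq lam i | i <- iota 0 k] a)%:E)%E.
  have := @laplace_J a k (fun=> 0) a0 (leqnSn k) (fun=> lexx 0).
  rewrite [X in (_ * X)%:E]big1 ?mulr1; last first.
    by move=> i _; rewrite mulr0 oppr0 expR0.
  move=> <-; apply: eq_integral => w _; rewrite /F big_nat1 indicE.
  have [/set_mem Ew|_] := boolP (w \in E0); last by rewrite !mul0r.
  by have [_ ->] := hE Ew (leqnn k); rewrite mulr1.
have Ek1 : (\int[P]_w (\1_E0 w * expR (- (a * J k.+1 w)))%:E =
    (c * laplace [seq lam i | i <- iota 0 k.+1] a)%:E)%E.
  have := @laplace_J a k.+1 (fun=> 0) a0 (leqnn k.+1) (fun=> lexx 0).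
  rewrite big_geq// mulr1 => <-.
  by apply: eq_integral => w _; rewrite /F big_geq// mulr1.
have : (a%:E * \int[P]_w (\1_E0 w * f a w)%:E +
   (c * laplace [seq lam i | i <- iota 0 k.+1] a)%:E =
   (c * laplace [seq lam i | i <- iota 0 k] a)%:E)%E.
  have mf : measurable_fun [set: T] (fun w => (\1_E0 w * f a w)%:E).
    apply/measurable_EFinP; apply: measurable_funM => //; apply: measurable_funM => //.
    by apply: measurable_funB; apply: measurable_expRM.
  have Ef0 w : 0 <= \1_E0 w * f a w.
    rewrite indicE; have [/set_mem Ew|_] := boolP (w \in E0); last by rewrite mul0r.
    by rewrite mul1r f0.
  rewrite -Ek -Ek1 -ge0_integralZl//; last 2 first.
  - by move=> w _; rewrite lee_fin.
  - by rewrite lee_fin ltW.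
  rewrite -ge0_integralD//; last 3 first.
  - by move=> w _; rewrite mule_ge0// lee_fin// ltW.
  - exact: emeasurable_funM.
  - by apply/measurable_EFinP; exact: mEe.
  apply: eq_integral => w _; rewrite -EFinM -EFinD; congr (_%:E).
  by rewrite /f; field; rewrite gt_eqF.
(* The difference of the two transforms has the factor [1 - lam k / (lam k + a) = a / (lam k + a)],
   whose numerator cancels the division by [a]. *)
move=> /(mulD_eq_fin a0) ->; congr (_%:E).
rewrite -addn1 iotaD map_cat /laplace big_cat/= big_seq1 add0n -/(laplace _ _).
have la0 : lam k + a != 0 by rewrite gt_eqF// addr_gt0.
by field; rewrite la0 gt_eqF.
Qed.
End holding.

(** * The jump chain *)

Lemma mkseq_eq (V : eqType) (x : nat -> V) y p : (mkseq x (size p).+1 = y :: p) =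
  (forall i, (i <= size p)%N -> x i = nth y (y :: p) i).
Proof.
apply/propext; split=> [E i ip|E]; first by rewrite -E nth_mkseq.
apply: (@eq_from_nth _ y) => [|i]; rewrite size_mkseq// => ip.
by rewrite nth_mkseq// E.
Qed.

Lemma measurable_mkseq (V : eqType) d (Omega : measurableType d)
    (X : nat -> Omega -> V) k u :
  (forall k v, measurable [set w | X k w = v]) ->
  measurable [set w | mkseq (X^~ w) k = u].
Proof.
move=> mX; have [su|su] := eqVneq (size u) k; last first.
  rewrite (_ : mkset _ = set0)//; apply/seteqP; split => // w /= h.
  by move: su; rewrite -h size_mkseq eqxx.
case: u su => [|y p] <-; first by rewrite (_ : mkset _ = setT)//; apply/seteqP.
under eq_set do rewrite mkseq_eq.
by apply: measurable_forall_le => i; exact: mX.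
Qed.

Section chain_law.
Context (R : realType) (V : countType) (T : tree V) (C : V -> V -> R)
  (C_gt0 : forall x y, y \in nbr T x -> 0 < C x y)
  (nbr0 : forall x, nbr T x != [::])
  (d : measure_display) (Omega : measurableType d)
  (P : V -> probability Omega R) (Y : nat -> Omega -> V)
  (H : nat -> Omega -> \bar R) (X_ctmc : is_ctmc T C P Y H).

Lemma rate_gt0 x : 0 < rate T C x.
Proof.
rewrite /rate; have := nbr0 x; have := @C_gt0 x.
case: (nbr T x) => // y s Cx _; rewrite big_cons ltr_pwDl ?Cx ?mem_head//.
by rewrite big_seq sumr_ge0// => z zs; rewrite ltW// Cx// inE zs orbT.
Qed.

Lemma jump_probE x y :
  jump_prob T C x y = if y \in nbr T x then C x y / rate T C x else 0.
Proof. by rewrite /jump_prob; have := nbr0 x; case: (nbr T x). Qed.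

Lemma jump_prob_ge0 x y : 0 <= jump_prob T C x y.
Proof.
rewrite jump_probE; case: ifPn => // yx.
by rewrite divr_ge0 ?ltW ?rate_gt0 ?C_gt0.
Qed.

Lemma jump_prob_gt0 x y : y \in nbr T x -> 0 < jump_prob T C x y.
Proof. by move=> yx; rewrite jump_probE yx divr_gt0 ?rate_gt0 ?C_gt0. Qed.

Lemma jump_prob_sum x : \sum_(y <- nbr T x) jump_prob T C x y = 1.
Proof.
rewrite big_seq; under eq_bigr => y yx do rewrite jump_probE yx.
by rewrite -big_seq -mulr_suml divff// gt_eqF// rate_gt0.
Qed.

Let event k (z : nat -> V) := [set w | forall i, (i <= k)%N -> Y i w = z i].

Let mevent k z : measurable (event k z).
Proof. by apply: measurable_forall_le => i; exact: ctmc_mY X_ctmc _ _. Qed.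

Let event_ge x k z :
  (((z 0%N == x)%:R * \prod_(i < k) jump_prob T C (z i) (z i.+1))%:E
   <= P x (event k z))%E.
Proof.
have := ctmc_law X_ctmc x k z (s := fun=> 0) (fun=> lexx 0).
rewrite [X in _ * X]big1 ?mulr1; last by move=> i _; rewrite mulr0 oppr0 expR0.
move=> <-; apply: le_measure; rewrite ?inE//; last first.
  by move=> w /= h i /h[].
apply: measurable_forall_le => i; apply: measurableI.
  exact: ctmc_mY X_ctmc _ _.
rewrite -[X in measurable X]setTI; apply: emeasurable_fun_o_infty => //.
exact: ctmc_mH X_ctmc _.
Qed.

Lemma chain_start x z : P x [set w | Y 0%N w = z] = (z == x)%:R%:E.
Proof.
have mY := ctmc_mY X_ctmc 0.
have E0 z' : event 0 (fun=> z') = [set w | Y 0%N w = z'].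
  apply/seteqP; split => [w /(_ 0%N (leqnn _))//|w /= h i].
  by rewrite leqn0 => /eqP ->.
have Px : P x [set w | Y 0%N w = x] = 1%E.
  apply/eqP; rewrite eq_le probability_le1//=.
  by have := event_ge x 0 (fun=> x); rewrite big_ord0 mulr1 eqxx E0.
have [->|zx] := eqVneq z x; first by rewrite Px.
apply/eqP; rewrite eq_le measure_ge0 andbT.
have := @probability_setC _ _ _ (P x) _ (mY x); rewrite Px subee// => h; rewrite -[leRHS]h.
apply: le_measure; rewrite ?inE//; first exact: measurableC.
by move=> w /= ->; apply/eqP.
Qed.

(** [ctmc_law] at thresholds 0 also demands positive holding times, so it directly gives only the
    lower bound [event_ge]. The lower bounds over all next states add up to the probability of the
    shorter path, which leaves no slack. *)
Lemma chain_law x k z : P x [set w | forall i, (i <= k)%N -> Y i w = z i] =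
  ((z 0%N == x)%:R * \prod_(i < k) jump_prob T C (z i) (z i.+1))%:E.
Proof.
rewrite -/(event k z); elim: k z => [|k IH] z.
  rewrite big_ord0 mulr1 -chain_start; congr (P x _).
  apply/seteqP; split => [w /(_ 0%N (leqnn _))//|w /= h i].
  by rewrite leqn0 => /eqP ->.
apply/eqP; rewrite eq_le event_ge andbT.
pose zy y i := if i == k.+1 then y else z i.
have zyz y i : (i <= k)%N -> zy y i = z i.
  by move=> ik; rewrite /zy ltn_eqF.
(* [z k.+1] is listed even when it is not a neighbour, so that jumps of probability 0 are covered by
   the same argument. *)
pose s := z k.+1 :: [seq y <- nbr T (z k) | y != z k.+1].
have us : uniq s.
  by rewrite /= mem_filter eqxx/= filter_uniq// nbr_uniq.
have zyE : zy (z k.+1) = z.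
  by apply/funext => i; rewrite /zy; case: eqP => // ->.
pose q k z := (z 0%N == x)%:R * \prod_(i < k) jump_prob T C (z i) (z i.+1).
have sumq : \sum_(y <- s) q k.+1 (zy y) = q k z.
  have qE y : q k.+1 (zy y) = q k z * jump_prob T C (z k) y.
    rewrite /q big_ord_recr/= mulrA; congr (_ * _); last first.
      by rewrite zyz// /zy eqxx.
    congr (_ * _).
    by apply: eq_bigr => i _; rewrite !zyz//; exact: ltnW.
  under eq_bigr do rewrite qE.
  rewrite -mulr_sumr -[RHS]mulr1; congr (_ * _).
  rewrite -(jump_prob_sum (z k)) big_cons big_filter.
  have [zk|zk] := boolP (z k.+1 \in nbr T (z k)).
    by rewrite [RHS](bigD1_seq (z k.+1))//= nbr_uniq.
  rewrite jump_probE (negbTE zk) add0r big_seq_cond [RHS]big_seq.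
  apply: eq_bigl => y; have [->|] := eqVneq y (z k.+1); rewrite ?andbT//.
  by rewrite (negbTE zk).
have sumP : (\sum_(y <- s) P x (event k.+1 (zy y)) <= P x (event k z))%E.
  rewrite (fsbig_seq _ _ us)/= -measure_fin_bigcup//; last first.
    move=> y y' _ _ [w [h h']].
    have := h k.+1 (leqnn _); rewrite h'// /zy eqxx; exact: esym.
    exact: finite_seq.
  apply: le_measure; rewrite ?inE//.
    by apply: fin_bigcup_measurable => //; exact: finite_seq.
  by move=> w [y _ h] i ik; rewrite -(zyz y)// h// ltnW.
move: sumP; rewrite IH -/(q k z) -sumq -sumEFin !big_cons zyE.
have le2 : (\sum_(y <- [seq y <- nbr T (z k) | y != z k.+1]) (q k.+1 (zy y))%:E <=
    \sum_(y <- [seq y <- nbr T (z k) | y != z k.+1]) P x (event k.+1 (zy y)))%E.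
  by apply: lee_sum => y _; exact: event_ge.
rewrite -/(q k.+1 z) => h.
have : (P x (event k.+1 z) +
    \sum_(y <- [seq y <- nbr T (z k) | y != z k.+1]) (q k.+1 (zy y))%:E <=
  (q k.+1 z)%:E +
    \sum_(y <- [seq y <- nbr T (z k) | y != z k.+1]) (q k.+1 (zy y))%:E)%E.
  by apply: le_trans h; exact: leeD2l.
by rewrite leeD2rE// sumEFin.
Qed.
End chain_law.

(** * Countable sums and paths in a tree *)

Section esum_extra.
Context {R : realType}.
Local Open Scope ereal_scope.

Lemma esumZl (I : choiceType) (A : set I) (f : I -> \bar R) (c : R) :
  (0 <= c)%R -> (forall i, 0 <= f i) ->
  \esum_(i in A) (c%:E * f i) = c%:E * \esum_(i in A) f i.
Proof.
move=> c0 f0; have [->|cn0] := eqVneq c 0%R.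
  by rewrite mul0e esum1// => i _; rewrite mul0e.
have cgt0 : (0 < c)%R by rewrite lt0r cn0.
(* The supremum gives this inequality; the reverse one is its instance [b = c^-1]. *)
have le_c (b : R) (g : I -> \bar R) : (0 <= b)%R -> (forall i, 0 <= g i) ->
    \esum_(i in A) (b%:E * g i) <= b%:E * \esum_(i in A) g i.
  move=> b0 g0; apply: ge_ereal_sup => _ [X [fX XA] <-].
  rewrite -ge0_mule_fsumr// lee_wpmul2l//.
  by apply: ereal_sup_ubound; exists X.
apply/eqP; rewrite eq_le le_c//=.
have cf0 i : 0 <= c%:E * f i by rewrite mule_ge0// lee_fin ltW.
have := @le_c (c^-1)%R (fun i => c%:E * f i)%E _ cf0.
rewrite invr_ge0 => /(_ c0).
under eq_esum do rewrite muleA -EFinM mulVf// mul1e.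
move=> h; have : c%:E * (\esum_(i in A) f i) <=
    c%:E * ((c^-1)%:E * \esum_(i in A) (c%:E * f i)) by rewrite lee_wpmul2l// lee_fin.
by rewrite muleA -EFinM divff// mul1e.
Qed.

Lemma esum_restrict (I : choiceType) (A B : set I) (f : I -> \bar R) :
  (forall i, A i -> ~ B i -> f i = 0) ->
  \esum_(i in A) f i = \esum_(i in A `&` B) f i.
Proof.
move=> f0; rewrite esum_mkcondr; apply: eq_esum => i Ai.
by case: ifPn => // /negP nB; apply: f0 => // Bi; apply/nB/mem_set.
Qed.

(** Turns a count times a weight into a sum over marks, so that marked words can be matched
    bijectively. *)
Lemma esum_nat_bool (n : nat) (b : nat -> bool) (c : \bar R) : 0 <= c ->
  \esum_(i in [set i | (i < n)%N /\ b i]) c = (\sum_(i < n) b i)%N%:R%:E * c.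
Proof.
move=> c0; rewrite -[X in esum X _]/(`I_n `&` [set i | b i]) esum_mkcondr.
rewrite esum_fset//; last by move=> i _; case: ifP.
rewrite -(fsbig_ord _ _ (fun i => if i \in [set i | b i] then c else 0)).
rewrite natr_sum -sumEFin ge0_sume_distrl; last by move=> i _; rewrite lee_fin.
apply: eq_bigr => i _; case: ifPn; last first.
  move=> /negP nb; case bi : (b i); last by rewrite mul0e.
  by exfalso; apply/nb/mem_set.
by move=> /set_mem /= ->; rewrite mul1e.
Qed.

Lemma measurable_bigcup_count d (T : measurableType d) (I : countType)
    (A : set I) (F : I -> set T) :
  (forall i, A i -> measurable (F i)) -> measurable (\bigcup_(i in A) F i).
Proof.
move=> mF; rewrite bigcup_mkcond; apply: countable_bigcupT_measurable => [|i].
  exact: countableP.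
by case: ifPn => // /set_mem /mF.
Qed.

Lemma ae_forall_count d (T : measurableType d) (mu : {measure set T -> \bar R})
    (I : countType) (Q : I -> T -> Prop) :
  (forall i, {ae mu, forall x, Q i x}) -> {ae mu, forall x, forall i, Q i x}.
Proof.
move=> Qae.
pose Q' n x := if @unpickle I n is Some i then Q i x else True.
have : mu.-negligible (\bigcup_n [set x | ~ Q' n x]).
  apply: negligible_bigcup => n; rewrite /Q'; case: (unpickle n) => [i|].
    exact: Qae.
  by rewrite (_ : mkset _ = set0); [exact: negligible_set0|apply/seteqP; split].
apply: negligibleS => x /= /existsNP[i nQ].
by exists (pickle i) => //; rewrite /= /Q' pickleK.
Qed.

Lemma measure_esum d (T : measurableType d) (mu : {measure set T -> \bar R})
    (I : countType) (A : set I) (F : I -> set T) :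
  (forall i, A i -> measurable (F i)) -> trivIset A F ->
  mu (\bigcup_(i in A) F i) = \esum_(i in A) mu (F i).
Proof.
move=> mF tF.
pose G n := if unpickle n is Some i then F i else set0 : set T.
have GE i : G (pickle i) = F i by rewrite /G pickleK.
have -> : \bigcup_(i in A) F i = \bigcup_(n in pickle @` A) G n.
  by rewrite bigcup_image; apply: eq_bigcupr => i _; rewrite GE.
rewrite measure_bigcup; last 2 first.
- by move=> _ [i Ai <-]; rewrite GE; exact: mF.
- move=> _ _ [i Ai <-] [j Aj <-]; rewrite !GE => h.
  by rewrite (tF i j).
rewrite nneseries_esum// (_ : [set x | x \in pickle @` A] = pickle @` A); last first.
  by apply/seteqP; split => x /=; rewrite inE.
rewrite (@reindex_esum _ _ _ A (pickle @` A) pickle).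
  by apply: eq_esum => i _; rewrite GE.
split=> [i Ai|i j _ _|//]; first by exists i.
exact: (pcan_inj pickleK).
Qed.
End esum_extra.

Section words.
Context {R : realType} {V : countType} (T : tree V).
Implicit Types (x y : V) (p q a e : seq V).

Fixpoint pathw (J : V -> V -> R) x p : R :=
  if p is y :: q then J x y * pathw J y q else 1.

(** Cut off outside the edges, so as to agree with [total_crossings] on arbitrary words. *)
Definition ecr (g : seq V) x y : nat :=
  if y \in nbr T x then crossings g x y else 0%N.

Lemma pathw_cat J x p q :
  pathw J x (p ++ q) = pathw J x p * pathw J (last x p) q.
Proof. by elim: p x => [|y p IH] x /=; rewrite ?mul1r// IH mulrA. Qed.

Lemma pathw_ge0 J x p : (forall x y, 0 <= J x y) -> 0 <= pathw J x p.
Proof. by move=> J0; elim: p x => //= y p IH x; rewrite mulr_ge0. Qed.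

Lemma pathw_path J x p : (forall x y, y \notin nbr T x -> J x y = 0) ->
  pathw J x p != 0 -> path (fun u v => v \in nbr T u) x p.
Proof.
move=> J0; elim: p x => //= y p IH x; rewrite mulf_eq0 negb_or => /andP[Jxy /IH->].
by rewrite andbT; apply: contraNT Jxy => /J0 ->.
Qed.

Lemma crossings_cons x y p u v : crossings (x :: y :: p) u v =
  (((x, y) == (u, v)) + crossings (y :: p) u v)%N.
Proof. by []. Qed.

Lemma crossings_cat x p q u v : crossings (x :: p ++ q) u v =
  (crossings (x :: p) u v + crossings (last x p :: q) u v)%N.
Proof.
by elim: p x => [|y p IH] x //=; rewrite !crossings_cons IH addnA.
Qed.

Lemma ecr_cat x p q u v : ecr (x :: p ++ q) u v =
  (ecr (x :: p) u v + ecr (last x p :: q) u v)%N.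
Proof. by rewrite /ecr crossings_cat; case: ifP. Qed.

Lemma crossings_count x p y : crossings (x :: p) x y =
  (\sum_(i < size p) ((nth x (x :: p) i == x) && (nth x p i == y)))%N.
Proof.
suff H z : crossings (z :: p) x y =
  (\sum_(i < size p) ((nth x (z :: p) i == x) && (nth x p i == y)))%N by exact: H.
elim: p z => [|u p IH] z; first by rewrite big_ord0.
by rewrite crossings_cons big_ord_recl/= IH xpair_eqE.
Qed.

Lemma count_mem_sum x p :
  count_mem x p = (\sum_(i < size p) (nth x p i == x))%N.
Proof.
rewrite -sum1_count big_mkcond/= (big_nth x) big_mkord.
by apply: eq_bigr => i _; case: ifP.
Qed.

Lemma exits_count x p : path (fun u v => v \in nbr T u) x p ->
  forall u, (\sum_(y <- nbr T u) ecr (x :: p) u y = count_mem u (belast x p))%N.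
Proof.
move=> + u; elim: p x => [|z p IH] x /=.
  by move=> _; rewrite big1_seq// => y /andP[_ yu]; rewrite /ecr yu.
move=> /andP[xz /IH <-].
rewrite (eq_bigr (fun y => ((y \in nbr T u) && ((x, z) == (u, y)))
   + ecr (z :: p) u y)%N); last first.
  by move=> y _; rewrite /ecr; case: ifP => // _; rewrite crossings_cons.
rewrite big_split/=; congr (_ + _)%N.
rewrite big_seq (eq_bigr (fun y => nat_of_bool ((x == u) && (y == z)))); last first.
  by move=> y yu; rewrite yu/= xpair_eqE [z == y]eq_sym.
rewrite -big_seq; case: (eqVneq x u) => [xu|_]/=; last by rewrite big1.
rewrite -xu (bigD1_seq z)//=; last exact: nbr_uniq.
by rewrite eqxx big1// => y /negbTE ->.
Qed.

Section tree_facts.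
Variable x0 : V.

Lemma parent_nbr x y : is_parent T x0 x y -> y \in nbr T x.
Proof. by move=> [p [/= /andP[]]]. Qed.

Lemma root_no_parent y : ~ is_parent T x0 x0 y.
Proof.
by move=> [p [_ /= /andP[np _] lp]]; move: np; rewrite -{1}lp mem_last.
Qed.

Lemma parent_exists x : x != x0 -> exists y, is_parent T x0 x y.
Proof.
move=> xx0; have [p [pp lp]] := tree_connected T x x0.
move: pp lp => /shortenP[[|y q] pq uq _] lq.
  by move: lq xx0 => /= ->; rewrite eqxx.
by exists y, q; split.
Qed.

(** If the path missed [x], shortening it and putting [x] in front would give a simple path from [x]
    to [x0] through [y], making [y] the parent. *)
Lemma child_visit x y p : y \in nbr T x -> ~ is_parent T x0 x y ->
  path (fun u v => v \in nbr T u) y p -> last y p = x0 -> x \in y :: p.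
Proof.
move=> yx ny pp lp; apply: contrapT => /negP xp; apply: ny.
move: pp lp xp => /shortenP[q pq uq sq] lq xp; exists q; split => //.
  by rewrite /= yx.
rewrite /= -/(uniq (y :: q)) uq andbT; apply: contra xp.
by rewrite !inE => /orP[->//|/sq ->]; rewrite orbT.
Qed.

(** Otherwise [x :: a ++ u :: rev a'] would be a cycle with more than two vertices. *)
Lemma no_fork x a u b a' b' :
  path (fun u v => v \in nbr T u) x (a ++ u :: b) ->
  path (fun u v => v \in nbr T u) x (a' ++ u :: b') ->
  x \notin a ++ u :: b -> uniq (a ++ u :: b) ->
  x \notin a' ++ u :: b' -> uniq (a' ++ u :: b') ->
  ~~ has (mem (a' ++ u :: b')) a -> a = [::] /\ a' = [::].
Proof.
rewrite -!cat_rcons !cat_path !mem_cat !mem_rcons !inE !negb_or.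
move=> /andP[pa _] /andP[pa' _] /andP[/andP[xu xa] _] + /andP[/andP[_ xa'] _].
rewrite !cat_uniq !rcons_uniq => /andP[/andP[ua uqa] _] /andP[/andP[ua' uqa'] _] na.
have : ucycle (fun u v => v \in nbr T u) (x :: a ++ u :: rev a').
  rewrite /ucycle /=; apply/andP; split.
    rewrite -cat_rcons rcons_cat cat_path pa/= last_rcons.
    rewrite -rev_cons -(belast_rcons x a' u) -[X in path _ X](last_rcons x a' u).
    by rewrite rev_path (eq_path (e' := fun u v => v \in nbr T u))// => v w; rewrite nbr_sym.
  rewrite mem_cat inE !negb_or xa xu mem_rev xa'/=.
  rewrite cat_uniq uqa/= mem_rev ua' rev_uniq uqa' andbT.
  rewrite andbT negb_or ua/= has_rev; apply: contra na => /hasP[v va' va].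
  by apply/hasP; exists v => //=; rewrite mem_cat mem_rcons inE va' orbT.
move=> /tree_acyclic; rewrite /= size_cat/= size_rev.
by case: a {pa xa ua uqa na} => [|? ?]; case: a' {pa' xa' ua' uqa'} => [|? ?] //=; lia.
Qed.

(** Two simple paths from [x] to the root meet, at the latest in [x0]. Cutting at the first vertex
    of one that lies on the other, [no_fork] makes this vertex the first step of both. *)
Lemma parent_unique x y y' :
  is_parent T x0 x y -> is_parent T x0 x y' -> y = y'.
Proof.
move=> [p [/= /andP[yx pp] /andP[xp up] lp]] [p' [/= /andP[yx' pp'] /andP[xp' up'] lp']].
have hp : has (mem (y' :: p')) (y :: p).
  by apply/hasP; exists x0; [rewrite -lp mem_last|rewrite /= -lp' mem_last].
have {pp} pp : path (fun u v => v \in nbr T u) x (y :: p) by rewrite /= yx.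
have {pp'} pp' : path (fun u v => v \in nbr T u) x (y' :: p') by rewrite /= yx'.
rewrite -/(uniq (y :: p)) in up; rewrite -/(uniq (y' :: p')) in up'.
have [a [u [b [e1 + na]]]] : exists a u b, [/\ y :: p = a ++ u :: b, u \in y' :: p' &
    ~~ has (mem (y' :: p')) a].
  case: (split_find hp) => u a b /= ua nh; exists a, u, b; split => //.
  by rewrite cat_rcons.
case/splitPr e2 : (y' :: p') / => [a' b'].
rewrite e1 e2 in xp xp' pp pp' up up' na.
have [ea ea'] := no_fork pp pp' xp up xp' up' na.
by move: e1 e2; rewrite ea ea' => -[-> _] [-> _].
Qed.
End tree_facts.
End words.

(** * Rearrangements of excursions *)

Section excursions.
Context {R : realType} {V : countType}.
Implicit Types (x y : V) (p q a e : seq V).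

(** Continuations of a path standing at [x], until the [r]-th further visit to [x0]. The word leaves
    out the starting state [x]. *)
Definition stopped x0 r x : set (seq V) :=
  [set p | last x p = x0 /\ count_mem x0 p = r].

(** The word of the states after the start, so [x] occurs in it only as the last letter. The empty
    word would pass these tests only for [y = x]. *)
Definition excursion x y e : bool :=
  [&& head x e == y, last x e == x & index x e == (size e).-1].

Definition first_return x p := take (index x p).+1 p.

Lemma first_returnP x p : x \in p ->
  excursion x (head x p) (first_return x p).
Proof.
move=> xp; have ip : (index x p < size p)%N by rewrite index_mem.
have -> : first_return x p = rcons (take (index x p) p) x.
  by rewrite /first_return (take_nth x)// nth_index.
apply/and3P; split; rewrite ?last_rcons//.
- by case: p xp ip => //= y p; case: eqP => [->|_ _ _] //=.
- rewrite size_rcons/= -cats1 index_cat/= eqxx addn0 in_take//.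
  by rewrite ltnn.
Qed.

(** An excursion can be read off any word that begins with it; this makes the decompositions below
    injective. *)
Lemma first_return_cat x y e q : y != x -> excursion x y e ->
  first_return x (e ++ q) = e /\ x \in e.
Proof.
move=> yx /and3P[/eqP he /eqP le /eqP ie].
have xe : x \in e.
  by case: e he le {ie} => [/esym/eqP|z e _ /= {1}<-]; rewrite ?(negbTE yx)// mem_last.
split=> //; rewrite /first_return index_cat xe ie prednK; last by case: (e) xe.
by rewrite take_size_cat.
Qed.

Lemma nth_cat_last x a s : nth x (x :: a ++ s) (size a) = last x a.
Proof.
rewrite -cat_cons nth_cat ltnS leqnn; case/lastP: a => // a z.
by rewrite last_rcons size_rcons/= nth_rcons ltnn eqxx.
Qed.

Section swap.
Variables (x0 x y : V) (r : nat).
Hypothesis yx : y != x.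

Let D1 := [set t : seq V * seq V * seq V | [/\ last x t.1.1 = x,
  excursion x y t.1.2 & stopped x0 r x (t.1.1 ++ t.1.2 ++ t.2)]].

Let A1 := [set k : seq V * nat | [/\ stopped x0 r x k.1, (k.2 < size k.1)%N,
  (nth x (x :: k.1) k.2 == x) && (nth x k.1 k.2 == y) & x \in drop k.2 k.1]].

Let A2 := [set k : seq V * nat | [/\ stopped x0 r x k.1, head x k.1 = y,
  (k.2 < size k.1)%N & nth x k.1 k.2 == x]].

(* A marked crossing of [xy] splits the path into [a], the excursion [e] that
   follows the mark, and the rest [q]; in [e ++ a ++ q] the mark is the visit to
   [x] that ends [e ++ a]. *)
Let bij1 : set_bij D1 A1 (fun t => (t.1.1 ++ t.1.2 ++ t.2, size t.1.1)).
Proof.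
split.
- move=> [[a e] q] [/= la ee sp]; have [_ xe] := first_return_cat q yx ee.
  have se : (0 < size e)%N by case: (e) xe.
  split => //=.
  + by rewrite !size_cat; lia.
  + rewrite nth_cat_last la eqxx/= nth_cat ltnn subnn nth_cat se nth0.
    by have /and3P[] := ee.
  + by rewrite drop_size_cat// mem_cat xe.
- move=> [[a e] q] [[a' e'] q'] /set_mem[/= _ ee _] /set_mem[/= _ ee' _] [h sa].
  move/eqP: h; rewrite eqseq_cat// => /andP[/eqP -> /eqP h].
  have [ee1 _] := first_return_cat q yx ee.
  have [ee2 _] := first_return_cat q' yx ee'.
  have e12 : e = e' by rewrite -ee1 h.
  by move/eqP: h; rewrite e12 eqseq_cat// eqxx => /eqP ->.
- move=> [p i] [/= sp ip /andP[/eqP n1 /eqP n2] xd].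
  exists (take i p, first_return x (drop i p), drop (index x (drop i p)).+1 (drop i p)).
    split=> /=.
    + by rewrite -(nth_cat_last _ _ (drop i p)) cat_take_drop size_takel// ltnW.
    + have := first_returnP xd; congr (excursion _ _ _).
      by rewrite -nth0 nth_drop addn0.
    + by rewrite /first_return !cat_take_drop.
  by rewrite /= /first_return !cat_take_drop size_takel// ltnW.
Qed.

Let bij2 : set_bij D1 A2
  (fun t => (t.1.2 ++ t.1.1 ++ t.2, (size t.1.2 + size t.1.1).-1)).
Proof.
split.
- move=> [[a e] q] [/= la ee [lp cp]]; have [_ xe] := first_return_cat q yx ee.
  have se : (0 < size e)%N by case: (e) xe.
  have /and3P[/eqP he /eqP le _] := ee.
  split => //=.
  + split; first by rewrite !last_cat le -lp !last_cat la le.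
    by rewrite -cp !count_cat; lia.
  + by rewrite -nth0 nth_cat se nth0.
  + by rewrite !size_cat; lia.
  + rewrite catA nth_cat size_cat prednK ?leqnn; last by lia.
    by rewrite -size_cat nth_last last_cat le la.
- move=> [[a e] q] [[a' e'] q'] /set_mem[/= _ ee _] /set_mem[/= _ ee' _] [h sa].
  have [ee1 xe1] := first_return_cat (a ++ q) yx ee.
  have [ee2 xe2] := first_return_cat (a' ++ q') yx ee'.
  have e12 : e = e' by rewrite -ee1 h.
  move: sa; rewrite e12 => sa.
  have {}sa : size a = size a' by move: sa; case: (e') xe2 => //= *; lia.
  by move/eqP: h; rewrite e12 eqseq_cat// eqxx/= eqseq_cat// => /andP[/eqP -> /eqP ->].
- move=> [p i] [/= [lp cp] hp ip /eqP ni].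
  have xp : x \in p by rewrite -ni mem_nth.
  have kp : (index x p < size p)%N by rewrite index_mem.
  have ki : (index x p <= i)%N.
    by rewrite leqNgt; apply/negP => /(before_find x); rewrite ni/= eqxx.
  set k := (index x p).+1.
  pose a := take (i.+1 - k) (drop k p); pose q := drop i.+1 p.
  have aq : a ++ q = drop k p.
    rewrite /a /q -{2}(cat_take_drop (i.+1 - k) (drop k p)); congr (_ ++ _).
    by rewrite drop_drop; congr drop; rewrite /k; lia.
  have sz : size a = (i.+1 - k)%N.
    by rewrite size_takel// size_drop; rewrite /k; lia.
  have efr := first_returnP xp; rewrite hp in efr.
  have /and3P[_ /eqP le _] := efr.
  have sfr : size (first_return x p) = k by rewrite size_takel.
  have pE : first_return x p ++ a ++ q = p by rewrite aq cat_take_drop.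
  have la : last x a = x.
    have : nth x (first_return x p ++ a ++ q) i = x by rewrite pE.
    rewrite catA nth_cat size_cat sfr sz (_ : (i < _)%N); last by rewrite /k; lia.
    have -> : i = (size (first_return x p ++ a)).-1.
      by rewrite size_cat sfr sz /k; lia.
    by rewrite nth_last last_cat le.
  exists (a, first_return x p, q); first split => //=.
    split.
      by rewrite !last_cat la le -lp -[in RHS]pE !last_cat le la.
    by rewrite -cp -[in RHS]pE !count_cat; lia.
  by rewrite /= pE sfr sz; congr pair; rewrite /k; lia.
Qed.

(** With the marks written as positions, both sides become sums over the decompositions [D1]. The
    crossings of [xy] without a later return to [x] have no decomposition, and [Fr] makes them
    weightless. *)
Lemma swap_excursion (F : seq V -> \bar R) : (forall p, 0 <= F p)%E ->
  (forall a e q, last x a = x -> last x e = x ->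
    F (a ++ e ++ q) = F (e ++ a ++ q)) ->
  (forall p i, stopped x0 r x p -> nth x (x :: p) i = x -> nth x p i = y ->
    (i < size p)%N -> x \notin drop i p -> F p = 0%E) ->
  (\esum_(p in stopped x0 r x) ((crossings (x :: p) x y)%:R%:E * F p) =
   \esum_(p in stopped x0 r x `&` [set p | head x p = y])
      ((count_mem x p)%:R%:E * F p))%E.
Proof.
move=> F0 FC Fr.
under eq_esum do rewrite (crossings_count _) -(esum_nat_bool _
   (fun i => (nth x (x :: _) i == x) && (nth x _ i == y)))//.
under [RHS]eq_esum do rewrite (count_mem_sum x) -(esum_nat_bool _
   (fun i => nth x _ i == x))//.
rewrite !esum_esum//.
rewrite (@esum_restrict _ _ _ A1) => [|[p i]]; last first.
  move=> [/= sp [ip /andP[/eqP n1 /eqP n2]]] nA.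
  apply: (Fr p i) => //; apply/negP => xd; apply: nA; split => //=.
  by rewrite n1 n2 !eqxx.
rewrite (_ : _ `&` A1 = A1); last first.
  by apply/setIidr => -[p i] [/= ? ? ? ?]; split.
rewrite (reindex_esum _ _ _ _ bij1)/=.
rewrite (_ : _ `*`` _ = A2); last first.
  by apply/seteqP; split => -[p i] => [[/= [? ?] [? ?]]|[/= ? ? ? ?]]; split.
rewrite (reindex_esum _ _ _ _ bij2)/=.
by apply: eq_esum => -[[a e] q] [/= la /and3P[_ /eqP le _] _]; exact: FC.
Qed.

(** The word lists the states after the root, so the root [x] is its last letter. At [x = x0] only
    the empty loop remains. *)
Definition rooted_loops : set (seq V) := [set l | last x l = x /\ x0 \notin l].

Let D3 := [set t : seq V * seq V * seq V | [/\ excursion x y t.1.1,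
  x0 \notin t.1.1, stopped x0 r x t.1.2 & rooted_loops t.2]].

Let A3 := [set k : seq V * seq V | [/\ stopped x0 r x k.1, rooted_loops k.2 &
  head x k.2 = y]].

Let A4 := [set k : seq V * seq V | [/\ stopped x0 r x k.1, head x k.1 = y,
  rooted_loops k.2, x \in k.1 & x0 \notin first_return x k.1]].

Let bij3 : set_bij D3 A3 (fun t => (t.1.2, t.1.1 ++ t.2)).
Proof.
split.
- move=> [[e p] l] [/= ee x0e sp [ll x0l]]; have [_ xe] := first_return_cat l yx ee.
  have /and3P[/eqP he /eqP le _] := ee.
  split=> //=; first by split; rewrite ?last_cat ?le// mem_cat negb_or x0e.
  by case: (e) xe he.
- move=> [[e p] l] [[e' p'] l'] /set_mem[/= ee _ _ _] /set_mem[/= ee' _ _ _] [-> h].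
  have [ee1 _] := first_return_cat l yx ee.
  have [ee2 _] := first_return_cat l' yx ee'.
  have e12 : e = e' by rewrite -ee1 h.
  by move/eqP: h; rewrite e12 eqseq_cat// eqxx => /eqP ->.
- move=> [p l] [/= sp [ll x0l] hl].
  have xl : x \in l.
    case: l ll x0l hl => [_ _ /esym/eqP|z l /= + _ _]; first by rewrite (negbTE yx).
    by move=> {1}<-; rewrite mem_last.
  exists (first_return x l, p, drop (index x l).+1 l); last first.
    by rewrite /= cat_take_drop.
  have ee := first_returnP xl; rewrite hl in ee.
  have /and3P[_ /eqP le _] := ee.
  have x0n : x0 \notin first_return x l ++ drop (index x l).+1 l.
    by rewrite cat_take_drop.
  move: x0n; rewrite mem_cat negb_or => /andP[n1 n2].
  split=> //=; split => //; rewrite -[in RHS]ll -[in RHS](cat_take_drop (index x l).+1 l).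
  by rewrite last_cat -/(first_return x l) le.
Qed.

Let bij4 : set_bij D3 A4 (fun t => (t.1.1 ++ t.1.2, t.2)).
Proof.
split.
- move=> [[e p] l] [/= ee x0e [lp cp] lo]; have [fe xe] := first_return_cat p yx ee.
  have /and3P[/eqP he /eqP le _] := ee.
  split=> //=.
  + split; first by rewrite last_cat le.
    by rewrite count_cat cp (count_memPn x0e).
  + by case: (e) xe he.
  + by rewrite mem_cat xe.
  + by rewrite fe.
- move=> [[e p] l] [[e' p'] l'] /set_mem[/= ee _ _ _] /set_mem[/= ee' _ _ _] [h ->].
  have [ee1 _] := first_return_cat p yx ee.
  have [ee2 _] := first_return_cat p' yx ee'.
  have e12 : e = e' by rewrite -ee1 h.
  by move/eqP: h; rewrite e12 eqseq_cat// eqxx => /eqP ->.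
- move=> [p l] [/= [lp cp] hp lo xp x0f].
  exists (first_return x p, drop (index x p).+1 p, l); last first.
    by rewrite /= cat_take_drop.
  have ee := first_returnP xp; rewrite hp in ee.
  have /and3P[_ /eqP le _] := ee.
  split=> //=; split.
    by rewrite -lp -[in RHS](cat_take_drop (index x p).+1 p) last_cat -/(first_return x p) le.
  by rewrite -cp -[in RHS](cat_take_drop (index x p).+1 p) count_cat (count_memPn x0f).
Qed.

(** Through [D3], the first excursion of the loop goes to the front of the path. A path whose first
    excursion does not return to [x], or meets [x0], cannot arise so, because the loops avoid [x0];
    [Fr] makes it weightless. *)
Lemma transfer_excursion (F : seq V -> seq V -> \bar R) :
  (forall p l, 0 <= F p l)%E ->
  (forall e p l, last x e = x -> F p (e ++ l) = F (e ++ p) l) ->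
  (forall p l, stopped x0 r x p -> head x p = y ->
    x \notin p \/ x0 \in first_return x p -> F p l = 0%E) ->
  (\esum_(p in stopped x0 r x)
     \esum_(l in rooted_loops `&` [set l | head x l = y]) F p l =
   \esum_(p in stopped x0 r x `&` [set p | head x p = y])
     \esum_(l in rooted_loops) F p l)%E.
Proof.
move=> F0 FC Fr; rewrite !esum_esum//.
rewrite (_ : _ `*`` _ = A3); last first.
  by apply/seteqP; split => -[p l] => [[/= ? [? ?]]|[/= ? ? ?]]; split.
rewrite (reindex_esum _ _ _ _ bij3)/= [RHS](@esum_restrict _ _ _ A4) => [|[p l]]; last first.
  move=> [/= [sp hp] lo] nA; apply: Fr => //.
  have [xp|] := boolP (x \in p); last by left.
  have [|x0p] := boolP (x0 \in first_return x p); first by right.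
  by exfalso; apply: nA.
rewrite (_ : _ `&` A4 = A4); last first.
  by apply/setIidr => -[p l] [/= ? ? ? ? ?]; split.
rewrite (reindex_esum _ _ _ _ bij4)/=.
by apply: eq_esum => -[[e p] l] [/= /and3P[_ /eqP le _] _ _ _]; exact: FC.
Qed.
End swap.
End excursions.

(** * Palm formula for independent Poisson counts *)

Section natval.
Context {R : realType}.
Local Open Scope ereal_scope.

Definition natval (x : \bar R) : Prop := x = +oo \/ exists k : nat, x = k%:R%:E.

Definition oval (o : option nat) : \bar R :=
  if o is Some k then k%:R%:E else +oo.

Lemma natval_oval x : natval x -> exists o, x = oval o.
Proof. by move=> [->|[k ->]]; [exists None|exists (Some k)]. Qed.

Lemma oval_inj : injective oval.
Proof. by move=> [k|] [l|]//= [] /eqP; rewrite eqr_nat => /eqP ->. Qed.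

Lemma natval_ge0 x : natval x -> 0 <= x.
Proof. by move=> [->|[k ->]]; rewrite ?leey// lee_fin. Qed.

Lemma natvalD x y : natval x -> natval y -> natval (x + y).
Proof.
move=> [->|[k ->]] [->|[l ->]]; [by left|by left|by left|].
by right; exists (k + l)%N; rewrite natrD EFinD.
Qed.

Lemma natvalM x (k : nat) : natval x -> natval (x * k%:R%:E).
Proof.
move=> [->|[l ->]]; last by right; exists (l * k)%N; rewrite natrM EFinM.
case: k => [|k]; first by right; exists 0%N; rewrite mule0.
by left; rewrite gt0_mulye// lte_fin ltr0n.
Qed.

Lemma natval_sup (u : nat -> \bar R) : (forall n, natval (u n)) ->
  natval (ereal_sup (range u)).
Proof.
move=> un.
have [[K uK]|] := pselect (exists K : nat, forall n, u n <= K%:R%:E); last first.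
  move=> /forallNP h; left; apply/eqP; rewrite -leye_eq leye_eq; apply/eqP.
  apply/eqyP => A A0.
  have /existsNP [n /negP] := h (Num.truncn A).+1.
  rewrite -ltNge => hn; apply: (@le_trans _ _ (u n)); last first.
    by apply: ereal_sup_ubound; exists n.
  apply/ltW/(lt_trans _ hn); rewrite lte_fin; exact: truncnS_gt.
have [f uf] : {f : nat -> nat & forall n, u n = (f n)%:R%:E}.
  apply: (@choice _ _ (fun n k => u n = k%:R%:E)) => n.
  by have [h|] := un n => //; have := uK n; rewrite h leye_eq.
pose Q k := `[< exists n, f n = k >].
have Q0 : exists k, Q k by exists (f 0%N); apply/asboolP; exists 0%N.
have QK k : Q k -> (k <= K)%N.
  by move=> /asboolP[n <-]; have := uK n; rewrite uf lee_fin ler_nat.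
case: (ex_maxnP Q0 QK) => m /asboolP[n fn] hm.
right; exists m; apply/eqP; rewrite eq_le; apply/andP; split.
  apply: ge_ereal_sup => _ [l _ <-]; rewrite uf lee_fin ler_nat.
  by apply: hm; apply/asboolP; exists l.
by apply: ereal_sup_ubound; exists n => //; rewrite uf fn.
Qed.

Lemma natval_nneseries (u : nat -> \bar R) (Q : pred nat) :
  (forall n, natval (u n)) -> natval (\sum_(n <oo | Q n) u n).
Proof.
move=> un.
have /ereal_nondecreasing_series/ereal_nondecreasing_cvgn/cvg_lim -> //:
  forall n, (0 <= n)%N -> Q n -> 0 <= u n by move=> n _ _; exact: natval_ge0.
apply: natval_sup => n; elim/big_ind: _ => //; last exact: natvalD.
by right; exists 0%N.
Qed.
End natval.

Section poisson_family.
Context d (Omega : measurableType d) {R : realType} (P : probability Omega R)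
  (M : nat -> Omega -> \bar R) (lam : nat -> R) (I : eqType) (c : nat -> I -> nat).
Hypotheses (mM : forall i, measurable_fun [set: Omega] (M i))
  (Mv : forall i w, natval (M i w))
  (lam0 : forall i, 0 <= lam i)
  (Mindep : forall (L : seq nat) (a : nat -> \bar R), uniq L ->
    P [set w | forall i, i \in L -> M i w = a i] =
    (\prod_(i <- L) P [set w | M i w = a i])%E)
  (Mpois : forall i k, P [set w | M i w = k%:R%:E] =
    (lam i ^+ k / k`!%:R * expR (- lam i))%:E).
Local Open Scope ereal_scope.

Definition crossing_sum (e : I) w : \bar R := \sum_(j <oo) (M j w * (c j e)%:R%:E).

Let Mc_ge0 j w e : 0 <= M j w * (c j e)%:R%:E.
Proof. by rewrite mule_ge0 ?lee_fin// natval_ge0. Qed.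

Let mMc j e : measurable_fun [set: Omega] (fun w => M j w * (c j e)%:R%:E).
Proof. exact: emeasurable_funM. Qed.

Lemma measurable_crossing_sum e : measurable_fun [set: Omega] (crossing_sum e).
Proof. by apply: ge0_emeasurable_sum => //; move=> k w _ _; exact: Mc_ge0. Qed.

Lemma natval_crossing_sum e w : natval (crossing_sum e w).
Proof. by apply: natval_nneseries => j; exact: natvalM. Qed.

Let mMx i x : measurable [set w | M i w = x].
Proof.
rewrite -[X in measurable X]setTI.
exact: mM measurableT _ (emeasurable_set1 _).
Qed.

Let split_value i A : measurable A ->
  P A = \esum_(o in [set: option nat]) P ([set w | M i w = oval o] `&` A).
Proof.
move=> mA; rewrite -measure_esum; last 2 first.
- by move=> o _; exact: measurableI.
- by move=> o o' _ _ [w [[/= -> _] [/= /oval_inj -> _]]].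
congr (P _); apply/seteqP; split=> [w wA|w [v _ [_ wA]]] //.
by have [v Mo] := natval_oval (Mv i w); exists v.
Qed.

Let Nm i (e : I) w : \bar R := \sum_(j <oo | j != i) (M j w * (c j e)%:R%:E).

Let crossing_sumD1 i e w : crossing_sum e w = M i w * (c i e)%:R%:E + Nm i e w.
Proof. by rewrite /crossing_sum (@nneseriesD1 _ _ i). Qed.

Section without_one.
Variable i : nat.
Let triple := (I * nat * nat)%type.

Let term j e w : \bar R := if j == i then 0 else M j w * (c j e)%:R%:E.

Let part n e w : \bar R := \sum_(j < n) term j e w.

(** Inequalities, because these events decrease with [n] to the corresponding event for the infinite
    sum. The offset [b] collects the contributions of counts already conditioned upon. *)
Let part_le n (b : I -> \bar R) (s : seq triple) :=
  [set w | forall t, t \in s ->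
     b t.1.1 + t.1.2%:R%:E + part n t.1.1 w <= t.2%:R%:E].

Let mpart n e : measurable_fun [set: Omega] (part n e).
Proof.
apply: (@emeasurable_sum _ _ _ _ _ _ (fun (j : 'I_n) => term j e)) => j.
have [ji|/negbTE ji] := eqVneq (j : nat) i.
  rewrite (_ : term j e = cst 0); first exact: measurable_cst.
  by apply/funext => w; rewrite /term ji eqxx.
rewrite (_ : term j e = fun w => M j w * (c j e)%:R%:E)//.
by apply/funext => w; rewrite /term ji.
Qed.

Let measurable_forall_in (J : eqType) (s : seq J) (Q : J -> Omega -> Prop) :
  (forall t, measurable [set w | Q t w]) ->
  measurable [set w | forall t, t \in s -> Q t w].
Proof.
move=> mQ; elim: s => [|t s IH].
  by rewrite (_ : mkset _ = setT)//; apply/seteqP; split.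
rewrite (_ : mkset _ = [set w | Q t w] `&` [set w | forall t, t \in s -> Q t w]).
  exact: measurableI.
apply/seteqP; split=> [w h|w [h1 h2] u].
  by split=> [|u us]; apply: h; rewrite inE ?eqxx ?us ?orbT.
by rewrite inE => /predU1P[->//|]; exact: h2.
Qed.

Let mpart_le n b s : measurable (part_le n b s).
Proof.
apply: measurable_forall_in => t; rewrite -[X in measurable X]setTI.
by apply: emeasurable_fun_infty_c => //; exact: emeasurable_funD.
Qed.

(** Induction on [n], conditioning on the value of the last count in the partial sum: its
    contribution moves into [b] and its index joins [L], where [Mindep] applies. The indices of [L]
    stay out of the partial sum, which skips [i]. *)
Let indep_part_le n b s (L : seq nat) (a : nat -> \bar R) : uniq L ->
  (forall j, j \in L -> j == i \/ (n <= j)%N) ->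
  P ([set w | forall j, j \in L -> M j w = a j] `&` part_le n b s) =
  P [set w | forall j, j \in L -> M j w = a j] * P (part_le n b s).
Proof.
elim: n b L a => [|n IH] b L a uL Lj.
  have [/asboolP h|/asboolPn h] := boolP `[< forall t, t \in s ->
      b t.1.1 + t.1.2%:R%:E <= t.2%:R%:E >].
    have -> : part_le 0 b s = setT.
      by apply/seteqP; split => // w _ t ts; rewrite /part big_ord0 adde0 h.
    by rewrite setIT probability_setT mule1.
  have -> : part_le 0 b s = set0.
    apply/seteqP; split => // w hw; apply: h => t ts.
    by have := hw t ts; rewrite /part big_ord0 adde0.
  by rewrite setI0 measure0 mule0.
have [ni|ni] := eqVneq n i.
  have pE e w : part n.+1 e w = part n e w.
    by rewrite /part big_ord_recr/= {2}/term ni eqxx adde0.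
  have -> : part_le n.+1 b s = part_le n b s.
    by apply/seteqP; split => w h t /h; rewrite pE.
  apply: IH => // j /Lj [->|nj]; [by left|right; exact: ltnW].
pose bx o e := b e + oval o * (c n e)%:R%:E.
have E o : [set w | M n w = oval o] `&` part_le n.+1 b s =
    [set w | M n w = oval o] `&` part_le n (bx o) s.
  have pE e w : M n w = oval o -> b e + part n.+1 e w = bx o e + part n e w.
    move=> Mn; rewrite /part big_ord_recr/= {2}/term (negbTE ni) Mn /bx.
    by rewrite -addeA [X in _ + X]addeC.
  apply/seteqP; split => w [/= Mn h]; split => // t /h ht.
    by rewrite addeAC -pE// addeAC.
  by rewrite addeAC pE// addeAC.
have nL : n \notin L.
  by apply/negP => /Lj [|]; [exact/negP|rewrite ltnn].
have mL (L' : seq nat) a' : measurable [set w | forall j, j \in L' -> M j w = a' j].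
  exact: measurable_forall_in.
rewrite (split_value n (mpart_le n.+1 b s)) (split_value n); last exact: measurableI.
under [in RHS]eq_esum do rewrite E.
have h1 o : P ([set w | M n w = oval o] `&` part_le n (bx o) s) =
    P [set w | M n w = oval o] * P (part_le n (bx o) s).
  have -> : [set w | M n w = oval o] =
      [set w | forall j, j \in [:: n] -> M j w = oval o].
    by apply/seteqP; split=> [w /= ? j|w /=]; [rewrite inE => /eqP ->|apply; rewrite inE].
  apply: IH => // j; rewrite inE => /eqP ->; by right.
under [in RHS]eq_esum do rewrite h1.
have fL : P [set w | forall j, j \in L -> M j w = a j] \is a fin_num.
  exact: fin_num_measure.
rewrite -(fineK fL) -esumZl; last 2 first.
- exact: fine_ge0.
- by move=> o; exact: mule_ge0.
rewrite fineK//; apply: eq_esum => o _.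
rewrite setICA E.
pose a' j := if j == n then oval o else a j.
have e1 : [set w | forall j, j \in L -> M j w = a j] `&` [set w | M n w = oval o] =
    [set w | forall j, j \in n :: L -> M j w = a' j].
  apply/seteqP; split => [w [/= h1' h2] j|w /= h].
    rewrite inE /a'; have [->//|jn /=] := eqVneq j n; exact: h1'.
  split=> [j jL|]; last by have := h n (mem_head _ _); rewrite /a' eqxx.
  have := h j; rewrite inE jL orbT /a' => /(_ isT).
  by case: eqP => // jn; rewrite -jn jL in nL.
rewrite setIA e1 IH; last 2 first.
- by rewrite /= nL.
- by move=> j; rewrite inE => /predU1P[->|/Lj[->|]]; [right|left|move=> /ltnW; right].
rewrite Mindep/= ?nL// Mindep// big_cons /a' eqxx muleCA muleA; congr (_ * _).
congr (_ * _); apply: eq_big_seq => j jL; case: eqP => // jn.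
by rewrite -jn jL in nL.
Qed.

Let term_ge0 j e w : 0 <= term j e w.
Proof. by rewrite /term; case: ifP. Qed.

Let partE n e w : part n e w = \sum_(0 <= j < n) term j e w.
Proof. by rewrite big_mkord. Qed.

Let NmE e w : Nm i e w = \sum_(j <oo) term j e w.
Proof.
rewrite /Nm eseries_mkcond; apply: eq_eseriesr => j _.
by rewrite /term; case: eqP.
Qed.

Let natval_Nm e w : natval (Nm i e w).
Proof. by apply: natval_nneseries => j; exact: natvalM. Qed.

Let mNm e : measurable_fun [set: Omega] (Nm i e).
Proof. by apply: ge0_emeasurable_sum => //; move=> k w _ _; exact: Mc_ge0. Qed.

Let sum_le (s : seq triple) := [set w | forall t, t \in s ->
  t.1.2%:R%:E + Nm i t.1.1 w <= t.2%:R%:E].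

Let msum_le s : measurable (sum_le s).
Proof.
apply: measurable_forall_in => t; rewrite -[X in measurable X]setTI.
by apply: emeasurable_fun_infty_c => //; exact: emeasurable_funD.
Qed.

Let sum_leE s : sum_le s = \bigcap_n part_le n (fun=> 0) s.
Proof.
apply/seteqP; split => [w h n _ t /h ht|w h t ts].
  rewrite add0e (le_trans _ ht)// leeD2lE// NmE partE.
  by apply: nneseries_lim_ge => j _ _; exact: term_ge0.
rewrite -leeBrDl// NmE; apply: lime_le.
  by apply: is_cvg_nneseries => j _ _; exact: term_ge0.
apply: nearW => n; rewrite leeBrDl//.
by have := h n Logic.I t ts; rewrite add0e partE.
Qed.

Let part_le_dec s : nonincreasing_seq (fun n => part_le n (fun=> 0) s).
Proof.
apply/nonincreasing_seqP => n; apply/subsetPset => w h t /h; apply: le_trans.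
rewrite !add0e leeD2lE// /part big_ord_recr/=; exact: leeDl.
Qed.

Let indep_sum_le s x :
  P ([set w | M i w = x] `&` sum_le s) = P [set w | M i w = x] * P (sum_le s).
Proof.
have c1 : P (part_le n (fun=> 0) s) @[n --> \oo] --> P (sum_le s).
  rewrite sum_leE; apply: nonincreasing_cvg_mu => //.
  - by rewrite ltey_eq fin_num_measure.
  - by rewrite -sum_leE.
have c2 : P ([set w | M i w = x] `&` part_le n (fun=> 0) s) @[n --> \oo] -->
    P ([set w | M i w = x] `&` sum_le s).
  have sI : [set w | M i w = x] `&` sum_le s =
      \bigcap_n ([set w | M i w = x] `&` part_le n (fun=> 0) s).
    rewrite sum_leE; apply/seteqP; split => [w [h1 h2] n _|w h].
      by split => //; exact: h2.
    by split=> [|n _]; [have [] := h 0%N Logic.I|have [] := h n Logic.I].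
  rewrite sI; apply: nonincreasing_cvg_mu => //.
  - by rewrite ltey_eq fin_num_measure//; exact: measurableI.
  - by move=> n; exact: measurableI.
  - by rewrite -sI; exact: measurableI.
  - move=> m n mn; apply/subsetPset; apply: setIS; apply/subsetPset.
    exact: part_le_dec.
apply: (cvg_unique _ c2) => //.
have -> : (fun n => P ([set w | M i w = x] `&` part_le n (fun=> 0) s)) =
    (fun n => P [set w | M i w = x] * P (part_le n (fun=> 0) s)).
  apply/funext => n.
  have Ex : [set w | M i w = x] = [set w | forall j, j \in [:: i] -> M j w = x].
    by apply/seteqP; split=> [w /= ? j|w /=]; [rewrite inE => /eqP ->|apply; rewrite inE].
  by rewrite Ex (indep_part_le _ _ (fun=> x))// => j; rewrite inE => /eqP ->; left.
by apply: cvgeZl => //; exact: fin_num_measure.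
Qed.

Let mix (s1 s2 : seq triple) := [set w |
  (forall t, t \in s1 -> t.1.2%:R%:E + Nm i t.1.1 w = t.2%:R%:E)] `&` sum_le s2.

Let mmix s1 s2 : measurable (mix s1 s2).
Proof.
apply: measurableI => //; apply: measurable_forall_in => t.
rewrite -[X in measurable X]setTI.
have mf : measurable_fun [set: Omega] (fun w => t.1.2%:R%:E + Nm i t.1.1 w).
  exact: emeasurable_funD.
exact: mf measurableT _ (emeasurable_set1 _).
Qed.

(* For integers, [b + u = k] means [b + u <= k] but not [b.+1 + u <= k]. *)
Let indep_mix s1 s2 x :
  P ([set w | M i w = x] `&` mix s1 s2) = P [set w | M i w = x] * P (mix s1 s2).
Proof.
elim: s1 s2 => [|[[e b] k] s1 IH] s2.
  have -> : mix [::] s2 = sum_le s2.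
    by rewrite /mix -[RHS]setTI; congr (_ `&` _); apply/seteqP; split.
  exact: indep_sum_le.
have -> : mix ((e, b, k) :: s1) s2 =
    mix s1 ((e, b, k) :: s2) `\` mix s1 ((e, b.+1, k) :: s2).
  apply/seteqP; split => [w [h1 h2]|w [[h1 h2] h3]].
    have hw := h1 _ (mem_head _ _); rewrite /= in hw.
    split.
      split=> [t ts|t]; first by apply: h1; rewrite inE ts orbT.
      by rewrite inE => /predU1P[->|/h2//]; rewrite /= hw.
    move=> [_ /(_ _ (mem_head _ _))]/=; rewrite -hw.
    have [hN|[l hN]] := natval_Nm e w; rewrite hN -?EFinD; first by move: hw; rewrite hN.
    by rewrite lee_fin -!natrD ler_nat addSn ltnn.
  split=> [t|t ts]; last by apply: h2; rewrite inE ts orbT.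
  rewrite inE => /predU1P[->|/h1//]/=.
  have := h2 _ (mem_head _ _); rewrite /=.
  have [hN|[l hN]] := natval_Nm e w; rewrite hN -?EFinD//.
  rewrite lee_fin -!natrD ler_nat leq_eqVlt => /orP[/eqP -> //|lk].
  exfalso; apply: h3; split=> // u.
  rewrite inE => /predU1P[->|us]; last by apply: h2; rewrite inE us orbT.
  by rewrite /= hN -EFinD lee_fin -natrD ler_nat.
have sub : mix s1 ((e, b.+1, k) :: s2) `<=` mix s1 ((e, b, k) :: s2).
  move=> w [h1 h2]; split=> // t.
  rewrite inE => /predU1P[->|ts]; last by apply: h2; rewrite inE ts orbT.
  have := h2 _ (mem_head _ _); apply: le_trans.
  by rewrite /=; apply: leeD => //; rewrite lee_fin ler_nat.
have subI : [set w | M i w = x] `&` mix s1 ((e, b.+1, k) :: s2) `<=`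
    [set w | M i w = x] `&` mix s1 ((e, b, k) :: s2) by exact: setIS.
have fm A : measurable A -> P A \is a fin_num by exact: fin_num_measure.
have -> : [set w | M i w = x] `&`
    (mix s1 ((e, b, k) :: s2) `\` mix s1 ((e, b.+1, k) :: s2)) =
    ([set w | M i w = x] `&` mix s1 ((e, b, k) :: s2)) `\`
    ([set w | M i w = x] `&` mix s1 ((e, b.+1, k) :: s2)).
  apply/seteqP; split => [w [h1 [h2 h3]]|w [[h1 h2] h3]].
    by split=> // -[].
  by split=> //; split=> // h4; apply: h3.
rewrite !measureD//; try exact: measurableI; try by rewrite ltey_eq fm//; exact: measurableI.
rewrite (setIidr sub) (setIidr subI).
transitivity (P [set w | M i w = x] * P (mix s1 ((e, b, k) :: s2)) -
    P [set w | M i w = x] * P (mix s1 ((e, b.+1, k) :: s2))).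
  by congr (_ - _); exact: IH.
symmetry; apply: muleBr; first exact: fm.
by rewrite fin_num_adde_defr//; exact: fm.
Qed.

(** [b] is meant for the crossings by a given path; [s] lists edges with their prescribed total
    numbers of crossings. *)
Definition net_event (b : I -> nat) (s : seq (I * nat)) := [set w |
  forall t, t \in s -> (b t.1)%:R%:E + crossing_sum t.1 w = t.2%:R%:E].

(** Given [M i = m], class [i] contributes the constant [m * c i] to each sum, and the rest is
    independent of [M i]. *)
Let net_event_indep (b : I -> nat) s (m : nat) :
  P ([set w | M i w = m%:R%:E] `&` net_event b s) = P [set w | M i w = m%:R%:E] *
    P (mix [seq (t.1, b t.1 + m * c i t.1, t.2)%N | t <- s] [::]).
Proof.
rewrite -indep_mix; congr (P _).
have E w t : M i w = m%:R%:E -> (b t)%:R%:E + crossing_sum t w =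
    (b t + m * c i t)%N%:R%:E + Nm i t w.
  by move=> Mw; rewrite (crossing_sumD1 i) Mw natrD natrM EFinD EFinM addeA.
apply/seteqP; split=> w [/= Mw h]; split=> //.
  by split=> // _ /mapP[t ts ->]/=; rewrite -E// h.
move=> t ts; rewrite E//.
have [h1 _] := h; have := h1 (t.1, (b t.1 + m * c i t.1)%N, t.2).
by rewrite /=; apply; apply/mapP; exists t.
Qed.

Lemma measurable_net_event b s : measurable (net_event b s).
Proof.
apply: measurable_forall_in => t; rewrite -[X in measurable X]setTI.
have mf : measurable_fun [set: Omega]
    (fun w => (b t.1)%:R%:E + crossing_sum t.1 w).
  by apply: emeasurable_funD => //; exact: measurable_crossing_sum.
exact: mf measurableT _ (emeasurable_set1 _).
Qed.

(* [k.+1 * p (k.+1) = l * p k] for the Poisson weights [p] of mean [l]. *)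
Let poisson_shift b s (m : nat) :
  m.+1%:R%:E * P ([set w | M i w = m.+1%:R%:E] `&` net_event b s) =
  (lam i)%:E * P ([set w | M i w = m%:R%:E] `&` net_event (fun e => b e + c i e)%N s).
Proof.
rewrite !net_event_indep !muleA !Mpois; congr (_ * P (mix _ _)); last first.
  by apply: eq_map => t; rewrite mulSn addnA.
rewrite -!EFinM; congr (_%:E); rewrite exprS factS natrM.
have m1 : (m.+1%:R : R) != 0%R by rewrite pnatr_eq0.
have m2 : (m`!%:R : R) != 0%R by rewrite pnatr_eq0 -lt0n fact_gt0.
move: (m.+1%:R : R) (m`!%:R : R) m1 m2 => u v u0 v0.
by field; rewrite u0 v0.
Qed.

Let net_event_fin b s t w : t \in s -> (0 < c i t.1)%N -> net_event b s w ->
  exists m : nat, M i w = m%:R%:E.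
Proof.
move=> ts c0 /(_ t ts); rewrite (crossing_sumD1 i).
have [->|//] := Mv i w.
by rewrite gt0_mulye ?lte_fin ?ltr0n// addye ?addey//; have [->|[l ->]] := natval_Nm t.1 w.
Qed.

Let net_eventE b s t : t \in s -> (0 < c i t.1)%N ->
  net_event b s = \bigcup_m ([set w | M i w = m%:R%:E] `&` net_event b s).
Proof.
move=> ts c0; apply/seteqP; split=> [w wD|w [m _ []]//].
by have [m Mw] := net_event_fin ts c0 wD; exists m.
Qed.

Let net_event_triv b s :
  trivIset setT (fun m : nat => [set w | M i w = m%:R%:E] `&` net_event b s).
Proof.
by move=> m n _ _ [w [[/= -> _] [/= [] /eqP]]]; rewrite eqr_nat => /eqP.
Qed.

(** The Mecke formula for one class: weighting by the count [M i] adds one loop of the class. As the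
    class crosses a prescribed edge, [M i] is finite on these events, which can thus be sliced by
    its value. *)
Lemma palm_one b s t : t \in s -> (0 < c i t.1)%N ->
  \int[P]_(w in net_event b s) M i w =
  (lam i)%:E * P (net_event (fun e => b e + c i e)%N s).
Proof.
have mD b' : measurable (net_event b' s) by exact: measurable_net_event.
move=> ts c0; rewrite (net_eventE b ts c0) ge0_integral_bigcup//; last 3 first.
- by move=> m; exact: measurableI.
- exact: measurable_funTS.
- by move=> w _; exact: natval_ge0.
rewrite (net_eventE (fun e => b e + c i e)%N ts c0) measure_bigcup//; last first.
  by move=> m _; exact: measurableI.
rewrite -nneseriesZl// [RHS]eseries_mkcond.
under eq_eseriesr => m _.
  rewrite (_ : integral _ _ _ = m%:R%:E * P ([set w | M i w = m%:R%:E] `&` net_event b s)).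
  over.
  rewrite -integral_cst; last exact: measurableI.
  by apply: eq_integral => w /set_mem[].
rewrite nneseries_recl//; last by move=> m _; exact: mule_ge0.
rewrite mul0e add0e -nneseries_addn; last by move=> m; exact: mule_ge0.
apply: eq_eseriesr => m _; rewrite in_setT/= addn1; exact: poisson_shift.
Qed.
End without_one.

(* The truncated subtraction is harmless: the event is empty if [t.2 < b t.1]. *)
Lemma palm b s t : t \in s ->
  (t.2 - b t.1)%N%:R%:E * P (net_event b s) =
  \sum_(i <oo) ((lam i * (c i t.1)%:R)%:E *
                P (net_event (fun e => b e + c i e)%N s)).
Proof.
move=> ts; rewrite -integral_cst; last exact: measurable_net_event.
transitivity (\int[P]_(w in net_event b s) crossing_sum t.1 w).
  apply: eq_integral => w /set_mem /(_ t ts).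
  have [->|[l ->]] := natval_crossing_sum t.1 w; first by rewrite addey.
  by rewrite -EFinD -natrD => -[/eqP]; rewrite eqr_nat => /eqP <-; rewrite addKn.
rewrite integral_nneseries; last 3 first.
- exact: measurable_net_event.
- by move=> j; exact: measurable_funTS.
- by move=> j w _; exact: Mc_ge0.
apply: eq_eseriesr => i _.
rewrite ge0_integralZr//; last 3 first.
- exact: measurable_net_event.
- exact: measurable_funTS.
- by move=> w _; exact: natval_ge0.
have [->|c0] := posnP (c i t.1); first by rewrite mule0 mulr0 mul0e.
by rewrite (palm_one _ ts c0) EFinM muleAC.
Qed.

Lemma poisson_sum1 (l : R) : (0 <= l)%R ->
  \sum_(m <oo) (l ^+ m / m`!%:R * expR (- l))%:E = 1.
Proof.
rewrite le_eqVlt => /predU1P[<-|l0].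
  rewrite nneseries_recl//.
  rewrite eseries0 ?adde0; last first.
    by case=> // m _ _; rewrite exprS mul0r mul0r mul0r.
  by rewrite expr0 fact0 divr1 mul1r oppr0 expR0.
have : poisson_prob l 0 [set: nat] = 1 by exact: probability_setT.
rewrite /poisson_prob l0 -nneseries_esumT.
  by move=> <-; apply: eq_eseriesr => m _; rewrite /poisson_pmf l0.
by move=> m; rewrite lee_fin poisson_pmf_ge0.
Qed.

Let mean_one i : \int[P]_w M i w = (lam i)%:E.
Proof.
pose U := \bigcup_m [set w | M i w = m%:R%:E].
have mU : measurable U by exact: bigcupT_measurable.
have tU : trivIset setT (fun m : nat => [set w | M i w = m%:R%:E]).
  by move=> m n _ _ [w [/= -> [] /eqP]]; rewrite eqr_nat => /eqP.
have PU : P U = 1.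
  rewrite measure_bigcup// -(poisson_sum1 (lam0 i)) eseries_mkcond.
  by apply: eq_eseriesr => m _; rewrite in_setT; exact: Mpois.
have PnU : P (~` U) = 0 by rewrite probability_setC// PU subee.
rewrite (ge0_negligible_integral (measurableC mU))//; last first.
  by move=> w _; exact: natval_ge0.
rewrite setTD setCK ge0_integral_bigcup//; last 2 first.
- exact: measurable_funTS.
- by move=> w _; exact: natval_ge0.
transitivity (\sum_(m <oo) (m%:R * (lam i ^+ m / m`!%:R * expR (- lam i)))%:E).
  apply: eq_eseriesr => m _; rewrite EFinM -Mpois -integral_cst//.
  by apply: eq_integral => w /set_mem.
have t0 m : (0 <= lam i ^+ m / m`!%:R * expR (- lam i))%R.
  by rewrite mulr_ge0 ?expR_ge0// divr_ge0// exprn_ge0.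
rewrite nneseries_recl//; last by move=> m _; rewrite lee_fin mulr_ge0.
rewrite mul0r add0e -nneseries_addn; last first.
  by move=> m; rewrite lee_fin mulr_ge0.
rewrite -[RHS]mule1 -(poisson_sum1 (lam0 i)) -nneseriesZl; last first.
  by move=> m _; rewrite lee_fin.
apply: eq_eseriesr => m _; rewrite addn1 -EFinM; congr (_%:E).
rewrite exprS factS natrM.
have : (m.+1%:R : R) != 0%R by rewrite pnatr_eq0.
have : (m`!%:R : R) != 0%R by rewrite pnatr_eq0 -lt0n fact_gt0.
move: (m.+1%:R : R) (m`!%:R : R) => u v v0 u0.
by field; rewrite u0 v0.
Qed.

Lemma crossing_sum_mean e :
  \int[P]_w crossing_sum e w = \sum_(i <oo) (lam i * (c i e)%:R)%:E.
Proof.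
rewrite integral_nneseries//.
apply: eq_eseriesr => i _; rewrite ge0_integralZr//; first by rewrite mean_one.
by move=> w _; exact: natval_ge0.
Qed.
End poisson_family.

(** * Loop measure of a rotation class *)

Section rotations.
Context {V : countType}.
Implicit Types (z p : seq V).

(** Without repetition: a periodic word has fewer rotations than letters, and the loop measure must
    count each of them once. *)
Definition rots z : seq (seq V) := undup [seq rot i z | i <- iota 0 (size z)].

Lemma mem_rots z p : (0 < size z)%N ->
  reflect (exists i, p = rot i z) (p \in rots z).
Proof.
move=> z0; rewrite mem_undup; apply: (iffP mapP) => [[i _ ->]|[i ->]].
  by exists i.
have [iz|zi] := ltnP i (size z); first by exists i; rewrite ?mem_iota.
by exists 0%N; rewrite ?mem_iota// rot0 rot_oversize.
Qed.

Lemma rots_size z p : p \in rots z -> size p = size z.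
Proof. by rewrite mem_undup => /mapP[i _ ->]; rewrite size_rot. Qed.

Lemma rots_perm z p : p \in rots z -> perm_eq p z.
Proof. by rewrite mem_undup => /mapP[i _ ->]; rewrite perm_rot. Qed.

Lemma rot_rots z p i : (0 < size z)%N -> p \in rots z -> rot i p \in rots z.
Proof.
move=> z0 /(mem_rots _ z0)[j ->]; apply/(mem_rots _ z0).
by exists (rot_add z j i); rewrite rot_rot_add.
Qed.

Lemma sum_rotS (M : nmodType) (f : seq V -> M) z :
  \sum_(i < size z) f (rot i.+1 z) = \sum_(i < size z) f (rot i z).
Proof.
case E : (size z) => [|n]; first by rewrite !big_ord0.
by rewrite big_ord_recr big_ord_recl/= rot0 -E rot_size addrC.
Qed.

Lemma sum_rot1 (M : nmodType) (f : seq V -> M) z :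
  \sum_(i < size z) f (rot i (rot 1 z)) = \sum_(i < size z) f (rot i z).
Proof.
by rewrite -sum_rotS; apply: eq_bigr => i _; rewrite rot_rot -rotS.
Qed.

Lemma sum_rots (M : nmodType) (f : seq V -> M) z p : p \in rots z ->
  \sum_(i < size z) f (rot i p) = \sum_(i < size z) f (rot i z).
Proof.
rewrite mem_undup => /mapP[j + ->]; rewrite mem_iota/= add0n => /ltnW.
elim: j => [|j IH] jz; first by rewrite rot0.
rewrite rotS//; transitivity (\sum_(i < size (rot j z)) f (rot i (rot 1 (rot j z)))).
  by rewrite size_rot.
by rewrite sum_rot1 size_rot IH// ltnW.
Qed.

Lemma sum_rots_rot (M : nmodType) (f : seq V -> M) z i : (0 < size z)%N ->
  \sum_(p <- rots z) f (rot i p) = \sum_(p <- rots z) f p.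
Proof.
move=> z0; rewrite -(big_map (rot i) xpredT f); apply: perm_big.
have um : uniq [seq rot i p | p <- rots z] by rewrite map_inj_uniq ?undup_uniq//; exact: rot_inj.
apply: uniq_perm => //; first exact: undup_uniq.
have [||] // := uniq_min_size um (s2 := rots z); last by rewrite size_map.
by move=> _ /mapP[p pz ->]; exact: rot_rots.
Qed.

(** A mass transport principle: over the class, the total mass sent along all rotations equals the
    total mass received. *)
Lemma rots_transport (M : nmodType) (G : seq V -> seq V -> M) z : (0 < size z)%N ->
  \sum_(p <- rots z) \sum_(i < size z) G p (rot i p) =
  \sum_(p <- rots z) \sum_(i < size z) G (rot i p) p.
Proof.
move=> z0; rewrite exchange_big/=.
transitivity (\sum_(i < size z) \sum_(p <- rots z) G (rot (size z - i) p) p).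
  apply: eq_bigr => i _; rewrite -[RHS](sum_rots_rot _ i)//.
  rewrite big_seq [RHS]big_seq; apply: eq_bigr => p /rots_size sp.
  by congr (G _ _); rewrite -{1}(rotK i p) /rotr size_rot sp.
rewrite exchange_big/= big_seq [RHS]big_seq; apply: eq_bigr => p /rots_size sp.
rewrite -sp -(sum_rotS (fun q => G q p)) (reindex_inj rev_ord_inj)/=.
by apply: eq_bigr => i _; rewrite subKn.
Qed.

(** Each crossing of [xy] is a way to cut the loop open between [x] and [y]; as a sum over
    rotations, the count can enter [rots_transport]. *)
Lemma loop_crossingsE z x y : loop_crossings z x y =
  (\sum_(i < size z) ((last x (rot i z) == x) && (head x (rot i z) == y)))%N.
Proof.
rewrite -(sum_rotS (fun p => nat_of_bool ((last x p == x) && (head x p == y)))).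
rewrite /loop_crossings -sum1_count big_mkcond/= (big_nth (x, x)) big_mkord.
rewrite size_zip size_rot minnn; apply: eq_bigr => i _.
rewrite nth_zip ?size_rot// xpair_eqE.
have -> : last x (rot i.+1 z) = nth x z i.
  by rewrite /rot last_cat (take_nth x)// last_rcons.
have -> : head x (rot i.+1 z) = nth x (rot 1 z) i.
  by rewrite rotS// rot_rot {1}/rot (drop_nth x)// size_rot.
by case: ifP.
Qed.
End rotations.

Section loop_measure_class.
Context (R : realType) (V : countType) (T : tree V) (C : V -> V -> R)
  (C_gt0 : forall x y, y \in nbr T x -> 0 < C x y)
  (nbr0 : forall x, nbr T x != [::])
  (d : measure_display) (Omega : measurableType d)
  (P : V -> probability Omega R) (Y : nat -> Omega -> V)
  (H : nat -> Omega -> \bar R) (X_ctmc : is_ctmc T C P Y H).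
Local Notation J := (jump_prob T C).
Local Notation leb := (@lebesgue_measure R).

Lemma prod_pathw x y p :
  \prod_(i < size p) J (nth x (y :: p) i) (nth x (y :: p) i.+1) = pathw J y p.
Proof.
elim: p y => [|z p IH] y; first by rewrite big_ord0.
by rewrite big_ord_recl/= -IH.
Qed.

Lemma follow_law x (u : seq V) : P x [set w | mkseq (Y^~ w) (size u) = u] =
  ((if u is y :: p then (y == x)%:R * pathw J y p else 1)%:E).
Proof.
case: u => [|y p]; first by rewrite (_ : mkset _ = setT) ?probability_setT//; apply/seteqP.
under eq_set do rewrite mkseq_eq.
by rewrite (chain_law C_gt0 nbr0 X_ctmc) prod_pathw.
Qed.

Lemma measurable_follow k (u : seq V) : measurable [set w | mkseq (Y^~ w) k = u].
Proof. exact: (measurable_mkseq _ _ (ctmc_mY X_ctmc)). Qed.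

(** Forgetting the root drops the final return. A trajectory without jumps has no return to drop,
    whence [maxn 1 k]. *)
Lemma unroot_states k t w :
  map fst (unroot (X_upto Y H k t w)) = mkseq (Y^~ w) (maxn 1 k).
Proof.
rewrite /X_upto; case: k => [|k] //=.
rewrite (maxn_idPr (ltn0Sn k)) /mkseq/=.
set s := [seq (Y i w, fine (H i w)) | i <- iota 1 k].
case E : (rcons s _) => [|q g'].
  by move: (congr1 size E); rewrite size_rcons.
move: E; rewrite lastI => /rcons_inj[<- _]/=.
by rewrite /s -map_comp.
Qed.

Definition cyc_weight (p : seq V) : R := if p is y :: q then pathw J y (rcons q y) else 1.

(** The part of [loop_measure] due to trajectories that run through [p] and, at time [t], are back
    at its first letter and have not yet left it. *)
Definition root_mass (p : seq V) : \bar R :=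
  if p is y :: _ then (\int[leb]_(t in `]0%R, +oo[)
    ((t^-1)%:E * P y ([set w | mkseq (Y^~ w) (size p).+1 = rcons p y]
                      `&` [set w | in_sojourn H (size p) t w])))%E
  else 0%E.

Lemma cyc_weight_ge0 p : 0 <= cyc_weight p.
Proof.
by case: p => //= y q; apply: pathw_ge0 => u v; exact: jump_prob_ge0.
Qed.

Lemma cyc_weight_last x p : p != [::] -> cyc_weight p = pathw J (last x p) p.
Proof.
case: p => // y q _; rewrite /cyc_weight -cats1 pathw_cat/= mulr1.
by rewrite mulrC.
Qed.

Lemma cyc_weight_rot p i : cyc_weight (rot i p) = cyc_weight p.
Proof.
have rot1 q : cyc_weight (rot 1 q) = cyc_weight q.
  case: q => // y [|z q] //=.
  by rewrite -cats1 pathw_cat last_cat/= mulr1 mulrC cats1.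
have [pi|] := leqP (size p) i; first by rewrite rot_oversize.
elim: i => [|i IH] ip; first by rewrite rot0.
by rewrite rotS ?rot1 ?IH// ltnW.
Qed.

Lemma root_massE y q : root_mass (y :: q) =
  (\int[leb]_(a in `]0%R, +oo[)
    (cyc_weight (y :: q) * laplace [seq rate T C x | x <- y :: q] a *
     (rate T C y + a)^-1)%:E)%E.
Proof.
set p := y :: q.
pose lam i := rate T C (nth y (rcons p y) i).
rewrite /root_mass /p -/p.
transitivity (\int[leb]_(a in `]0%R, +oo[)
   (cyc_weight p * laplace [seq lam i | i <- iota 0 (size p)] a
     * (lam (size p) + a)^-1)%:E)%E; last first.
  apply: eq_integral => a _; congr (_%:E); congr (_ * _ * _^-1).
    congr (laplace _ a); apply: (@eq_from_nth _ 0).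
      by rewrite !size_map size_iota.
    move=> i; rewrite size_map size_iota => ip.
    by rewrite (nth_map 0%N) ?size_iota// nth_iota// (nth_map y)// /lam nth_rcons ip.
  by rewrite /lam nth_rcons ltnn eqxx.
have E0 : P y [set w | mkseq (Y^~ w) (size p).+1 = rcons p y] = (cyc_weight p)%:E.
  have := follow_law y (rcons p y); rewrite size_rcons => ->.
  by rewrite /p rcons_cons/= eqxx mul1r.
apply: integral_holding => //.
- by move=> i; exact: ctmc_mH X_ctmc _.
- exact: measurable_follow.
- by move=> i; exact: rate_gt0.
- exact: cyc_weight_ge0.
move=> s s0.
have h : P y [set w | forall i : nat, (i <= size p)%N ->
      Y i w = nth y (rcons p y) i /\ ((s i)%:E < H i w)%E] =
    (\prod_(i < (size q).+1) J (nth y (y :: rcons q y) i) (nth y (y :: rcons q y) i.+1) *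
     \prod_(i < (size p).+1) expR (- (lam i * s i)))%:E.
  rewrite (ctmc_law X_ctmc y (size p) (nth y (rcons p y)) s0).
  by rewrite /p rcons_cons [nth _ _ 0%N]/= eqxx mul1r.
have -> : (cyc_weight p * \prod_(i < (size p).+1) expR (- (lam i * s i)))%:E =
  P y [set w | forall i : nat, (i <= size p)%N ->
      Y i w = nth y (rcons p y) i /\ ((s i)%:E < H i w)%E].
  by rewrite h -(size_rcons q y) prod_pathw.
congr (P y _); apply/seteqP; split => w /=.
  move=> [h1 h2] i ip; split; last exact: h2.
  by rewrite -h1 nth_mkseq.
move=> h1; split; last by move=> i /h1[].
apply: (@eq_from_nth _ y); first by rewrite size_mkseq/= size_rcons.
move=> i; rewrite size_mkseq => ip.
by rewrite nth_mkseq//; have [] := h1 i ip.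
Qed.

(* Summed over the rotations, the integrands of [root_massE] are the derivative of
   [- laplace]. *)
Lemma sum_root_mass z : (0 < size z)%N ->
  (\sum_(i < size z) root_mass (rot i z) = (cyc_weight z)%:E)%E.
Proof.
case: z => // x0 z0 _; set z := x0 :: z0.
have zi (i : 'I_(size z)) : rot i z = nth x0 z i :: (drop i.+1 z ++ take i z).
  by rewrite /rot (drop_nth x0).
have ra x a : 0 < a -> 0 < (rate T C x + a)^-1.
  by move=> a0; rewrite invr_gt0 addr_gt0// rate_gt0.
pose l := [seq rate T C x | x <- z].
have l0 : {in l, forall x, 0 < x} by move=> _ /mapP[x _ ->]; exact: rate_gt0.
transitivity (\sum_(i < size z) \int[leb]_(a in `]0%R, +oo[)
    (cyc_weight z * laplace l a * (rate T C (nth x0 z i) + a)^-1)%:E)%E.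
  apply: eq_bigr => i _; rewrite zi root_massE -zi cyc_weight_rot.
  apply: eq_integral => a _; congr ((_ * _ * _)%:E).
  by rewrite /laplace; apply: perm_big; rewrite perm_map// perm_rot.
have minv (x : R) : measurable_fun [set: R] (fun a => (x + a)^-1).
  by apply: measurableT_comp; [exact: measurable_invr|exact: measurable_funD].
have mlap : measurable_fun [set: R] (laplace l).
  by apply: measurable_prod => x _; apply: measurable_funM.
rewrite -ge0_integral_sum//; last 2 first.
- move=> i; apply: measurable_funTS; apply/measurable_EFinP.
  apply: measurable_funM; first exact: measurable_funM.
  exact: minv.
- move=> i a; rewrite /= in_itv/= andbT => a0; rewrite lee_fin.
  apply: mulr_ge0; last exact/ltW/ra.
  by apply: mulr_ge0; [exact: (cyc_weight_ge0 z)|apply: laplace_ge0 => //; exact: ltW].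
rewrite -[RHS]mule1 -(integral_laplace l0)//.
rewrite -ge0_integralZl//; last 3 first.
- apply: measurable_funTS; apply/measurable_EFinP; apply: measurable_funM => //.
  apply: measurable_sum => x.
  exact: minv.
- move=> a; rewrite /= in_itv/= andbT => a0; rewrite lee_fin.
  apply: mulr_ge0; first by apply: laplace_ge0 => //; exact: ltW.
  by rewrite big_map; apply: sumr_ge0 => x _; exact/ltW/ra.
- by rewrite lee_fin (cyc_weight_ge0 z).
apply: eq_integral => a _; rewrite sumEFin -EFinM; congr (_%:E).
by rewrite -mulr_sumr mulrA /l big_map (big_nth x0) big_mkord.
Qed.

Lemma measurable_sojourn k t : measurable [set w | in_sojourn H k t w].
Proof.
have mjt j : measurable_fun [set: Omega] (jump_time H j).
  by apply: emeasurable_sum => i; exact: ctmc_mH X_ctmc _.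
apply: measurableI; rewrite -[X in measurable X]setTI.
  exact: emeasurable_fun_infty_c.
exact: emeasurable_fun_o_infty.
Qed.

Lemma measurable_sojourn_prob x k (E : set Omega) : measurable E ->
  measurable_fun [set: R] (fun t => P x (E `&` [set w | in_sojourn H k t w])).
Proof.
move=> mE.
have mjt j : measurable_fun [set: R * Omega] (fun z => jump_time H j z.2).
  apply: (measurableT_comp (f := jump_time H j)) => //.
  by apply: emeasurable_sum => i; exact: ctmc_mH X_ctmc _.
have mt : measurable_fun [set: R * Omega] (fun z => z.1%:E : \bar R).
  by apply/measurable_EFinP.
pose S := (setT `&` [set z : R * Omega | jump_time H k z.2 <= z.1%:E]%E) `&`
  ((setT `&` [set z : R * Omega | z.1%:E < jump_time H k.+1 z.2]%E) `&` (setT `*` E)).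
have mS : measurable S.
  apply: measurableI; first exact: measurable_lee.
  by apply: measurableI; [exact: measurable_lte|exact: measurableX].
rewrite (_ : (fun _ => _) = P x \o xsection S); first exact: measurable_fun_xsection.
apply/funext => t /=; congr (P x _); apply/seteqP; split=> w.
  by move=> [Ew [h1 h2]]; rewrite /xsection/= inE.
by rewrite /xsection/= inE => -[[_ h1] [[_ h2] [_ Ew]]].
Qed.

(** From size 2 on, the number of jumps is the number of letters; a class of size 1 would also
    receive the trajectories without jumps. *)
Lemma loop_measure_rots z : (1 < size z)%N ->
  loop_measure P Y H [set g | map fst g \in rots z] =
  (\sum_(p <- rots z) root_mass p)%E.
Proof.
move=> z1; rewrite /loop_measure.
pose F x p t := [set w | mkseq (Y^~ w) (size z).+1 = rcons p x]
  `&` [set w | in_sojourn H (size z) t w].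
have mF x p t : measurable (F x p t).
  by apply: measurableI; [exact: measurable_follow|exact: measurable_sojourn].
have evE x t : [set w | exists k, [/\ in_sojourn H k t w, Y k w = x &
    map fst (unroot (X_upto Y H k t w)) \in rots z]] =
    \bigcup_(p in [set` rots z]) F x p t.
  apply/seteqP; split=> w.
    move=> [k [kt Yk]]; rewrite unroot_states => pz.
    have := rots_size pz; rewrite size_mkseq => kz.
    have {}kz : k = size z by lia.
    exists (mkseq (Y^~ w) k).
      by move: pz; rewrite (maxn_idPr _)// kz; lia.
    split; rewrite /= -kz//; apply: (@eq_from_nth _ x).
      by rewrite size_rcons !size_mkseq.
    move=> i; rewrite size_mkseq => ik; rewrite nth_mkseq// nth_rcons size_mkseq.
    have [ik'|ki] := ltnP i k; first by rewrite nth_mkseq.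
    have -> : i = k by lia.
    by rewrite eqxx Yk.
  move=> [p pz [/= h tz]]; exists (size z); split => //.
    have := congr1 (fun s => nth x s (size z)) h.
    by rewrite nth_mkseq// nth_rcons (rots_size pz) ltnn eqxx.
  rewrite unroot_states (maxn_idPr (ltnW z1)).
  suff -> : mkseq (Y^~ w) (size z) = p by [].
  have := congr1 (take (size z)) h.
  rewrite -cats1 take_cat (rots_size pz) ltnn subnn take0 cats0 => <-.
  by rewrite /mkseq -map_take take_iota (minn_idPl (leqnSn _)).
have PF x t : P x (\bigcup_(p in [set` rots z]) F x p t) =
    (\sum_(p <- rots z) if head x p == x then P x (F x p t) else 0)%E.
  rewrite measure_fin_bigcup//; last 2 first.
  - exact: finite_seq.
  - move=> p q _ _ [w [[/= e1 _] [/= e2 _]]].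
    by apply: (@rcons_injl _ x); rewrite -e1 e2.
  rewrite -fsbig_seq ?undup_uniq//; apply: eq_big_seq => p pz; case: ifPn => // px.
  apply/eqP; rewrite eq_le measure_ge0 andbT.
  have -> : 0%E = P x [set w | mkseq (Y^~ w) (size z).+1 = rcons p x].
    have := follow_law x (rcons p x).
    rewrite size_rcons (rots_size pz) => ->.
    case: p pz px => [/rots_size pz|y q _ /= /negbTE ->]; last by rewrite mul0r.
    by move: z1; rewrite -pz.
  apply: le_measure; rewrite ?inE//; first exact: measurable_follow.
  exact: subIsetl.
have rm0 p : (0 <= root_mass p)%E.
  rewrite /root_mass; case: p => // y q; apply: integral_ge0 => t /=.
  by rewrite in_itv/= andbT => t0; apply: mule_ge0 => //; rewrite lee_fin invr_ge0 ltW.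
have mPF x p : measurable_fun [set: R] (fun t => P x (F x p t)).
  by apply: measurable_sojourn_prob; exact: measurable_follow.
transitivity (\esum_(x in [set: V]) \sum_(p <- rots z)
    (if head x p == x then root_mass p else 0))%E.
  apply: eq_esum => x _.
  under eq_integral => t _.
    rewrite (_ : mkset _ = \bigcup_(p in [set` rots z]) F x p t); last exact: evE.
    rewrite PF ge0_sume_distrr; last by move=> p _; case: ifP.
    over.
  rewrite ge0_integral_sum//; last 2 first.
  - move=> p; case: (head x p == x).
      apply: measurable_funTS; apply: emeasurable_funM; last exact: mPF.
      by apply/measurable_EFinP; exact: measurable_invr.
    apply: emeasurable_funM => //.
    by apply/measurable_EFinP; exact: measurable_invr.
  - move=> p t; rewrite /= in_itv/= andbT => t0; apply: mule_ge0.
      by rewrite lee_fin invr_ge0 ltW.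
    by case: ifP.
  apply: eq_big_seq => p pz; case: ifPn => [px|_]; last first.
    by rewrite integral0_eq// => t _; rewrite mule0.
  case: p pz px => [/rots_size pz|y q pz /= /eqP yx]; first by move: z1; rewrite -pz.
  by rewrite /F -yx -(rots_size pz).
rewrite esum_sum//; last by move=> x p _ _; case: ifP.
apply: eq_big_seq => p pz.
case: p pz => [/rots_size pz|y q pz]; first by move: z1; rewrite -pz.
rewrite -[RHS](@esum_set1 _ _ y (fun=> root_mass (y :: q)))//.
rewrite [RHS]esum_mkcond; apply: eq_esum => x _ /=.
by rewrite [x \in _](_ : _ = (y == x))//; apply/idP/eqP => [/set_mem ->//|->]; exact/mem_set.
Qed.

Lemma root_mass_ge0 p : (0 <= root_mass p)%E.
Proof.
rewrite /root_mass; case: p => // y q; apply: integral_ge0 => t /=.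
by rewrite in_itv/= andbT => t0; apply: mule_ge0 => //; rewrite lee_fin invr_ge0 ltW.
Qed.

Lemma loop_measure_fin z : (1 < size z)%N ->
  loop_measure P Y H [set g | map fst g \in rots z] \is a fin_num.
Proof.
move=> z1; rewrite loop_measure_rots//; apply/sum_fin_numP => p pz _.
have p0 : (0 < size p)%N by rewrite (rots_size pz) ltnW.
have : (root_mass p < +oo)%E.
  apply: (@le_lt_trans _ _ (\sum_(i < size p) root_mass (rot i p))%E).
    rewrite (bigD1 (Ordinal p0))//= rot0 leeDl// sume_ge0// => i _.
    exact: root_mass_ge0.
  by rewrite sum_root_mass// ltry.
by rewrite ge0_fin_numE// root_mass_ge0.
Qed.

(** Transporting the mass of each root to the marked crossing gathers at each rotation the masses of
    all its roots, whose sum is [cyc_weight] by [sum_root_mass]. *)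
Lemma loop_measure_crossings z x y : (1 < size z)%N ->
  (loop_measure P Y H [set g | map fst g \in rots z]
     * (loop_crossings z x y)%:R%:E =
   \sum_(p <- rots z) (((last x p == x) && (head x p == y))%:R * pathw J x p)%:E)%E.
Proof.
move=> z1; have z0 := ltnW z1; rewrite loop_measure_rots//.
pose phi p : \bar R := ((last x p == x) && (head x p == y))%:R%:E.
rewrite ge0_sume_distrl; last by move=> p _; exact: root_mass_ge0.
transitivity (\sum_(p <- rots z) \sum_(i < size z)
    (root_mass p * phi (rot i p)))%E.
  apply: eq_big_seq => p pz; rewrite loop_crossingsE natr_sum -sumEFin.
  rewrite -ge0_sume_distrr; last by move=> i _; rewrite lee_fin.
  congr (_ * _)%E; symmetry; exact: (sum_rots phi pz).
rewrite (rots_transport (fun p q => root_mass p * phi q)%E)//.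
apply: eq_big_seq => p pz; rewrite -ge0_sume_distrl; last first.
  by move=> i _; exact: root_mass_ge0.
rewrite -(rots_size pz) sum_root_mass; last by rewrite (rots_size pz).
rewrite /phi -EFinM mulrC; case: eqVneq => [lp|_]; last by rewrite !mul0r.
rewrite (cyc_weight_last x) ?lp//.
by case: p pz lp => // /rots_size pz; move: z0; rewrite -pz.
Qed.
End loop_measure_class.

(** * Crossings of the loop soup *)

Section loop_classes.
Context {V : countType}.
Implicit Types (z p : seq V).

Definition canonical_loop z : bool :=
  (1 < size z)%N && (z == choose (mem (rots z)) z).

(* A representative of the [i]-th rotation class of words of size at least 2, or
   [[::]], whose class is empty. *)
Definition loop_of (i : nat) : seq V :=
  if @pickle_inv (seq V) i is Some z then
    if canonical_loop z then z else [::]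
  else [::].

Definition loop_class (i : nat) : set (seq V) := [set p | p \in rots (loop_of i)].

Lemma rots_refl z : (0 < size z)%N -> z \in rots z.
Proof. by move=> z0; apply/(mem_rots _ z0); exists 0%N; rewrite rot0. Qed.

Lemma rots_eq z p : p \in rots z -> rots p =i rots z.
Proof.
move=> pz; have z0 : (0 < size z)%N.
  by move: pz; rewrite mem_undup; case: (z).
have p0 : (0 < size p)%N by rewrite (rots_size pz).
move=> q; apply/idP/idP => [/(mem_rots _ p0)[i ->]|/(mem_rots _ z0)[i ->]].
  exact: rot_rots.
have /(mem_rots _ z0)[j pE] := pz.
have -> : rot i z = rot (size z - j) (rot i p).
  by rewrite rot_rot pE -(size_rot j z) -/(rotr j (rot j z)) rotK.
by apply: rot_rots => //; apply: rot_rots => //; exact: rots_refl.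
Qed.

Lemma loop_ofP i : loop_of i = [::] \/ canonical_loop (loop_of i) /\ i = pickle (loop_of i).
Proof.
rewrite /loop_of; case E : (@pickle_inv (seq V) i) => [z|]; last by left.
case: ifPn => [cz|_]; last by left.
by right; split => //; have := @pickle_invK (seq V) i; rewrite /= E.
Qed.

Lemma loop_class_size i p : loop_class i p -> (1 < size p)%N.
Proof.
move=> pi; rewrite (rots_size pi).
by have [z0|[/andP[]]//] := loop_ofP i; rewrite /loop_class/= z0 in pi.
Qed.

Lemma loop_class_cover p : (1 < size p)%N -> exists i, loop_class i p.
Proof.
move=> p1; have p0 := ltnW p1.
pose z := choose (mem (rots p)) p.
have zp : z \in rots p by apply: chooseP; exact: rots_refl.
have pz : p \in rots z by rewrite (rots_eq zp) rots_refl.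
exists (pickle z); rewrite /loop_class/= /loop_of pickleK_inv.
suff -> : canonical_loop z by [].
rewrite /canonical_loop (rots_size zp) p1/=; apply/eqP.
rewrite {1}/z (eq_choose (Q := mem (rots z))); last by move=> q /=; rewrite (rots_eq zp).
by apply: choose_id => //=; apply: rots_refl; rewrite (rots_size zp).
Qed.

Lemma loop_class_inj i j p : loop_class i p -> loop_class j p -> i = j.
Proof.
move=> pi pj; have p1 := loop_class_size pi.
have h k : loop_class k p -> k = pickle (choose (mem (rots p)) p).
  move=> pk; have [z0|[/andP[z1 /eqP zE] ->]] := loop_ofP k.
    by rewrite /loop_class/= z0 in pk.
  congr pickle; rewrite zE (eq_choose (Q := mem (rots p))); last first.
    by move=> q /=; rewrite (rots_eq pk).
  apply: choose_id => /=; last by apply: rots_refl; exact: ltnW.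
  by rewrite (rots_eq pk) rots_refl// ltnW.
by rewrite (h i pi) (h j pj).
Qed.

Lemma trivIset_loop_class : trivIset setT loop_class.
Proof. by move=> i j _ _ [p [/loop_class_inj]]; exact. Qed.

Lemma esum_loop_class (R : realType) (h : seq V -> \bar R) : (forall p, 0 <= h p)%E ->
  (\sum_(i <oo) \sum_(p <- rots (loop_of i)) h p =
   \esum_(p in [set p | (1 < size p)%N]) h p)%E.
Proof.
move=> h0; rewrite nneseries_esumT; last by move=> i; exact: sume_ge0.
rewrite (_ : [set p | _] = \bigcup_i loop_class i); last first.
  apply/seteqP; split => [p /loop_class_cover[i pi]|p [i _ /loop_class_size]//].
  by exists i.
rewrite esum_bigcupT//; last exact: trivIset_loop_class.
apply: eq_esum => i _; rewrite esum_fset//.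
  by rewrite /loop_class -fsbig_seq// undup_uniq.
by rewrite /loop_class; exact: finite_seq.
Qed.

Lemma loop_crossings_rots z p x y : p \in rots z ->
  loop_crossings p x y = loop_crossings z x y.
Proof.
move=> pz; rewrite !loop_crossingsE (rots_size pz).
exact: (sum_rots (fun q => nat_of_bool ((last x q == x) && (head x q == y))) pz).
Qed.

Lemma crossings_rooted x p u v : last x p = x ->
  crossings (x :: p) u v = loop_crossings p u v.
Proof.
case/lastP: p => // q x'; rewrite last_rcons => ->.
have /loop_crossings_rots -> : rcons q x \in rots (x :: q).
  by apply/(mem_rots (z := x :: q)) => //; exists 1%N; rewrite rot1_cons.
rewrite /crossings /loop_crossings rot1_cons/=.
have zip_rcons (a s : seq V) y : size a = size s -> zip (rcons a y) s = zip a s.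
  by elim: a s => [[]//|c a IH] [|b s] //= [/IH ->].
by rewrite -rcons_cons zip_rcons// size_rcons.
Qed.

Lemma dloop_measurable (A : set (dloop V)) : rot_inv A -> measurable A.
Proof. by move=> rA; exact: sub_sigma_algebra. Qed.

Lemma rot_inv_loop_class i : rot_inv (loop_class i).
Proof.
move=> p j; rewrite /loop_class /= => pz; apply: rot_rots => //.
by move: pz; rewrite mem_undup; case: (loop_of i).
Qed.

(** The loops with a given word of states are the union over [n] of the boxes that bound all holding
    times by [n], and there are countably many words. *)
Lemma cloop_states_measurable (R : realType) (Q : seq V -> Prop) :
  (forall p i, Q p -> Q (rot i p)) ->
  measurable [set g : cloop R V | Q (map fst g)].
Proof.
move=> Qrot; apply: sub_sigma_algebra; split; last first.
  by move=> s i /=; rewrite map_rot; exact: Qrot.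
have mb p : (@measurable _ (g_sigma_algebraType (@cloop_boxes R V)))
    [set g | map fst g = p].
  rewrite (_ : mkset _ = \bigcup_n [set g : seq (V * R) | map fst g = p /\
      all2 <=%R (map snd g) (nseq (size p) n%:R)]).
    by apply: bigcupT_measurable => n; apply: sub_sigma_algebra; exists p, (nseq (size p) n%:R).
  apply/seteqP; split=> [g /= gp|g [n _ []]//].
  exists (Num.truncn (\sum_(t <- map snd g) `|t|)).+1 => //; split => //.
  rewrite -gp size_map -(size_map snd g).
  have : {in map snd g, forall t, t <= \sum_(t <- map snd g) `|t|}.
    move=> t tg; apply: (le_trans (ler_norm t)).
    by rewrite (big_rem t)//= lerDl sumr_ge0.
  move: (\sum_(_ <- _) _) => K; elim: (map snd g) => //= t s IH h.
  rewrite IH ?andbT; last by move=> u us; apply: h; rewrite inE us orbT.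
  by rewrite (le_trans (h t (mem_head _ _)))// ltW// truncnS_gt.
pose F (o : option (seq V)) : set (seq (V * R)) := if o is Some p then
  if `[< Q p >] then [set g | map fst g = p] else set0 else set0.
rewrite (_ : mkset _ = \bigcup_n F (unpickle n)).
  apply: (@bigcupT_measurable _ (g_sigma_algebraType (@cloop_boxes R V))) => n.
  rewrite /F; case: (unpickle n) => [p|]; last exact: measurable0.
  by case: ifPn => _; [exact: mb|exact: measurable0].
apply/seteqP; split => [g Qg|g [n _]].
  by exists (pickle (map fst g)) => //; rewrite pickleK /F asboolT.
by rewrite /F; case: (unpickle n) => // p; case: asboolP => // Qp /= ->.
Qed.
End loop_classes.

Section soup_network.
Context (R : realType) (V : countType) (T : tree V) (d : measure_display)
  (Omega : measurableType d) (Lbar : Omega -> {measure set (dloop V) -> \bar R})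
  (Lbar_pp : is_point_process Lbar).
Local Open Scope ereal_scope.

Definition edge_crossings (i : nat) (e : V * V) : nat :=
  if e.2 \in nbr T e.1 then loop_crossings (loop_of i) e.1 e.2 else 0%N.

Definition class_count (i : nat) (w : Omega) : \bar R := Lbar w (loop_class i).

Definition soup_net : V * V -> Omega -> \bar R :=
  crossing_sum class_count edge_crossings.

Lemma measurable_loop_class i : measurable (loop_class i : set (dloop V)).
Proof. by apply: dloop_measurable; exact: rot_inv_loop_class. Qed.

Lemma measurable_class_count i : measurable_fun [set: Omega] (class_count i).
Proof. exact: (pp_measurable Lbar_pp (measurable_loop_class i)). Qed.

Lemma natval_class_count i w : natval (class_count i w).
Proof. exact: (pp_counting Lbar_pp w (measurable_loop_class i)). Qed.

(** The number of crossings is constant on each class. Words of at most one letter belong to no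
    class, but they cross no edge either. *)
Lemma soup_crossingsE x y w : y \in nbr T x ->
  soup_crossings (Lbar w) x y = soup_net (x, y) w.
Proof.
move=> yx; rewrite /soup_crossings /soup_net /crossing_sum.
have xy : x != y by apply: contraTneq yx => ->; exact: nbr_irrefl.
pose f i (z : dloop V) : \bar R :=
  (loop_crossings (loop_of i) x y)%:R%:E * (\1_(loop_class i) z)%:E.
have f0 i z : 0 <= f i z by rewrite mule_ge0 ?lee_fin.
transitivity (\int[Lbar w]_z \sum_(i <oo) f i z).
  apply: eq_integral => z _.
  have [z1|z1] := ltnP 1 (size z); last first.
    rewrite eseries0; last first.
      move=> i _ _; rewrite /f indicE memNset ?mule0// => /loop_class_size.
      by rewrite ltnNge z1.
    rewrite (_ : loop_crossings z x y = 0%N)// /loop_crossings.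
    case: z z1 => [|u [|? ?]]//= _; rewrite xpair_eqE addn0.
    by have [->|] := eqVneq u x; rewrite ?(negbTE xy)// .
  have [i zi] := loop_class_cover z1.
  rewrite (@nneseriesD1 _ _ i)//= eseries0 ?adde0; last first.
    move=> j _ /= ji; rewrite /f indicE memNset ?mule0// => zj.
    by rewrite (loop_class_inj zi zj) eqxx in ji.
  by rewrite /f indicE mem_set// mule1 (loop_crossings_rots _ _ zi).
rewrite integral_nneseries//; last first.
  move=> i; apply: emeasurable_funM => //; apply/measurable_EFinP.
  by apply: measurable_indic; exact: measurable_loop_class.
apply: eq_eseriesr => i _; rewrite /f ge0_integralZl//; last first.
  by apply/measurable_EFinP; apply: measurable_indic; exact: measurable_loop_class.
rewrite integral_indic//; last exact: measurable_loop_class.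
by rewrite setIT /edge_crossings/= yx muleC.
Qed.

Lemma measurable_soup_net e : measurable_fun [set: Omega] (soup_net e).
Proof. exact: measurable_crossing_sum measurable_class_count natval_class_count _. Qed.
End soup_network.

(** * Poisson law and Mecke formula of the soup *)

Section soup_law.
Context (R : realType) (V : countType) (T : tree V) (x0 : V) (C : V -> V -> R)
  (C_gt0 : forall x y, y \in nbr T x -> 0 < C x y)
  (nbr0 : forall x, nbr T x != [::])
  (alpha : R) (alpha_ge0 : 0 <= alpha)
  (dX : measure_display) (OmegaX : measurableType dX)
  (PX : V -> probability OmegaX R)
  (Y : nat -> OmegaX -> V) (H : nat -> OmegaX -> \bar R)
  (X_ctmc : is_ctmc T C PX Y H)
  (dL : measure_display) (OmegaL : measurableType dL)
  (PL : probability OmegaL R)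
  (L : OmegaL -> {measure set (cloop R V) -> \bar R})
  (d : measure_display) (Omega : measurableType d) (P : probability Omega R)
  (Lbar : Omega -> {measure set (dloop V) -> \bar R})
  (Lbar_law : is_discrete_soup0 x0
     (fun A => (alpha%:E * loop_measure PX Y H A)%E) P PL L Lbar).
Local Notation J := (jump_prob T C).
Local Open Scope ereal_scope.

Let mu (A : set (cloop R V)) := alpha%:E * loop_measure PX Y H A.

Let avoiding i : set (cloop R V) :=
  [set g | loop_class i (map fst g) /\ x0 \notin map fst g].

Definition soup_intensity (i : nat) : R := fine (mu (avoiding i)).

Let Lbar_pp : is_point_process Lbar.
Proof. by case: Lbar_law. Qed.

Let measurable_avoiding i : measurable (avoiding i).
Proof.
apply: (cloop_states_measurable (Q := fun p => loop_class i p /\ x0 \notin p)).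
by move=> p j [pi x0p]; split; [exact: rot_inv_loop_class|rewrite mem_rot].
Qed.

Let loop_measure0 : loop_measure PX Y H set0 = 0.
Proof.
rewrite /loop_measure esum1// => x _; rewrite integral0_eq// => t _.
by rewrite (_ : mkset _ = set0) ?measure0 ?mule0//; apply/seteqP; split => // w [k []].
Qed.

Let avoidingE i : avoiding i = if (@loop_of V i == [::]) || (x0 \in @loop_of V i) then set0
  else ([set g | map fst (g : seq (V * R)) \in rots (@loop_of V i)] : set (cloop R V)).
Proof.
rewrite /avoiding; case: ifPn => [/orP[/eqP h|h]|].
- apply/seteqP; split => // g /= [] gi _; have := loop_class_size gi.
  by move: gi; rewrite /loop_class/= h.
- by apply/seteqP; split => // g /= [gi]; rewrite (perm_mem (rots_perm gi)) h.
- rewrite negb_or => /andP[_ x0z]; apply/seteqP; split => [g []//|g /= gi].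
  by split=> //; rewrite (perm_mem (rots_perm gi)).
Qed.

Let loop_of_size i : @loop_of V i != [::] -> (1 < size (@loop_of V i))%N.
Proof. by have [->|[/andP[]]//] := @loop_ofP V i. Qed.

Let mu_avoiding_fin i : mu (avoiding i) \is a fin_num.
Proof.
rewrite /mu avoidingE; case: ifPn => [_|]; first by rewrite loop_measure0 mule0.
rewrite negb_or => /andP[/loop_of_size zi _]; apply: fin_numM => //.
exact: (loop_measure_fin C_gt0 nbr0 X_ctmc zi).
Qed.

Let mu_ge0 A : 0 <= mu A.
Proof.
apply: mule_ge0; rewrite ?lee_fin//; apply: esum_ge0 => x _.
apply: integral_ge0 => t /=; rewrite in_itv/= andbT => t0.
by apply: mule_ge0 => //; rewrite lee_fin invr_ge0 ltW.
Qed.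

Lemma soup_intensity_ge0 i : (0 <= soup_intensity i)%R.
Proof. exact: fine_ge0. Qed.

Lemma soup_poisson i k : P [set w | class_count Lbar i w = k%:R%:E] =
  (soup_intensity i ^+ k / k`!%:R * expR (- soup_intensity i))%:E.
Proof.
have [ppp _ law] := Lbar_law.
have := law 1%N (fun=> loop_class i) (fun=> [set k%:R%:E])
  (fun=> measurable_loop_class i) (fun=> emeasurable_set1 _).
have E1 (U : Type) (Q : U -> Prop) : [set w | forall _ : 'I_1, Q w] = [set w | Q w].
  by apply/seteqP; split => w h //; exact: (h ord0).
rewrite (E1 _ (fun w => Lbar w (loop_class i) = k%:R%:E)).
rewrite (E1 _ (fun w => discrete_soup0 x0 (L w) (loop_class i) = k%:R%:E)) => ->.
rewrite (ppp_fin ppp (measurable_avoiding i))//.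
by rewrite ltey_eq mu_avoiding_fin.
Qed.

Lemma soup_indep (K : seq nat) (a : nat -> \bar R) : uniq K ->
  P [set w | forall i, i \in K -> class_count Lbar i w = a i] =
  \prod_(i <- K) P [set w | class_count Lbar i w = a i].
Proof.
move=> uK; have [ppp _ law] := Lbar_law.
have lawE (k : nat) (f : 'I_k -> nat) :
    P [set w | forall j, class_count Lbar (f j) w = a (f j)] =
    PL [set w | forall j, L w (avoiding (f j)) = a (f j)].
  exact: (law k (fun j => loop_class (f j)) (fun j => [set a (f j)])
    (fun j => measurable_loop_class _) (fun j => emeasurable_set1 _)).
have -> : [set w | forall i, i \in K -> class_count Lbar i w = a i] =
    [set w | forall j : 'I_(size K), class_count Lbar (nth 0%N K j) w = a (nth 0%N K j)].
  apply/seteqP; split => w /= h.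
    by move=> j; apply: h; exact: mem_nth.
  by move=> i /(nthP 0%N)[j jK <-]; exact: (h (Ordinal jK)).
rewrite lawE (ppp_indep ppp (A := fun j : 'I_(size K) => avoiding (nth 0%N K j))
  (fun j => a (nth 0%N K j)))//; last first.
  move=> j j' _ _ [g [[h1 _] [h2 _]]]; apply/val_inj/eqP.
  by rewrite -(nth_uniq 0%N (ltn_ord j) (ltn_ord j') uK) (loop_class_inj h1 h2).
rewrite (big_nth 0%N) big_mkord; apply: eq_bigr => j _.
have := lawE 1%N (fun=> nth 0%N K j).
have E1 (U : Type) (Q : U -> Prop) : [set w | forall _ : 'I_1, Q w] = [set w | Q w].
  by apply/seteqP; split => w h //; exact: (h ord0).
rewrite (E1 _ (fun w => class_count Lbar (nth 0%N K j) w = a (nth 0%N K j))).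
by rewrite (E1 _ (fun w => L w (avoiding (nth 0%N K j)) = a (nth 0%N K j))).
Qed.

Let rooted_weight x y p : \bar R :=
  (alpha * ([&& last x p == x, head x p == y & x0 \notin p]%:R * pathw J x p))%:E.

Let rooted_weight_ge0 x y p : 0 <= rooted_weight x y p.
Proof.
rewrite lee_fin !mulr_ge0// pathw_ge0// => u v.
exact: (jump_prob_ge0 C_gt0 nbr0).
Qed.

Lemma soup_intensity_crossings i x y : y \in nbr T x ->
  (soup_intensity i * (edge_crossings T i (x, y))%:R)%:E =
  \sum_(p <- rots (loop_of i)) rooted_weight x y p.
Proof.
move=> yx; rewrite EFinM fineK// /mu avoidingE /edge_crossings/= yx.
case: ifPn => [/orP[/eqP ->|x0z]|].
- by rewrite mule0 big_nil.
- rewrite loop_measure0 mule0 mul0e big1_seq// => p /andP[_ pz].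
  by rewrite /rooted_weight (perm_mem (rots_perm pz)) x0z !andbF mul0r mulr0.
rewrite negb_or => /andP[/loop_of_size zi x0z].
rewrite -muleA (loop_measure_crossings C_gt0 nbr0 X_ctmc)//.
rewrite ge0_sume_distrr; last first.
  move=> p _; rewrite lee_fin mulr_ge0// pathw_ge0// => u v.
  exact: (jump_prob_ge0 C_gt0 nbr0).
apply: eq_big_seq => p pz; rewrite -EFinM /rooted_weight.
by rewrite (perm_mem (rots_perm pz)) x0z andbT.
Qed.

Let esum_rooted x y (f : seq V -> \bar R) : y \in nbr T x -> (forall p, 0 <= f p) ->
  \esum_(p in [set p | (1 < size p)%N]) (rooted_weight x y p * f p) =
  alpha%:E * \esum_(p in rooted_loops x0 x `&` [set p | head x p = y])
    ((pathw J x p)%:E * f p).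
Proof.
move=> yx f0; have xy : x != y by apply: contraTneq yx => ->; exact: nbr_irrefl.
have J0 u v : (0 <= J u v)%R := jump_prob_ge0 C_gt0 nbr0 u v.
rewrite -esumZl//; last first.
  by move=> p; rewrite mule_ge0// lee_fin pathw_ge0.
rewrite [LHS](esum_restrict (B := rooted_loops x0 x `&` [set p | head x p = y])); last first.
  move=> p _ np; rewrite /rooted_weight.
  case: and3P => [[/eqP lp /eqP hp x0p]|_]; last by rewrite mul0r mulr0 mul0e.
  by exfalso; apply: np.
rewrite (_ : _ `&` _ = rooted_loops x0 x `&` [set p | head x p = y]); last first.
  apply/setIidr => -[|u [|v p]] [[/= lp x0p] hp]//.
  - by move: xy; rewrite hp eqxx.
  - by move: xy; rewrite -lp hp eqxx.
apply: eq_esum => p [[lp x0p] hp].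
by rewrite /rooted_weight lp hp !eqxx x0p mul1r EFinM muleA.
Qed.

(** [palm] inserts a loop of each class with weight intensity times crossings of [xy]. By
    [soup_intensity_crossings] this amounts to inserting a loop rooted at [x] that starts with [xy],
    with [alpha] times its path weight. *)
Lemma soup_palm (b : V * V -> nat) (s : seq (V * V * nat)) x y k :
  y \in nbr T x -> ((x, y), k) \in s ->
  (k - b (x, y))%N%:R%:E * P (net_event (class_count Lbar) (edge_crossings T) b s) =
  alpha%:E * \esum_(p in rooted_loops x0 x `&` [set p | head x p = y])
    ((pathw J x p)%:E * P (net_event (class_count Lbar) (edge_crossings T)
       (fun e => b e + ecr T (x :: p) e.1 e.2)%N s)).
Proof.
move=> yx ks.
rewrite -[LHS]/((((x, y), k).2 - b ((x, y), k).1)%N%:R%:E * _).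
rewrite (palm (edge_crossings T) (measurable_class_count Lbar_pp)
  (natval_class_count Lbar_pp) soup_indep soup_poisson b ks).
rewrite -esum_rooted// -esum_loop_class; last first.
  by move=> p; exact: mule_ge0.
apply: eq_eseriesr => i _; rewrite soup_intensity_crossings//.
rewrite ge0_sume_distrl; last by move=> p _.
apply: eq_big_seq => p pz.
rewrite /rooted_weight; case: (eqVneq (last x p) x) => [lp|_]; last first.
  by rewrite mul0r mulr0 !mul0e.
congr (_ * P (net_event _ _ _ _)); apply/funext => e; congr (_ + _)%N.
rewrite /edge_crossings /ecr; case: ifP => // _.
by rewrite (crossings_rooted _ _ lp) (loop_crossings_rots _ _ pz).
Qed.

(* Followed by a fixed path from [x] to [x0], the rooted loops at [x] are disjoint
   events: the first visit to [x0] tells where the loop ends. *)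
Lemma green_finite x : x != x0 ->
  \esum_(p in rooted_loops x0 x) (pathw J x p)%:E < +oo.
Proof.
move=> xx0; have J0 u v : (0 <= J u v)%R := jump_prob_ge0 C_gt0 nbr0 u v.
have [q [pq lq]] := tree_connected T x x0.
have x0q : x0 \in q.
  case: q lq {pq} => [/= xE|u q <- /=]; first by rewrite xE eqxx in xx0.
  exact: mem_last.
have q_gt0 : (0 < pathw J x q)%R.
  elim: q x pq {xx0 lq x0q} => //= u q IH x /andP[ux pq].
  by rewrite mulr_gt0 ?IH//; exact: (jump_prob_gt0 C_gt0 nbr0).
pose F p := [set w | mkseq (Y^~ w) (size (x :: p ++ q)) = x :: p ++ q].
have idx s w n : x0 \notin s -> F s w -> (size (x :: s ++ q) <= n)%N ->
    index x0 (mkseq (Y^~ w) n) = (size s + index x0 q).+1.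
  move=> x0s Fs sn; rewrite -(subnKC sn) /mkseq iotaD map_cat -/(mkseq _ _) Fs.
  rewrite index_cat inE mem_cat x0q !orbT/= (negbTE xx0) index_cat.
  by rewrite (negbTE x0s).
have tF : trivIset (rooted_loops x0 x) F.
  move=> p p' [_ x0p] [_ x0p'] [w [Fp Fp']].
  have [pn pn'] : (size (x :: p ++ q) <= maxn (size (x :: p ++ q)) (size (x :: p' ++ q)))%N
    /\ (size (x :: p' ++ q) <= maxn (size (x :: p ++ q)) (size (x :: p' ++ q)))%N.
    by rewrite leq_maxl leq_maxr.
  have spp' : size p = size p'.
    by have := idx _ _ _ x0p Fp pn; rewrite (idx _ _ _ x0p' Fp' pn') => -[] /addIn.
  have : x :: p ++ q = x :: p' ++ q.
    by rewrite -Fp -Fp'/= !size_cat spp'.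
  by case=> /eqP; rewrite eqseq_cat// => /andP[/eqP].
have mF p : measurable (F p) := measurable_follow X_ctmc _ _.
have : (pathw J x q)%:E * (\esum_(p in rooted_loops x0 x) (pathw J x p)%:E) <= 1.
  rewrite -esumZl//; [|exact: ltW|by move=> p; rewrite lee_fin pathw_ge0].
  rewrite (_ : \esum_(_ in _) _ = PX x (\bigcup_(p in rooted_loops x0 x) F p)).
    by apply: probability_le1; exact: measurable_bigcup_count.
  rewrite measure_esum//; apply: eq_esum => p [lp _].
  transitivity (((x == x)%:R * pathw J x (p ++ q))%:E).
    by rewrite eqxx mul1r pathw_cat lp mulrC EFinM.
  exact/esym/(follow_law C_gt0 nbr0 X_ctmc x (x :: p ++ q)).
rewrite ltey; apply: contraTneq => ->.
by rewrite gt0_muley// leye_eq.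
Qed.

(** The mean number of crossings is at most [alpha] times the sum in [green_finite]; at [x = x0] it
    is 0, since no loop passes there. *)
Lemma soup_net_finite x y : y \in nbr T x ->
  P [set w | soup_net T Lbar (x, y) w = +oo] = 0.
Proof.
move=> yx; have J0 u v : (0 <= J u v)%R := jump_prob_ge0 C_gt0 nbr0 u v.
have mN := measurable_soup_net T Lbar_pp (x, y).
have N0 w : 0 <= soup_net T Lbar (x, y) w.
  by apply: natval_ge0; apply: natval_crossing_sum (natval_class_count Lbar_pp) _ _.
have meanE : \int[P]_w soup_net T Lbar (x, y) w =
    alpha%:E * \esum_(p in rooted_loops x0 x `&` [set p | head x p = y])
      (pathw J x p)%:E.
  rewrite (crossing_sum_mean (edge_crossings T) (measurable_class_count Lbar_pp)
    (natval_class_count Lbar_pp) soup_intensity_ge0 soup_poisson).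
  under eq_eseriesr do rewrite soup_intensity_crossings//.
  rewrite esum_loop_class//.
  rewrite -(eq_esum (fun p _ => mule1 (rooted_weight x y p))).
  rewrite esum_rooted//; congr (_ * _).
  by apply: eq_esum => p _; rewrite mule1.
have fin : \int[P]_w soup_net T Lbar (x, y) w < +oo.
  rewrite meanE; have [xE|xx0] := eqVneq x x0.
    rewrite (_ : _ `&` _ = set0) ?esum_set0 ?mule0//.
    apply/seteqP; split => // -[|u p] [[/= lp x0p] hp]//.
      by move: yx; rewrite -hp (negbTE (nbr_irrefl _ _)).
    by move: x0p; rewrite -xE -{1}lp mem_last.
  rewrite lte_mul_pinfty// ?lee_fin//.
  apply: le_lt_trans (green_finite xx0); rewrite esum_mkcondr.
  by apply: le_esum => p _; case: ifP => // _; rewrite lee_fin pathw_ge0.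
have /integrable_ae : P.-integrable [set: Omega] (soup_net T Lbar (x, y)).
  apply/integrableP; split => //.
  by under eq_integral do rewrite gee0_abs//.
move=> /(_ measurableT); case=> A [mA PA0 NA].
apply/eqP; rewrite eq_le measure_ge0 andbT -PA0 le_measure ?inE//.
  by rewrite -[X in measurable X]setTI; exact: (mN measurableT _ (emeasurable_set1 _)).
by move=> w /= Nw; apply: NA => /= /(_ Logic.I); rewrite Nw.
Qed.
End soup_law.

(** * The path stopped at the root *)

Section stopped_words.
Context (V : countType) (x0 : V).
Implicit Types (p g : seq V) (x : nat -> V).

Definition stopped_word (m : nat) : set (seq V) :=
  [set g | exists2 p, stopped x0 m x0 p & g = x0 :: p].

Lemma visits_count x l : visits x0 x l = count_mem x0 (behead (mkseq x l.+1)).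
Proof.
rewrite /visits /= count_map -sum1_count [RHS]big_mkcond/=.
rewrite /index_iota subSS subn0; apply: eq_bigr => j _ /=.
by case: eqP.
Qed.

Lemma last_count_gt0 y p : last y p = x0 -> p != [::] -> (0 < count_mem x0 p)%N.
Proof.
by case: p => // z p lp _; rewrite -has_count has_pred1 -lp; exact: (mem_last z p).
Qed.

Lemma count_take_lt y p j : last y p = x0 -> (j < size p)%N ->
  (count_mem x0 (take j p) < count_mem x0 p)%N.
Proof.
move=> lp jp; rewrite -[in ltnRHS](cat_take_drop j p) count_cat -[ltnLHS]addn0 ltn_add2l.
rewrite -has_count has_pred1 -lp -(cat_take_drop j p) last_cat cat_take_drop.
case E : (drop j p) => [|z q]; last exact: (mem_last z q).
by move/(congr1 size): E; rewrite size_drop/= => /eqP; rewrite subn_eq0 leqNgt jp.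
Qed.

Lemma take_mkseq x j n : (j <= n)%N -> take j (mkseq x n) = mkseq x j.
Proof. by move=> jn; rewrite /mkseq -map_take take_iota (minn_idPl jn). Qed.

(** Prescribing the stopped path prescribes its first [(size p).+1] states and nothing else: the
    event is a cylinder, to which finite-dimensional laws apply. *)
Lemma path_upto_tau_eq m x y p : stopped x0 m y p ->
  path_upto_tau x0 m x = y :: p <-> mkseq x (size p).+1 = y :: p.
Proof.
case: m => [|m] [lp cp].
  have [->|/(last_count_gt0 lp)] := eqVneq p [::]; first by [].
  by rewrite cp.
rewrite /path_upto_tau; case: pselect => [tau|ntau].
  case: ex_minnP => l /andP[l0 /eqP vl] lmin; split=> [E|E].
    by have /(congr1 size) := E; rewrite size_mkseq/= => -[<-].
  have pE j : (j <= size p)%N -> visits x0 x j = count_mem x0 (take j p).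
    move=> jp; rewrite visits_count; congr count.
    have -> : behead (mkseq x j.+1) = take j (behead (mkseq x (size p).+1)).
      by rewrite -[mkseq x j.+1](take_mkseq x (n := (size p).+1)).
    by rewrite E.
  suff -> : l = size p by [].
  apply/eqP; rewrite eqn_leq; apply/andP; split.
    apply: lmin; rewrite pE// take_size cp eqxx andbT lt0n size_eq0.
    by apply: contra_eqN cp => /eqP ->.
  rewrite leqNgt; apply/negP => lp'.
  by have := count_take_lt lp lp'; rewrite -pE ?vl ?cp ?ltnn// ltnW.
split=> // E; exfalso; apply: ntau; exists (size p).
rewrite visits_count E/= cp eqxx andbT lt0n size_eq0.
by apply: contra_eqN cp => /eqP ->.
Qed.

Lemma path_upto_tau_tau m x : (0 < m)%N ->
  (exists l, (0 < l)%N && (visits x0 x l == m)) ->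
  exists2 p, stopped x0 m (x 0%N) p & path_upto_tau x0 m x = x 0%N :: p.
Proof.
case: m => // m _ tau; rewrite /path_upto_tau; case: pselect => // tau'.
case: ex_minnP => -[//|l] /andP[_ /eqP vl] lmin.
exists (behead (mkseq x l.+2)) => //.
split; last by rewrite -visits_count.
apply: contrapT => lx; have xl : x l.+1 != x0.
  apply/eqP => xl; apply: lx; rewrite -[behead _]/(map x (iota 1 l.+1)).
  by rewrite -(addn1 l) iotaD map_cat last_cat /= add1n.
have : visits x0 x l = m.+1.
  move: vl; rewrite /visits big_nat_recr//= (negbTE xl) addn0 => <-.
  by [].
case: l {vl lx xl} lmin => [|l] lmin vl; first by rewrite /visits big_nil in vl.
by have := lmin l.+1; rewrite vl eqxx => /(_ isT); rewrite ltnn.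
Qed.

Lemma path_upto_tauP m x : x 0%N = x0 ->
  path_upto_tau x0 m x = [::] \/ stopped_word m (path_upto_tau x0 m x).
Proof.
case: m => [|m] xE; first by right; exists [::]; rewrite //= xE.
have [tau|ntau] := pselect (exists l, (0 < l)%N && (visits x0 x l == m.+1)).
  by right; have [p] := path_upto_tau_tau (ltn0Sn m) tau; rewrite xE; exists p.
by left; rewrite /path_upto_tau; case: pselect.
Qed.

Lemma path_upto_tau_io m x : x 0%N = x0 ->
  (forall k, exists2 l, (k <= l)%N & x l = x0) ->
  stopped_word m (path_upto_tau x0 m x).
Proof.
case: m => [|m] xE io; first by exists [::]; rewrite //= xE.
have [p] : exists2 p, stopped x0 m.+1 (x 0%N) p & path_upto_tau x0 m.+1 x = x 0%N :: p.
  apply: path_upto_tau_tau => //.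
  suff [l vl] : exists l, visits x0 x l = m.+1.
    by exists l; rewrite vl eqxx andbT; case: l vl => //; rewrite /visits big_nil.
  elim: m.+1 => [|j [l vl]]; first by exists 0%N; rewrite /visits big_nil.
  have [l' ll' xl'] := io l.+1.
  have [k kP kmin] := ex_minnP (ex_intro (fun k => (l < k)%N && (x k == x0)) l'
    (introT andP (conj ll' (introT eqP xl')))).
  have /andP[lk xk] := kP.
  exists k; rewrite -vl /visits -(prednK (leq_ltn_trans (leq0n l) lk)) in xk *.
  rewrite big_nat_recr//= xk addn1; congr S.
  have lk1 : (l <= k.-1)%N by rewrite -ltnS (prednK (leq_ltn_trans (leq0n l) lk)).
  rewrite (big_cat_nat (n := l.+1))//= -[RHS]addn0; congr addn.
  rewrite big_nat big1// => i /andP[li ik].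
  apply/eqP; rewrite eqb0; apply/negP => xi.
  have := kmin i; rewrite li xi => /(_ isT).
  by rewrite leqNgt (leq_trans ik)// (prednK (leq_ltn_trans (leq0n l) lk)).
by rewrite xE; exists p.
Qed.

End stopped_words.

Section path_measurable.
Context (R : realType) (V : countType) (T : tree V) (x0 : V)
  (d : measure_display) (Omega : measurableType d)
  (Xbar : nat -> Omega -> V)
  (mXbar : forall k v, measurable [set w | Xbar k w = v])
  (Lbar : Omega -> {measure set (dloop V) -> \bar R})
  (Lbar_pp : is_point_process Lbar) (m : nat).

Let path_m w : word V := path_upto_tau x0 m (Xbar^~ w).
Let N_m := total_crossings T x0 m Xbar Lbar.

Lemma word_measurable (A : set (word V)) : measurable A.
Proof. exact: sub_sigma_algebra. Qed.

(** The junk word [[::]] is the complement of all other values, so its event needs no separate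
    check. *)
Lemma measurable_countable_fun (f : Omega -> word V) :
  (forall u, u != [::] -> measurable [set w | f w = u]) -> measurable_fun setT f.
Proof.
move=> mf; have mf' u : measurable [set w | f w = u].
  have [->|/mf//] := eqVneq u [::].
  rewrite (_ : mkset _ = ~` \bigcup_(u in [set u | u != [::]]) [set w | f w = u]).
    by apply: measurableC; apply: measurable_bigcup_count.
  apply/seteqP; split => w /=; first by move=> fw [v /= v0 fv]; rewrite -fw fv eqxx in v0.
  by apply: contra_notP => /eqP fw; exists (f w).
move=> _ A _; rewrite setTI (_ : _ @^-1` _ = \bigcup_(u in A) [set w | f w = u]).
  exact: measurable_bigcup_count.
by apply/seteqP; split => [w Aw|w [u Au /= fwu]]; [exists (f w)|rewrite /preimage/= fwu].
Qed.

Lemma measurable_path_upto_tau : measurable_fun setT path_m.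
Proof.
apply: measurable_countable_fun => -[//|y p] _; rewrite /path_m.
case: m => [|k].
  rewrite (_ : mkset _ = [set w | mkseq (Xbar^~ w) 1 = y :: p]) //.
  exact: measurable_mkseq.
have [st|nst] := pselect (stopped x0 k.+1 y p).
  rewrite (_ : mkset _ = [set w | mkseq (Xbar^~ w) (size p).+1 = y :: p]).
    exact: measurable_mkseq.
  by apply/seteqP; split => w /=; have [] := path_upto_tau_eq (Xbar^~ w) st.
rewrite (_ : mkset _ = set0)//; apply/seteqP; split => // w /= E; apply: nst.
have tau : exists l, (0 < l)%N && (visits x0 (Xbar^~ w) l == k.+1).
  by move: E; rewrite /path_upto_tau; case: pselect.
have [q sq] := path_upto_tau_tau (ltn0Sn k) tau.
by rewrite [LHS]E => -[-> ->].
Qed.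

(** [fine] sends an infinite crossing number to 0, hence the second case. *)
Lemma truncn_soup_crossings x y w j : y \in nbr T x ->
  (Num.truncn (fine (soup_crossings (Lbar w) x y)) == j) =
  (soup_net T Lbar (x, y) w == j%:R%:E) ||
  ((j == 0%N) && (soup_net T Lbar (x, y) w == +oo%E)).
Proof.
move=> yx; rewrite (soup_crossingsE Lbar w yx).
have := natval_crossing_sum (edge_crossings T) (natval_class_count Lbar_pp) (x, y) w.
rewrite -/(soup_net _ _ _ _) => -[->|[i ->]] /=; first by rewrite truncn0 eq_sym andbT.
by rewrite natrK eqe eqr_nat andbF orbF.
Qed.

Lemma measurable_total_crossings : measurable_fun setT N_m.
Proof.
apply: (@measurability _ _ _ (network V) _ N_m (@net_cyl V)) => //.
move=> _ [_ [x [y [k ->]]] <-]; rewrite setTI.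
rewrite /preimage /= /N_m /total_crossings.
have [yx|_] := boolP (y \in nbr T x); last first.
  by have [->|k0] := eqVneq k 0%N; [rewrite (_ : mkset _ = setT)//; apply/seteqP; split
    |rewrite (_ : mkset _ = set0)//; apply/seteqP; split => // w /= h; rewrite -h in k0].
have ms c : measurable [set w | soup_net T Lbar (x, y) w = c].
  rewrite -[X in measurable X]setTI.
  exact: (measurable_soup_net T Lbar_pp (x, y) measurableT (emeasurable_set1 c)).
rewrite (_ : mkset _ = \big[setU/set0]_(j < k.+1)
    ([set w | crossings (path_m w) x y = j] `&`
     [set w | Num.truncn (fine (soup_crossings (Lbar w) x y)) = (k - j)%N])); last first.
  rewrite -(bigcup_mkord _ (fun j => [set w | crossings (path_m w) x y = j] `&`
     [set w | Num.truncn (fine (soup_crossings (Lbar w) x y)) = (k - j)%N])).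
  apply/seteqP; split => [w /= <-|w [j /= jk [cj ->]]]; last first.
    by rewrite -/(path_m w) cj subnKC.
  by exists (crossings (path_m w) x y) => /=; [rewrite ltnS leq_addr|rewrite addKn].
apply: bigsetU_measurable => j _; apply: measurableI.
  rewrite -[X in measurable X]setTI.
  exact: (measurable_path_upto_tau measurableT (word_measurable [set u | crossings u x y = j])).
rewrite (_ : mkset _ = [set w | soup_net T Lbar (x, y) w = (k - j)%:R%:E] `|`
  (if (k - j == 0)%N then [set w | soup_net T Lbar (x, y) w = +oo%E] else set0)).
  by apply: measurableU; last case: ifP.
apply/seteqP; split => w /=.
  move=> /eqP; rewrite truncn_soup_crossings// => /orP[/eqP|/andP[-> /eqP]]; by [left|right].
move=> h; apply/eqP; rewrite truncn_soup_crossings//.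
by case: h => [->|]; rewrite ?eqxx//; case: ifP => //= _ ->; rewrite eqxx orbT.
Qed.
End path_measurable.

(** * Moving excursions *)

Section exit_ratio.
Context (R : realType) (V : countType) (T : tree V) (x0 : V) (J : V -> V -> R)
  (J_ge0 : forall u v, 0 <= J u v)
  (J_nbr : forall u v, v \notin nbr T u -> J u v = 0)
  (alpha : R) (alpha_ge0 : 0 <= alpha)
  (x : V) (t : V -> nat) (G : (V * V -> nat) -> \bar R).
Local Open Scope ereal_scope.
Local Notation cr q := (fun e : V * V => ecr T (x :: q) e.1 e.2).
Local Notation loops_via y := (rooted_loops x0 x `&` [set l | head x l = y]).

(** [G c] stands for the probability that the soup, added to crossings [c] of the continuation,
    gives the prescribed numbers; [t y] is the number of crossings of [xy] that remain. [G_palm] is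
    then [soup_palm], and [G_over] says that a continuation cannot cross too often. *)
Hypothesis G_ge0 : forall c, 0 <= G c.
Hypothesis G_palm : forall c y, y \in nbr T x ->
  (t y - c (x, y))%N%:R%:E * G c =
  alpha%:E * \esum_(p in loops_via y)
    ((pathw J x p)%:E * G (fun e => c e + ecr T (x :: p) e.1 e.2)%N).
Hypothesis G_over : forall c y, y \in nbr T x -> (t y < c (x, y))%N -> G c = 0.

Let w q : 0 <= (pathw J x q)%:E.
Proof. by rewrite lee_fin pathw_ge0. Qed.

Let F q := (pathw J x q)%:E * G (cr q).

Let F2 q l := (pathw J x q * pathw J x l)%:E *
  G (fun e => ecr T (x :: q) e.1 e.2 + ecr T (x :: l) e.1 e.2)%N.

Let F_ge0 q : 0 <= F q.
Proof. exact: mule_ge0. Qed.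

Let F2_ge0 q l : 0 <= F2 q l.
Proof. by apply: mule_ge0 => //; rewrite lee_fin mulr_ge0// pathw_ge0. Qed.

Let F_path q : ~~ path (fun u v => v \in nbr T u) x q -> F q = 0.
Proof.
move=> nq; rewrite /F; have [->|/(pathw_path J_nbr) qp] := eqVneq (pathw J x q) 0%R.
  by rewrite mul0e.
by rewrite qp in nq.
Qed.

Let F2_path q l : ~~ path (fun u v => v \in nbr T u) x q -> F2 q l = 0.
Proof.
move=> nq; rewrite /F2; have [->|/(pathw_path J_nbr) qp] := eqVneq (pathw J x q) 0%R.
  by rewrite mul0r mul0e.
by rewrite qp in nq.
Qed.

Let cr_cat a q e : last x a = x -> ecr T (x :: a ++ q) e.1 e.2 =
  (ecr T (x :: a) e.1 e.2 + ecr T (x :: q) e.1 e.2)%N.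
Proof. by move=> la; rewrite ecr_cat la. Qed.

Let F_palm (q : seq V) y : y \in nbr T x ->
  alpha%:E * (\esum_(l in loops_via y) F2 q l) = (t y - ecr T (x :: q) x y)%N%:R%:E * F q.
Proof.
move=> yx; rewrite /F [RHS]muleCA (G_palm _ yx) [RHS]muleCA; congr (_ * _).
rewrite -esumZl ?pathw_ge0//; last by move=> l; exact: mule_ge0.
by apply: eq_esum => l _; rewrite /F2 EFinM muleA.
Qed.

(** The [t y] remaining crossings are shared between the continuation [q] and the soup. If [q] has
    too many, [G_over] makes both sides vanish despite the truncated subtraction. *)
Let F_exit q y : y \in nbr T x ->
  (t y)%:R%:E * F q = (ecr T (x :: q) x y)%:R%:E * F q +
    alpha%:E * \esum_(l in loops_via y) F2 q l.
Proof.
move=> yx; rewrite F_palm// -ge0_muleDl ?lee_fin//.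
have [tc|ct] := ltnP (t y) (ecr T (x :: q) x y).
  by rewrite /F (G_over yx tc) !mule0.
by rewrite -EFinD -natrD subnKC.
Qed.

Let F_exits q : path (fun u v => v \in nbr T u) x q ->
  (\sum_(y <- nbr T x) t y)%N%:R%:E * F q = (count_mem x (belast x q))%:R%:E * F q +
    alpha%:E * \sum_(y <- nbr T x) \esum_(l in loops_via y) F2 q l.
Proof.
move=> pq; rewrite -(exits_count pq) ge0_sume_distrr; last first.
  by move=> y _; apply: esum_ge0.
rewrite !natr_sum -!sumEFin ge0_sume_distrl; last by move=> y _; rewrite lee_fin.
rewrite ge0_sume_distrl; last by move=> y _; rewrite lee_fin.
by rewrite -big_split/= !big_seq; apply: eq_bigr => y yx; exact: F_exit.
Qed.

Let sum_rooted (q : seq V) : (\esum_(l in rooted_loops x0 x) F2 q l) =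
  F q + \sum_(y <- nbr T x) \esum_(l in loops_via y) F2 q l.
Proof.
have nx : x \notin nbr T x := nbr_irrefl T x.
under [in RHS]eq_bigr do rewrite esum_mkcondr.
rewrite -esum_sum; last by move=> l y _ _; case: ifP.
have -> : F q = \esum_(l in rooted_loops x0 x) if l == [::] then F2 q l else 0.
  rewrite (esum_restrict (B := [set [::]])); last by move=> l _ /eqP/negbTE ->.
  rewrite (_ : _ `&` _ = [set [::]]); last first.
    by apply/seteqP; split => l; [case|move=> ->].
  rewrite esum_set1//= /F2 mulr1; congr (_ * G _).
  by apply/funext => e; rewrite /ecr; case: ifP; rewrite ?addn0.
rewrite -esumD; last 2 first.
- by move=> l _; case: ifP.
- by move=> l _; apply: sume_ge0 => y _; case: ifP.
apply: eq_esum => -[|u l] _ /=.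
  rewrite big1_seq ?adde0// => y /andP[_ yx]; rewrite ifN//.
  by apply/negP => /set_mem/= xy; rewrite -xy (negbTE nx) in yx.
rewrite add0e; have [ux|nux] := boolP (u \in nbr T x).
  rewrite (bigD1_seq u)//=; last exact: nbr_uniq.
  rewrite mem_set// big1 ?adde0// => y yu; rewrite ifN//.
  by apply/negP => /set_mem/= uy; rewrite uy eqxx in yu.
rewrite big1_seq; first by rewrite /F2/= J_nbr// mul0r mulr0 mul0e.
move=> y /andP[_ yx]; rewrite ifN//.
by apply/negP => /set_mem/= uy; rewrite uy yx in nux.
Qed.

(** The [-1] of [alpha - 1] appears as [Zy] added on the left, so that extended reals are never
    subtracted. It comes from the start at [x], which is an exit along [x :: q] but not a visit in
    [q]. *)
Lemma exit_ratio r y : y \in nbr T x -> ~ is_parent T x0 x y ->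
  let Z := \esum_(q in stopped x0 r x) F q in
  let Zy := \esum_(q in stopped x0 r x `&` [set q | head x q = y]) F q in
  (t y)%:R%:E * Z + (x != x0)%:R%:E * Zy =
  ((\sum_(y <- nbr T x) t y)%N%:R + alpha * (x != x0)%:R)%:E * Zy.
Proof.
move=> yx npar Z Zy.
have yNx : y != x by apply: contraTneq yx => ->; exact: nbr_irrefl.
have visit q : path (fun u v => v \in nbr T u) x q -> last x q = x0 ->
    head x q = y -> x \in q.
  case: q => [_ _ /= xy|u q /= /andP[_ pq] lq uy]; first by rewrite xy eqxx in yNx.
  by rewrite uy in pq lq *; exact: child_visit npar pq lq.
have swap : (\esum_(q in stopped x0 r x) ((ecr T (x :: q) x y)%:R%:E * F q)) =
  \esum_(q in stopped x0 r x `&` [set q | head x q = y]) ((count_mem x q)%:R%:E * F q).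
  under eq_esum do rewrite /ecr/= yx.
  apply: swap_excursion => // [a e q la le|q i [lq cq] qi qy iq xq].
    rewrite /F !(pathw_cat, la, le) mulrCA; congr (_ * G _).
    by apply/funext => f; rewrite !cr_cat// addnCA.
  apply: F_path; apply/negP => pq; move/negP: xq; apply.
  rewrite (drop_nth x iq) qy; move: pq lq.
  rewrite -{1 2}(cat_take_drop i q) cat_path last_cat (drop_nth x iq) qy /=.
  by move=> /and3P[_ _ pq] lq; exact: child_visit npar pq lq.
(* Exits against visits: the start is an exit but not a visit in [q], while a final [x] is a visit
   but not an exit. *)
have belast_count q : (count_mem x (belast x q) + (last x q == x) = (count_mem x q).+1)%N.
  have := congr1 (count_mem x) (lastI x q).
  by rewrite -cats1 count_cat /= eqxx addn0 add1n => ->.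
have ZE : (t y)%:R%:E * Z = \esum_(q in stopped x0 r x)
    ((ecr T (x :: q) x y)%:R%:E * F q + alpha%:E * \esum_(l in loops_via y) F2 q l).
  by rewrite /Z -esumZl ?ler0n//; apply: eq_esum => q _; exact: F_exit.
(* At the root, these two corrections cancel because [q] ends at [x0], and the soup has no loop:
   both [alpha] and [-1] disappear. *)
have [xx0|xx0] := eqVneq x x0.
  have novia y' q : y' \in nbr T x -> \esum_(l in loops_via y') F2 q l = 0.
    move=> y'x; rewrite (_ : _ `&` _ = set0) ?esum_set0//.
    apply/seteqP; split => // -[|u l] [[/= lx xl] ly].
      by move: y'x; rewrite -ly (negbTE (nbr_irrefl _ _)).
    by move: xl; rewrite -xx0 -{1}lx mem_last.
  rewrite mul0e adde0 mulr0 addr0 ZE.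
  under eq_esum do rewrite novia// mule0 adde0.
  rewrite swap /Zy -esumZl//; apply: eq_esum => q [[lq cq] hq].
  have [pq|/F_path ->] := boolP (path (fun u v => v \in nbr T u) x q); last by rewrite !mule0.
  rewrite F_exits// big1_seq ?mule0 ?adde0; last by move=> y' /andP[_]; exact: novia.
  by have := belast_count q; rewrite lq -xx0 eqxx addn1 => -[->].
have ldx q : stopped x0 r x q -> (last x q == x) = false.
  by case=> ->; rewrite eq_sym (negbTE xx0).
have F2_cat e p l : last x e = x -> F2 p (e ++ l) = F2 (e ++ p) l.
  move=> le; rewrite /F2 !pathw_cat le mulrCA mulrA; congr (_%:E * G _).
  by apply/funext => f; rewrite !cr_cat// addnCA addnA.
have transfer : \esum_(q in stopped x0 r x) (\esum_(l in loops_via y) F2 q l) =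
   \esum_(q in stopped x0 r x `&` [set q | head x q = y])
     (\esum_(l in rooted_loops x0 x) F2 q l).
  apply: transfer_excursion => // p l [lp _] hp bad.
  apply: F2_path; apply/negP => pp.
  have xp := visit _ pp lp hp; case: bad => [|]; first by rewrite xp.
  (* An excursion meeting [x0] before [x], cut at that point, would lead from the child [y] to the
     root without visiting [x]. *)
  move=> x0p; have x0Np : x0 \in p := mem_take x0p.
  rewrite /first_return in_take// ltnS in x0p.
  suff : x \in take (index x0 p).+1 p.
    rewrite in_take// ltnS => /(conj x0p)/andP/anti_leq E.
    by move: xx0; rewrite -(nth_index x xp) -E nth_index// eqxx.
  case: p hp lp pp {xp x0p} x0Np => // u p /= uy lp /andP[_ pp] x0p.
  rewrite -uy in pp lp npar *.
  set k := if _ then _ else _.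
  have lk : last u (take k p) = x0.
    rewrite /k; case: eqVneq => [<-|ux0]; first by rewrite take0.
    rewrite inE eq_sym (negbTE ux0)/= in x0p.
    by rewrite (take_nth u) ?index_mem// last_rcons nth_index.
  have ux : u \in nbr T x by rewrite uy.
  apply: (child_visit ux npar _ lk).
  by rewrite -(cat_take_drop k p) cat_path in pp; case/andP: pp.
rewrite ZE esumD; last 2 first.
- by move=> q _; exact: mule_ge0.
- by move=> q _; rewrite mule_ge0 ?lee_fin// esum_ge0.
rewrite swap esumZl//; last by move=> q; exact: esum_ge0.
rewrite transfer -esumZl//; last by move=> q; exact: esum_ge0.
rewrite mul1e mulr1 /Zy -esumZl ?addr_ge0//.
rewrite -esumD; last 2 first.
- by move=> q _; exact: mule_ge0.
- by move=> q _; rewrite mule_ge0 ?lee_fin// esum_ge0.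
rewrite -esumD; last 2 first.
- by move=> q _; rewrite adde_ge0// mule_ge0 ?lee_fin// esum_ge0.
- by [].
apply: eq_esum => q [sq hq].
have [pq|nq] := boolP (path (fun u v => v \in nbr T u) x q); last first.
  rewrite F_path// !mule0 esum1 ?mule0 ?adde0// => l _; exact: F2_path.
rewrite EFinD ge0_muleDl ?lee_fin// F_exits// sum_rooted.
have := belast_count q; rewrite ldx// addn0 => ->.
rewrite muleDr ?ge0_adde_def ?inE ?sume_ge0//; last first.
  by move=> y' _; exact: esum_ge0.
rewrite -addn1 natrD EFinD ge0_muleDl ?lee_fin// mul1e.
move: (alpha%:E * F q) (alpha%:E * _) => u v.
by rewrite -!addeA; congr (_ + _); rewrite [RHS]addeC [v + u]addeC addeA.
Qed.
End exit_ratio.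

(** * Regular conditional laws *)

Section conditional_law.
Context (R : realType) (d d1 d2 : measure_display) (Omega : measurableType d)
  (P : probability Omega R) (T1 : measurableType d1) (T2 : measurableType d2)
  (f : Omega -> T1) (g : Omega -> T2) (kappa : R.-pker T2 ~> T1)
  (kappa_rcd : is_rcd P f g kappa).
Local Open Scope ereal_scope.

Let mf : measurable_fun setT f. Proof. by case: kappa_rcd. Qed.
Let mg : measurable_fun setT g. Proof. by case: kappa_rcd. Qed.
Let g_mixin := isMeasurableFun.Build _ _ _ _ _ mg.
Let g_mfun : {mfun Omega >-> T2} := HB.pack g g_mixin.
Let Q : probability T2 R := distribution P g_mfun.

Lemma integral_rcd A B : measurable A -> measurable B ->
  \int[Q]_(y in B) kappa y A = P (f @^-1` A `&` g @^-1` B).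
Proof.
move=> mA mB; have [_ _ ->//] := kappa_rcd.
rewrite ge0_integral_pushforward//.
by apply: measurable_funTS; exact: measurable_kernel.
Qed.

Lemma rcd_null A B : measurable A -> measurable B ->
  P (f @^-1` A `&` g @^-1` B) = 0 ->
  {ae pushforward P g, forall y, B y -> kappa y A = 0}.
Proof.
move=> mA mB; rewrite -integral_rcd// => h.
apply/(ae_eq_integral_abs Q mB (f := fun y => kappa y A)).
  by apply: measurable_funTS; exact: measurable_kernel.
by rewrite -[RHS]h; apply: eq_integral => y _; rewrite gee0_abs.
Qed.

(** Integrated against the law of [g], the two sides agree on a pi-system, hence on all measurable
    sets, hence almost everywhere. The set [D] is where coefficients that depend on the condition
    take the constant values [c1], [c2], [c3]. *)
Lemma rcd_linear (G : set (set T2)) (D : set T2) A1 A2 (c1 c2 c3 : R) :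
  @measurable _ T2 = <<s G >> -> setI_closed G -> G setT -> measurable D ->
  measurable A1 -> measurable A2 -> (0 <= c1)%R -> (0 <= c2)%R -> (0 <= c3)%R ->
  (forall S, G S ->
    c1%:E * P (f @^-1` A1 `&` g @^-1` (S `&` D)) +
    c2%:E * P (f @^-1` A2 `&` g @^-1` (S `&` D)) =
    c3%:E * P (f @^-1` A2 `&` g @^-1` (S `&` D))) ->
  {ae pushforward P g, forall y, D y ->
    c1%:E * kappa y A1 + c2%:E * kappa y A2 = c3%:E * kappa y A2}.
Proof.
move=> GE GI GT mD mA1 mA2 c1_ge0 c2_ge0 c3_ge0 PG.
pose F y := c1%:E * kappa y A1 + c2%:E * kappa y A2.
pose F' y := c3%:E * kappa y A2.
have mk A : measurable A -> measurable_fun setT (fun y => kappa y A).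
  exact: measurable_kernel.
have mF : measurable_fun setT F.
  by apply: emeasurable_funD; apply: emeasurable_funM => //; exact: mk.
have mF' : measurable_fun setT F' by apply: emeasurable_funM => //; exact: mk.
have F0 y : 0 <= F y by rewrite adde_ge0// mule_ge0.
have F'0 y : 0 <= F' y by rewrite mule_ge0.
have IF S : measurable S -> \int[Q]_(y in S) F y =
    c1%:E * P (f @^-1` A1 `&` g @^-1` S) + c2%:E * P (f @^-1` A2 `&` g @^-1` S).
  move=> mS; rewrite ge0_integralD//; last 4 first.
  - by move=> y _; rewrite mule_ge0.
  - by apply: measurable_funTS; apply: emeasurable_funM => //; exact: mk.
  - by move=> y _; rewrite mule_ge0.
  - by apply: measurable_funTS; apply: emeasurable_funM => //; exact: mk.
  rewrite !ge0_integralZl//; [|by apply: measurable_funTS; exact: mk..].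
  by rewrite !integral_rcd.
have IF' S : measurable S -> \int[Q]_(y in S) F' y = c3%:E * P (f @^-1` A2 `&` g @^-1` S).
  move=> mS; rewrite ge0_integralZl//; last by apply: measurable_funTS; exact: mk.
  by rewrite integral_rcd.
have Ffin S : measurable S -> \int[Q]_(y in S) F y < +oo.
  move=> mS; have Pfin A : measurable A -> P (f @^-1` A `&` g @^-1` S) < +oo.
    move=> mA; rewrite (le_lt_trans (probability_le1 P _)) ?ltry//.
    by apply: measurableI; rewrite -[X in measurable X]setTI; [exact: mf|exact: mg].
  by rewrite IF// lte_add_pinfty// lte_mul_pinfty// ?lee_fin// Pfin.
have FG S : G S -> \int[Q]_(y in S `&` D) F y = \int[Q]_(y in S `&` D) F' y.
  move=> GS; have mS : measurable S by rewrite GE; exact: sub_gen_smallest.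
  by rewrite IF ?IF'//; [exact: PG|exact: measurableI..].
have FF' S : measurable S -> \int[Q]_(y in S `&` D) F y = \int[Q]_(y in S `&` D) F' y.
  rewrite {1}GE; apply: (dynkin_induction
    (P := fun S => \int[Q]_(y in S `&` D) F y = \int[Q]_(y in S `&` D) F' y) GE GI).
  - exact: FG.
  - exact: FG.
  - move=> {}S mS FS; have mSD := measurableI _ _ mS mD.
    have mSD' := measurableI _ _ (measurableC mS) mD.
    have dis : [disjoint S `&` D & ~` S `&` D].
      by apply/disj_setPS => y [[Sy _] [nSy _]].
    have := FG _ GT; rewrite -(setUv S) setIUl.
    rewrite !ge0_integral_setU//; [|exact: measurable_funTS..].
    (* Passing to complements is a subtraction and requires finite integrals. *)
    have fin : \int[Q]_(y in S `&` D) F' y \is a fin_num.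
      by rewrite -FS ge0_fin_numE ?integral_ge0// Ffin.
    rewrite FS => E; rewrite -[RHS](addeK _ fin) [X in _ = X - _]addeC -E.
    by rewrite [X in _ = X - _]addeC addeK.
  - move=> S' mS tS FS; rewrite setI_bigcupl.
    have mSD n : measurable (S' n `&` D) by exact: measurableI.
    have tSD : trivIset setT (fun n => S' n `&` D).
      apply/trivIsetP => i j _ _ ij; rewrite setIACA.
      by move/trivIsetP : tS => -> //; rewrite set0I.
    rewrite !ge0_integral_bigcup//; [|exact: measurable_funTS..].
    exact: eq_eseriesr.
apply: (integral_ae_eq mD (f := F) (g := F')).
- apply/integrableP; split; first exact: measurable_funTS.
  by under eq_integral do rewrite gee0_abs//; exact: Ffin.
- exact: measurable_funTS.
- by move=> E ED mE; have := FF' E mE; rewrite (setIidl ED).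
Qed.

Lemma rcd_ae_forall (I : countType) (E : I -> T2 -> Prop) :
  (forall i, {ae pushforward P g, forall y, E i y}) ->
  {ae pushforward P g, forall y, forall i, E i y}.
Proof. exact: (@ae_forall_count _ _ _ Q). Qed.

Lemma rcd_aeW (E : T2 -> Prop) : (forall y, E y) -> {ae pushforward P g, forall y, E y}.
Proof. exact: (aeW Q). Qed.

Lemma rcd_aeS (E E' : T2 -> Prop) : (forall y, E y -> E' y) ->
  {ae pushforward P g, forall y, E y} -> {ae pushforward P g, forall y, E' y}.
Proof.
move=> EE'; apply: (@filterS _ _ (ae_filter_ringOfSetsType Q)); exact: EE'.
Qed.
End conditional_law.

(** * Joint law of the path and the crossings *)

Section joint_law.
Context (R : realType) (V : countType) (T : tree V) (x0 : V) (C : V -> V -> R)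
  (C_gt0 : forall x y, y \in nbr T x -> 0 < C x y)
  (nbr0 : forall x, nbr T x != [::])
  (alpha : R) (alpha_ge0 : 0 <= alpha)
  (dX : measure_display) (OmegaX : measurableType dX)
  (PX : V -> probability OmegaX R)
  (Y : nat -> OmegaX -> V) (H : nat -> OmegaX -> \bar R)
  (X_ctmc : is_ctmc T C PX Y H)
  (dL : measure_display) (OmegaL : measurableType dL)
  (PL : probability OmegaL R)
  (L : OmegaL -> {measure set (cloop R V) -> \bar R})
  (d : measure_display) (Omega : measurableType d) (P : probability Omega R)
  (Xbar : nat -> Omega -> V)
  (Lbar : Omega -> {measure set (dloop V) -> \bar R})
  (Xbar_law : is_jump_chain (PX x0) Y P Xbar)
  (Lbar_law : is_discrete_soup0 x0
     (fun A => (alpha%:E * loop_measure PX Y H A)%E) P PL L Lbar)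
  (indep : independent P Xbar Lbar) (m : nat).
Local Notation J := (jump_prob T C).
Local Open Scope ereal_scope.

Let path_m w : word V := path_upto_tau x0 m (Xbar^~ w).
Let N_m := total_crossings T x0 m Xbar Lbar.

Let soup_event := net_event (class_count Lbar) (edge_crossings T).

Let Lbar_pp : is_point_process Lbar.
Proof. by case: Lbar_law. Qed.

Definition net_box (s : seq (V * V * nat)) : set (network V) :=
  [set n | forall t, t \in s -> n t.1.1 t.1.2 = t.2].

Lemma measurable_net_box s : measurable (net_box s : set (network V)).
Proof.
rewrite (_ : net_box s = \big[setI/setT]_(t <- s) [set n | n t.1.1 t.1.2 = t.2]).
  apply: bigsetI_measurable => t _; apply: sub_sigma_algebra.
  by exists t.1.1, t.1.2, t.2.
by rewrite -bigcap_seq; apply/seteqP; split => n h t; exact: h.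
Qed.

Let follow u : set Omega := [set w | mkseq (Xbar^~ w) (size u) = u].

Lemma soup_event_indep u b s :
  P (follow u `&` soup_event b s) = P (follow u) * P (soup_event b s).
Proof.
apply: indep.
- set G := [set E | _].
  suff : @measurable _ (g_sigma_algebraType G) (follow u) by [].
  case: u => [|y p].
    by rewrite (_ : follow _ = setT)//; apply/seteqP.
  rewrite /follow; under eq_set do rewrite mkseq_eq.
  apply: measurable_forall_le => i; apply: sub_sigma_algebra.
  by exists i, (nth y (y :: p) i).
- set G := [set E | _].
  suff : @measurable _ (g_sigma_algebraType G) (soup_event b s) by [].
  apply: measurable_net_event => i; last by move=> w; exact: natval_class_count.
  move=> _ B mB; rewrite setTI; apply: sub_sigma_algebra.
  by exists (loop_class i), B; split => //; exact: measurable_loop_class.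
Qed.

Lemma Xbar_follow y p : P (follow (y :: p)) = ((y == x0)%:R * pathw J y p)%:E.
Proof.
rewrite -(follow_law C_gt0 nbr0 X_ctmc x0 (y :: p)).
have E (U : Type) (X : nat -> U -> V) : [set w | mkseq (X^~ w) (size (y :: p)) = y :: p] =
    [set w | forall i, (i <= size p)%N -> X i w = nth y (y :: p) i].
  by apply/funext => w /=; rewrite mkseq_eq.
by rewrite /follow !E; exact: Xbar_law.2.
Qed.

(** Outside the null event [N0] the soup crossings of edges are finite, so the truncation in
    [total_crossings] loses nothing. The left event then coincides with a cylinder of the chain and
    a soup event, which are independent. *)
Lemma soup_event_box p s : stopped x0 m x0 p ->
  P (path_m @^-1` [set x0 :: p] `&` N_m @^-1` net_box s) =
  (pathw J x0 p)%:E *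
  P (soup_event (fun e => ecr T (x0 :: p) e.1 e.2) s).
Proof.
move=> sp; have follow0 : P (follow (x0 :: p)) = (pathw J x0 p)%:E.
  by rewrite Xbar_follow eqxx mul1r.
rewrite -follow0 -soup_event_indep.
pose N0 := \bigcup_(e in [set e : V * V | e.2 \in nbr T e.1])
  [set w | soup_net T Lbar e w = +oo].
have mN e : measurable [set w | soup_net T Lbar e w = +oo].
  rewrite -[X in measurable X]setTI.
  exact: (measurable_soup_net T Lbar_pp e measurableT (emeasurable_set1 _)).
have mfollow : measurable (follow (x0 :: p)).
  exact: (measurable_mkseq _ _ Xbar_law.1).
have msoup : measurable (soup_event (fun e => ecr T (x0 :: p) e.1 e.2) s).
  apply: measurable_net_event; first exact: measurable_class_count.
  by move=> i w; exact: natval_class_count.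
apply: (measure_eq_mod_null (N := N0)).
- apply: measurableI; rewrite -[X in measurable X]setTI.
    exact: (measurable_path_upto_tau x0 Xbar_law.1 m measurableT (word_measurable _)).
  exact: (measurable_total_crossings T x0 Xbar_law.1 Lbar_pp m measurableT (measurable_net_box s)).
- exact: measurableI.
- exact: measurable_bigcup_count.
- apply: measure_negligible; first exact: measurable_bigcup_count.
  have : {ae P, forall w, forall e : V * V, e.2 \in nbr T e.1 ->
      soup_net T Lbar e w != +oo}.
    apply: ae_forall_count => e; have [ye|ne] := boolP (e.2 \in nbr T e.1).
      exists [set w | soup_net T Lbar e w = +oo]; split => //.
        by have := soup_net_finite C_gt0 nbr0 alpha_ge0 X_ctmc Lbar_law ye; case: (e).
      by move=> w /= /not_implyP[_ /negP]; rewrite negbK => /eqP.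
    exact: aeW.
  by apply: negligibleS => w [e /= ye eoo] /(_ e ye); rewrite eoo eqxx.
move=> w Nw.
have pathE : path_m w = x0 :: p <-> follow (x0 :: p) w := path_upto_tau_eq _ sp.
have boxE x y k : path_m w = x0 :: p -> (N_m w x y == k) =
    ((ecr T (x0 :: p) x y)%:R%:E + soup_net T Lbar (x, y) w == k%:R%:E).
  move=> pw; rewrite /N_m /total_crossings -/(path_m w) pw /ecr.
  have [yx|nyx] := boolP (y \in nbr T x); last first.
    rewrite (_ : soup_net T Lbar (x, y) w = 0) ?adde0 ?eqe ?eqr_nat//.
    by apply: eseries0 => j _ _; rewrite /edge_crossings/= (negbTE nyx) mule0.
  have := natval_crossing_sum (edge_crossings T) (natval_class_count Lbar_pp) (x, y) w.
  rewrite -/(soup_net _ _ _ _) => -[soo|[j sj]].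
    by exfalso; apply: Nw; exists (x, y).
  rewrite sj (_ : Num.truncn _ = j) -?EFinD ?eqe -?natrD ?eqr_nat//.
  by apply/eqP; rewrite (truncn_soup_crossings Lbar_pp w j yx) sj eqxx.
split=> -[/= pw bw]; (split; first exact/pathE).
  by move=> [[x y] k] ts; apply/eqP; rewrite -boxE//; apply/eqP; exact: (bw _ ts).
move=> [[x y] k] ts; apply/eqP; rewrite boxE; last exact/pathE.
by apply/eqP; exact: (bw _ ts).
Qed.

Let J_ge0 u v : (0 <= J u v)%R := jump_prob_ge0 C_gt0 nbr0 u v.

Let J_nbr u v : v \notin nbr T u -> J u v = 0%R.
Proof. by rewrite (jump_probE C nbr0) => /negbTE ->. Qed.

Lemma path_upto_tau_head (X : nat -> V) y p : path_upto_tau x0 m X = y :: p -> X 0%N = y.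
Proof. by rewrite /path_upto_tau; case: m => [[]|k] //; case: pselect => // tau -[]. Qed.

(** Sums [soup_event_box] over the continuations of [a]. The weight of [a] factors out, and
    [m - count_mem x0 a] visits to [x0] remain to be made. *)
Lemma continuation_law a (A : set (seq V)) s : (count_mem x0 a <= m)%N ->
  P ([set w | exists2 q, A q & path_m w = x0 :: a ++ q] `&` N_m @^-1` net_box s) =
  (pathw J x0 a)%:E *
  \esum_(q in stopped x0 (m - count_mem x0 a) (last x0 a) `&` A)
    ((pathw J (last x0 a) q)%:E * P (soup_event (fun e =>
       ecr T (x0 :: a) e.1 e.2 + ecr T (last x0 a :: q) e.1 e.2)%N s)).
Proof.
move=> am; set r := (m - _)%N; set x := last x0 a.
have st q : stopped x0 m x0 (a ++ q) <-> stopped x0 r x q.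
  rewrite /stopped/= last_cat count_cat /r; split=> -[-> h]; split=> //.
    by rewrite -h addKn.
  by rewrite h subnKC.
rewrite (_ : _ `&` _ = \bigcup_(q in stopped x0 r x `&` A)
    (path_m @^-1` [set x0 :: a ++ q] `&` N_m @^-1` net_box s)); last first.
  apply/seteqP; split => [w [[q Aq pw] bw]|w [q [sq Aq] [pw bw]]]; last first.
    by split=> //; exists q.
  exists q => //; split=> //; apply/st.
  have [|[p sp]] := path_upto_tauP m (path_upto_tau_head pw).
    by rewrite -/(path_m w) pw.
  by rewrite -/(path_m w) pw => -[->].
rewrite -esumZl; last 2 first.
- by rewrite pathw_ge0.
- by move=> q; rewrite mule_ge0// lee_fin pathw_ge0.
transitivity (\esum_(q in stopped x0 r x `&` A)
  P (path_m @^-1` [set x0 :: a ++ q] `&` N_m @^-1` net_box s)).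
  apply: (measure_esum P).
    move=> q _; apply: measurableI; rewrite -[X in measurable X]setTI.
      exact: (measurable_path_upto_tau x0 Xbar_law.1 m measurableT (word_measurable _)).
    exact: (measurable_total_crossings T x0 Xbar_law.1 Lbar_pp m measurableT
      (measurable_net_box s)).
  move=> q q' _ _ [w [[/= pq _] [/= pq' _]]]; move: pq'; rewrite pq => -[] /eqP.
  by rewrite eqseq_cat// eqxx => /eqP.
apply: eq_esum => q [/st sq _].
have := soup_event_box s sq.
rewrite pathw_cat EFinM -muleA => h; apply: (eq_trans h); congr (_ * (_ * P _)).
by congr net_event; apply/funext => e; rewrite ecr_cat.
Qed.

Definition prefix_prob g (B : set (network V)) : \bar R :=
  P (path_m @^-1` [set u | prefix g u] `&` N_m @^-1` B).

(* If [k z] is too small for some [z], truncation is harmless, as then both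
   probabilities vanish. *)
Lemma exit_law a y s (k : V -> nat) : let x := last x0 a in
  let t z := (k z - ecr T (x0 :: a) x z)%N in
  (count_mem x0 a <= m)%N -> y \in nbr T x -> ~ is_parent T x0 x y ->
  (forall z, z \in nbr T x -> ((x, z), k z) \in s) ->
  (t y)%:R%:E * prefix_prob (x0 :: a) (net_box s) +
    (x != x0)%:R%:E * prefix_prob (x0 :: rcons a y) (net_box s) =
  ((\sum_(z <- nbr T x) t z)%N%:R + alpha * (x != x0)%:R)%:E *
    prefix_prob (x0 :: rcons a y) (net_box s).
Proof.
move=> x t am yx npar star.
have yNx : y != x by apply: contraTneq yx => ->; exact: nbr_irrefl.
pose G (c : V * V -> nat) :=
  P (soup_event (fun e => ecr T (x0 :: a) e.1 e.2 + c e)%N s).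
have pE : prefix_prob (x0 :: a) (net_box s) = (pathw J x0 a)%:E *
    \esum_(q in stopped x0 (m - count_mem x0 a) x)
      ((pathw J x q)%:E * G (fun e => ecr T (x :: q) e.1 e.2)).
  rewrite -[stopped _ _ _]setIT -continuation_law//; congr (P (_ `&` _)).
  apply/funext => w; apply/propext; split=> [/prefixP[q /= pw]|[q _ /= ->]].
    by exists q.
  exact: (prefix_prefix (x0 :: a)).
have pyE : prefix_prob (x0 :: rcons a y) (net_box s) = (pathw J x0 a)%:E *
    \esum_(q in stopped x0 (m - count_mem x0 a) x `&` [set q | head x q = y])
      ((pathw J x q)%:E * G (fun e => ecr T (x :: q) e.1 e.2)).
  rewrite -continuation_law//; congr (P (_ `&` _)).
  apply/funext => w; apply/propext; split=> [/prefixP[q /= pw]|[[|u q] /= hq]].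
  - by exists (y :: q); rewrite //= pw cat_rcons.
  - by rewrite hq eqxx in yNx.
  - by move=> ->; rewrite hq -cat_rcons; exact: (prefix_prefix (x0 :: rcons a y)).
have Gratio := @exit_ratio R V T x0 J J_ge0 J_nbr alpha alpha_ge0 x t G.
rewrite pE pyE !(muleCA _ (pathw J x0 a)%:E) -ge0_muleDr; first last.
- by rewrite mule_ge0 ?lee_fin// esum_ge0// => q _; rewrite mule_ge0// lee_fin pathw_ge0.
- by rewrite mule_ge0 ?lee_fin// esum_ge0// => q _; rewrite mule_ge0// lee_fin pathw_ge0.
congr (_ * _); apply: Gratio => //.
  move=> c z zx; rewrite /t -subnDA.
  have := soup_palm C_gt0 nbr0 alpha_ge0 X_ctmc Lbar_law
    (fun e => ecr T (x0 :: a) e.1 e.2 + c e)%N zx (star z zx).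
  move=> ->; congr (_ * _); apply: eq_esum => p _; congr (_ * P (net_event _ _ _ _)).
  by apply/funext => e; rewrite addnA.
move=> c z zx tc; rewrite /G (_ : soup_event _ s = set0) ?measure0//.
apply/seteqP; split => // w /(_ _ (star z zx))/= E.
have := leeDl (ecr T (x0 :: a) x z + c (x, z))%N%:R%:E
  (natval_ge0 (natval_crossing_sum (edge_crossings T) (natval_class_count Lbar_pp) (x, z) w)).
rewrite E lee_fin ler_nat => le; move: tc; rewrite /t; lia.
Qed.

Variables (kappa : R.-pker (network V) ~> (word V))
  (kappa_rcd : is_rcd P path_m N_m kappa).

(** For each fixed value [k] of [n u v] the event is empty, since a path that begins with [g]
    already crosses [uv] more than [k] times. *)
Lemma rcd_crossings : {ae pushforward P N_m, forall n : network V,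
  forall (g : seq V) u v, v \in nbr T u -> (n u v < crossings g u v)%N ->
  kappa n [set u : word V | prefix g u] = 0}.
Proof.
apply: (rcd_ae_forall kappa_rcd) => g; apply: (rcd_ae_forall kappa_rcd) => u.
apply: (rcd_ae_forall kappa_rcd) => v.
have [vu|nvu] := boolP (v \in nbr T u); last exact: (rcd_aeW kappa_rcd).
suff : {ae pushforward P N_m, forall n : network V, forall k, n u v = k ->
    (k < crossings g u v)%N -> kappa n [set u : word V | prefix g u] = 0}.
  by apply: (rcd_aeS kappa_rcd) => n h _; exact: h.
apply: (rcd_ae_forall kappa_rcd) => k.
have [kg|gk] := ltnP k (crossings g u v); last exact: (rcd_aeW kappa_rcd).
suff : {ae pushforward P N_m, forall n : network V, [set n : network V | n u v = k] n ->
    kappa n [set u : word V | prefix g u] = 0}.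
  by apply: (rcd_aeS kappa_rcd) => n h nk _; exact: h.
apply: (rcd_null kappa_rcd); [exact: word_measurable|by apply: sub_sigma_algebra; exists u, v, k|].
rewrite (_ : _ `&` _ = set0) ?measure0//; apply/seteqP; split => // w [/= /prefixP[q pw]].
rewrite /N_m /total_crossings vu -/(path_m w) pw => E.
case: g kg pw E => [|z g] kg pw E; first by [].
by move: kg; rewrite -E cat_cons crossings_cat -addnA ltnNge leq_addr.
Qed.

(** The coefficients depend on [n] through the crossing numbers out of [x]. Freezing these to values
    [vs], on the box [star vs], gives the constant coefficients that [rcd_linear] wants. As [x] has
    finitely many neighbours, [vs] ranges over a countable set and one null set serves for all. *)
Lemma rcd_exit : {ae pushforward P N_m, forall n : network V,
  forall a y, let x := last x0 a in
    let t z := (n x z - crossings (x0 :: a) x z)%N in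
    (count_mem x0 a <= m)%N -> y \in nbr T x -> ~ is_parent T x0 x y ->
    (t y)%:R%:E * kappa n [set u : word V | prefix (x0 :: a) u] +
      (x != x0)%:R%:E * kappa n [set u : word V | prefix (x0 :: rcons a y) u] =
     ((\sum_(z <- nbr T x) t z)%N%:R + alpha * (x != x0)%:R)%:E *
       kappa n [set u : word V | prefix (x0 :: rcons a y) u]}.
Proof.
apply: (rcd_ae_forall kappa_rcd) => a; apply: (rcd_ae_forall kappa_rcd) => y.
set x := last x0 a.
have [am|nam] := leqP (count_mem x0 a) m; last exact: (rcd_aeW kappa_rcd).
have [yx|/negP nyx] := boolP (y \in nbr T x); last first.
  by apply: (rcd_aeW kappa_rcd) => n /= _ /nyx.
have [par|npar] := pselect (is_parent T x0 x y).
  by apply: (rcd_aeW kappa_rcd) => n /= _ _ /(_ par).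
pose val (vs : seq nat) z := nth 0%N vs (index z (nbr T x)).
pose star vs := [seq ((x, z), val vs z) | z <- nbr T x].
pose t vs z := (val vs z - ecr T (x0 :: a) x z)%N.
suff : {ae pushforward P N_m, forall n : network V, forall vs, net_box (star vs) n ->
    (t vs y)%:R%:E * kappa n [set u : word V | prefix (x0 :: a) u] +
      (x != x0)%:R%:E * kappa n [set u : word V | prefix (x0 :: rcons a y) u] =
     ((\sum_(z <- nbr T x) t vs z)%N%:R + alpha * (x != x0)%:R)%:E *
       kappa n [set u : word V | prefix (x0 :: rcons a y) u]}.
  apply: (rcd_aeS kappa_rcd) => n /(_ [seq n x z | z <- nbr T x]) h /= _ _ _.
  have valE z : z \in nbr T x -> val [seq n x z | z <- nbr T x] z = n x z.
    by move=> zx; rewrite /val (nth_map x) ?index_mem// nth_index.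
  have tE z : z \in nbr T x ->
      t [seq n x z | z <- nbr T x] z = (n x z - crossings (x0 :: a) x z)%N.
    by move=> zx; rewrite /t valE// /ecr zx.
  rewrite -tE// (eq_big_seq _ (fun z zx => esym (tE z zx))) h//.
  by move=> _ /mapP[z zx ->] /=; rewrite valE.
apply: (rcd_ae_forall kappa_rcd) => vs.
have GE : @measurable _ (network V) = <<s range net_box >>.
  apply/seteqP; split.
    apply: sub_smallest2r => // _ [u [v [k ->]]]; exists [:: ((u, v), k)] => //.
    by apply/seteqP; split => n /= => [h|h e]; [exact: (h _ (mem_head _ _))|rewrite inE => /eqP ->].
  apply: smallest_sub; first exact: sigma_algebra_measurable.
  by move=> _ [s _ <-]; exact: measurable_net_box.
apply: (rcd_linear kappa_rcd GE).
- move=> _ _ [s _ <-] [s' _ <-]; exists (s ++ s') => //.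
  apply/seteqP; split => n /= => [h|[h h'] e]; last by rewrite mem_cat => /orP[/h|/h'].
  by split=> e es; apply: h; rewrite mem_cat es ?orbT.
- by exists [::] => //; apply/seteqP; split.
- exact: measurable_net_box.
- exact: word_measurable.
- exact: word_measurable.
- by [].
- by [].
- by rewrite addr_ge0// mulr_ge0.
move=> _ [s _ <-].
have -> : net_box s `&` net_box (star vs) = net_box (s ++ star vs).
  apply/seteqP; split => n /= => [[h h'] e|h]; first by rewrite mem_cat => /orP[/h|/h'].
  by split=> e es; apply: h; rewrite mem_cat es ?orbT.
apply: (exit_law am yx npar (k := val vs)).
by move=> z zx; rewrite mem_cat; apply/orP; right; apply/mapP; exists z.
Qed.
End joint_law.

(** * Laws determined by the exit identities *)

Section process_law.
Context (R : realType) (V : countType) (T : tree V) (x0 : V) (alpha : R)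
  (n : network V) (nu : {measure set (word V) -> \bar R}).
Local Notation step := (fun u v => v \in nbr T u).

Definition good_word (m : nat) : set (word V) :=
  [set g | exists2 p, stopped x0 m x0 p /\ path step x0 p & g = x0 :: p].

Local Notation m := (net_at T n x0).
Local Notation pre g := (nu [set u : word V | prefix g u]).

Hypotheses (nu1 : nu setT = 1%E) (nu_good : nu (~` good_word m) = 0%E)
  (nu_crossings : forall (g : seq V) u v, v \in nbr T u ->
    (n u v < crossings g u v)%N -> pre g = 0%E)
  (nu_exit : forall a y, let x := last x0 a in
    let t z := (n x z - crossings (x0 :: a) x z)%N in
    (count_mem x0 a <= m)%N -> y \in nbr T x -> ~ is_parent T x0 x y ->
    ((t y)%:R%:E * pre (x0 :: a) + (x != x0)%:R%:E * pre (x0 :: rcons a y) =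
     ((\sum_(z <- nbr T x) t z)%N%:R + alpha * (x != x0)%:R)%:E *
       pre (x0 :: rcons a y))%E).

Let mw (A : set (word V)) : measurable A := word_measurable A.

Let nu_le (A B : set (word V)) : A `<=` B -> (nu A <= nu B)%E.
Proof. by move=> AB; apply: le_measure; rewrite ?inE//; exact: mw. Qed.

Let nu_fin (A : set (word V)) : nu A \is a fin_num.
Proof.
by rewrite ge0_fin_numE// (@le_lt_trans _ _ 1%E) ?ltry// -nu1 nu_le.
Qed.

Let nu_full (A : set (word V)) : good_word m `<=` A -> nu A = 1%E.
Proof.
move=> gA; rewrite -nu1; apply: (measure_eq_mod_null (N := ~` good_word m)).
- exact: mw.
- exact: mw.
- exact: mw.
- by [].
by move=> w /contrapT/gA.
Qed.

(** A path that starts and ends at [x0] leaves it as often as it comes back. *)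
Lemma exits_at_root p : path step x0 p -> last x0 p = x0 ->
  Theta_at R T n (x0 :: p) x0 = m%:R - (count_mem x0 p)%:R.
Proof.
move=> pp lp; rewrite /Theta_at /Theta sumrB /net_at natr_sum; congr (_ - _).
have -> : count_mem x0 p = count_mem x0 (belast x0 p).
  have := congr1 (count_mem x0) (lastI x0 p).
  by rewrite -cats1 count_cat /= lp eqxx addn0 add1n addn1 => -[].
rewrite -(exits_count pp) natr_sum !big_seq; apply: eq_bigr => y yx.
by rewrite /ecr yx.
Qed.

Lemma good_word_stop g : good_word m g -> is_T R T x0 n g (size g).-1.
Proof.
move=> [p [[lp cp] pp] ->]; split => [|j /= jp [nj]].
  split; first by rewrite (nth_last x0 (x0 :: p)).
  by rewrite /= take_size exits_at_root// cp subrr.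
move=> /=; rewrite exits_at_root; last 2 first.
- by rewrite -(cat_take_drop j p) cat_path in pp; case/andP: pp.
- case: j jp nj => [|j] jp; first by rewrite take0.
  by rewrite (take_nth x0 (ltnW jp)) last_rcons.
move/eqP; rewrite subr_eq0 eqr_nat => /eqP E.
by have := count_take_lt lp jp; rewrite cp -E ltnn.
Qed.

(** [k] is the first index by which [x0] has been revisited [m] times; by minimality the path is
    then at [x0]. In contrapositive form, a path that is not exhausted still has a return to
    make. *)
Lemma exhausted_exists a : path step x0 a -> (m <= count_mem x0 a)%N ->
  exists2 k, (k <= size a)%N & exhausted R T x0 n (x0 :: a) k.
Proof.
move=> pa ma; have ex : exists k, (m <= count_mem x0 (take k a))%N.
  by exists (size a); rewrite take_size.
case: (ex_minnP ex) => k mk kmin.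
have ka : (k <= size a)%N by apply: kmin; rewrite take_size.
exists k => //; have [lk ck] : last x0 (take k a) = x0 /\ count_mem x0 (take k a) = m.
  case: k mk kmin ka => [|k] mk kmin ka.
    by rewrite take0; split=> //; move: mk; rewrite take0/= leqn0 => /eqP.
  have : ~~ (m <= count_mem x0 (take k a))%N.
    by apply/negP => /kmin; rewrite ltnn.
  rewrite -ltnNge => kl; move: mk; rewrite (take_nth x0)// -cats1 count_cat/= addn0.
  rewrite cats1 last_rcons; case: eqVneq => [-> |_]; last by rewrite addn0 leqNgt kl.
  by rewrite addn1 => mk; split=> //; apply/eqP; rewrite eqn_leq kl mk.
split.
  case: k lk ka {ck mk kmin} => [//|k] lk ka.
  by move: lk; rewrite (take_nth x0)// last_rcons.
rewrite /= exits_at_root// ?ck ?subrr//.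
by rewrite -(cat_take_drop k a) cat_path in pa; case/andP: pa.
Qed.

Lemma prefix_good g : pre g != 0%E -> g != [::] ->
  exists2 a, path step x0 a & g = x0 :: a.
Proof.
move=> g0 gn0; apply: contrapT => ng; move/eqP: g0; apply.
apply/eqP; rewrite eq_le measure_ge0 andbT -nu_good; apply: nu_le => u /= gu [p [_ pp] E].
apply: ng; move: gu; rewrite E; case: g gn0 => // z g _ /= /andP[/eqP -> /prefixP[q pE]].
by exists g => //; move: pp; rewrite pE cat_path => /andP[].
Qed.

(** Since [am] is strict, a good word beginning with [x0 :: a] cannot end there, so it has exactly
    one next state, a neighbour. *)
Lemma prefix_split a : path step x0 a -> (count_mem x0 a < m)%N ->
  pre (x0 :: a) = (\sum_(z <- nbr T (last x0 a)) pre (x0 :: rcons a z))%E.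
Proof.
move=> pa am; transitivity (nu (\bigcup_(z in [set` nbr T (last x0 a)])
    [set u : word V | prefix (x0 :: rcons a z) u])).
  apply: (measure_eq_mod_null (N := ~` good_word m)) => //; [exact: mw..|].
  move=> u /contrapT[p [[lp cp] pp] ->]; split => [/= /andP[_]|[z /= zx /andP[_]]].
    move=> /prefixP[[|z q] pE]; first by move: am; rewrite -cp pE cats0 ltnn.
    exists z; first by move: pp; rewrite pE cat_path /= => /and3P[].
    by rewrite /= eqxx/= pE -cat_rcons prefix_prefix.
  by rewrite eqxx/= => /prefixP[q ->]; rewrite cat_rcons prefix_prefix.
rewrite measure_fin_bigcup//; last 2 first.
- exact: finite_seq.
- move=> z z' _ _ [u [/prefixP[q E] /prefixP[q' E']]].
  have := congr1 (fun s => nth x0 s (size a).+1) (etrans (esym E) E').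
  by rewrite /= !cat_rcons !nth_cat ltnn subnn.
by rewrite -fsbig_seq// nbr_uniq.
Qed.

(** The term [alpha - 1] is carried by the parent alone, which is unique for [x != x0] and missing
    at the root. *)
Lemma cTheta_atE a : let x := last x0 a in
  (forall y, y \in nbr T x -> (crossings (x0 :: a) x y <= n x y)%N) ->
  cTheta_at T x0 alpha n (x0 :: a) x =
  (\sum_(z <- nbr T x) (n x z - crossings (x0 :: a) x z))%N%:R + (alpha - 1) * (x != x0)%:R.
Proof.
move=> x le; rewrite /cTheta_at /cTheta big_split/= -mulr_sumr natr_sum.
congr (_ + _ * _).
  by rewrite !big_seq; apply: eq_bigr => y yx; rewrite natrB// le.
have [->|xx0] := eqVneq x x0.
  rewrite big1// => y _; rewrite asboolF//; exact: root_no_parent.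
have [y0 py0] := parent_exists T xx0.
rewrite (bigD1_seq y0) ?nbr_uniq//=; last exact: parent_nbr py0.
rewrite asboolT// big1 ?addr0// => y yy0; rewrite asboolF// => py.
by rewrite (parent_unique py py0) eqxx in yy0.
Qed.

Let crossings_le a : pre (x0 :: a) != 0%E ->
  forall z, z \in nbr T (last x0 a) ->
  (crossings (x0 :: a) (last x0 a) z <= n (last x0 a) z)%N.
Proof.
move=> a0 z zx; rewrite leqNgt; apply/negP => /(nu_crossings zx) E.
by rewrite E eqxx in a0.
Qed.

Let sum_exits a := (\sum_(z <- nbr T (last x0 a))
  (n (last x0 a) z - crossings (x0 :: a) (last x0 a) z))%N.

Lemma child_mass a y : let x := last x0 a in
  (count_mem x0 a <= m)%N -> y \in nbr T x -> ~ is_parent T x0 x y ->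
  fine (pre (x0 :: rcons a y)) * ((sum_exits a)%:R + (alpha - 1) * (x != x0)%:R) =
  (n x y - crossings (x0 :: a) x y)%N%:R * fine (pre (x0 :: a)).
Proof.
move=> x am yx npar; have := nu_exit am yx npar.
rewrite -(fineK (nu_fin _)) -(fineK (nu_fin [set u | prefix (x0 :: rcons a y) u])).
rewrite -!EFinM -EFinD => -[]; rewrite -/x -/(sum_exits a) /=.
move: (fine (nu [set u | prefix (x0 :: a) u])) (fine _) => p q; lra.
Qed.

Let fine_prefix_split a : path step x0 a -> (count_mem x0 a < m)%N ->
  fine (pre (x0 :: a)) = \sum_(z <- nbr T (last x0 a)) fine (pre (x0 :: rcons a z)).
Proof.
move=> pa am; rewrite prefix_split//.
under eq_bigr do rewrite -(fineK (nu_fin _)).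
by rewrite sumEFin.
Qed.

Let nonexhausted z x : pre (rcons z x) != 0%E ->
  (forall k, (k <= size z)%N -> ~ exhausted R T x0 n (rcons z x) k) ->
  exists a, [/\ rcons z x = x0 :: a, path step x0 a, last x0 a = x &
    (count_mem x0 a < m)%N].
Proof.
move=> g0 nex; have [|a pa E] := prefix_good g0; first by case: (z).
exists a; split=> //; first by rewrite -[RHS](last_rcons x0 z) E.
rewrite ltnNge; apply/negP => /(exhausted_exists pa)[k ka exk].
apply: (nex k); last by rewrite E.
by move: (congr1 size E); rewrite size_rcons /= => -[->].
Qed.

Lemma process_lawP : is_process_law T x0 alpha n nu.
Proof.
split.
- by apply: nu_full => g [p _ ->].
- move=> z x y nex cT_gt0 yx.
  have [g0|g0] := eqVneq (pre (rcons z x)) 0%E.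
    rewrite g0 mule0; apply/eqP; rewrite eq_le measure_ge0 andbT -g0.
    apply: nu_le => u /=; exact: prefix_trans (prefix_rcons _ _).
  have [a [E pa la am]] := nonexhausted g0 nex.
  rewrite E in g0 cT_gt0 *; rewrite -la in cT_gt0 yx *.
  have le := crossings_le g0.
  have SE := cTheta_atE le; rewrite -/(sum_exits a) in SE.
  rewrite SE in cT_gt0 *; set S := _ + _ in cT_gt0 *.
  have S0 : S != 0 by rewrite gt_eqF.
  have child w : w \in nbr T (last x0 a) -> ~ is_parent T x0 (last x0 a) w ->
      fine (pre (x0 :: rcons a w)) = cTheta T x0 alpha n (x0 :: a) (last x0 a) w / S
        * fine (pre (x0 :: a)).
    move=> wx nw; have := child_mass (ltnW am) wx nw; rewrite -/S => h.
    rewrite /cTheta asboolF// mulr0 addr0 /Theta -natrB ?le//.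
    by rewrite mulrAC -h mulfK.
  rewrite -(fineK (nu_fin _)) -(fineK (nu_fin [set u | prefix (x0 :: a) u])) -EFinM.
  congr _%:E; rewrite -[LHS]/(fine (pre (x0 :: rcons a y))).
  (* All other neighbours of [last x0 a] are children, so the parent gets the mass that [child]
     leaves in [fine_prefix_split]. *)
  have [ypar|npar] := pselect (is_parent T x0 (last x0 a) y); last exact: child.
  have := fine_prefix_split pa am; rewrite (bigD1_seq y)//= ?nbr_uniq//.
  have -> : \sum_(w <- nbr T (last x0 a) | w != y) fine (pre (x0 :: rcons a w)) =
      (\sum_(w <- nbr T (last x0 a) | w != y)
        cTheta T x0 alpha n (x0 :: a) (last x0 a) w) / S * fine (pre (x0 :: a)).
    rewrite !mulr_suml big_seq_cond [RHS]big_seq_cond.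
    apply: eq_bigr => w /andP[wx wy]; apply: child => // wpar.
    by rewrite (parent_unique wpar ypar) eqxx in wy.
  have SE' : S = cTheta T x0 alpha n (x0 :: a) (last x0 a) y +
      \sum_(w <- nbr T (last x0 a) | w != y) cTheta T x0 alpha n (x0 :: a) (last x0 a) w.
    by rewrite /S -SE /cTheta_at (bigD1_seq y)//= nbr_uniq.
  move=> h; apply: (addIr ((\sum_(w <- nbr T (last x0 a) | w != y)
    cTheta T x0 alpha n (x0 :: a) (last x0 a) w) / S * fine (pre (x0 :: a)))).
  by rewrite -h -mulrDl -mulrDl -SE' divff// mul1r.
- move=> z x y nex cT0 xx0 ypar.
  have le_g : (pre (rcons (rcons z x) y) <= pre (rcons z x))%E.
    apply: nu_le => u /=; exact: prefix_trans (prefix_rcons _ _).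
  have [g0|g0] := eqVneq (pre (rcons z x)) 0%E.
    by apply/eqP; rewrite eq_le le_g g0 measure_ge0.
  have [a [E pa la am]] := nonexhausted g0 nex.
  rewrite E in g0 cT0 *; rewrite -la in cT0 xx0 ypar *.
  have le := crossings_le g0.
  have := cTheta_atE le; rewrite cT0 -/(sum_exits a) => SE.
  rewrite [RHS]prefix_split// (bigD1_seq y) ?nbr_uniq//=; last exact: parent_nbr ypar.
  rewrite big1_seq ?adde0// => w /andP[wy wx].
  have npar : ~ is_parent T x0 (last x0 a) w.
    by move=> wpar; rewrite (parent_unique wpar ypar) eqxx in wy.
  (* When the total weight is 0, the identity for a child says that no crossing to it is left; one
     more step there exceeds [n] and has mass 0. *)
  have := child_mass (ltnW am) wx npar; rewrite -SE mulr0 => /esym/eqP.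
  rewrite mulf_eq0 pnatr_eq0 subn_eq0 => /orP[nc|]; last first.
    by move=> /eqP f0; move: g0; rewrite -(fineK (nu_fin _)) f0 eqxx.
  apply: (nu_crossings (u := last x0 a) wx).
  rewrite -cat1s -cats1 /= crossings_cat.
  by rewrite /crossings/= eqxx addn0 addn1 ltnS.
- by apply: nu_full => g; exact: good_word_stop.
Qed.
End process_law.

(** * Recurrence *)

Section recurrence.
Context (R : realType) (V : countType) (T : tree V) (x0 : V) (C : V -> V -> R)
  (C_gt0 : forall x y, y \in nbr T x -> 0 < C x y)
  (nbr0 : forall x, nbr T x != [::])
  (dX : measure_display) (OmegaX : measurableType dX)
  (PX : V -> probability OmegaX R)
  (Y : nat -> OmegaX -> V) (H : nat -> OmegaX -> \bar R)
  (X_ctmc : is_ctmc T C PX Y H) (X_rec : recurrent Y H PX).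
Local Open Scope ereal_scope.

Let mY k v : measurable [set w | Y k w = v] := ctmc_mY X_ctmc k v.
Let mH k : measurable_fun [set: OmegaX] (H k) := ctmc_mH X_ctmc k.

(** Splitting over the countably many words of first states makes the rates deterministic, as
    [holding_fin_null] requires. *)
Lemma holding_finite : {ae PX x0, forall w, forall k, 0 < H k w < +oo}.
Proof.
apply: ae_forall_count => k.
suff : {ae PX x0, forall w, forall u : seq V, mkseq (Y^~ w) k.+1 = u -> 0 < H k w < +oo}.
  by apply: (@filterS _ _ (ae_filter_ringOfSetsType (PX x0))) => w; exact.
apply: ae_forall_count => -[|y p]; first exact: aeW.
have [pk|pk] := eqVneq (size p) k; last first.
  by apply: (aeW (PX x0)) => w E; move: pk; rewrite -[size p]/(size (y :: p)).-1 -E size_mkseq eqxx.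
rewrite -{}pk {k}.
pose E := [set w | mkseq (Y^~ w) (size p).+1 = y :: p].
pose B := [set w | forall i, (i <= size p)%N -> 0 < H i w < +oo].
have mE : measurable E by exact: (measurable_mkseq _ _ mY).
have := @holding_fin_null _ _ _ (PX x0) H (size p) (fun i => rate T C (nth y (y :: p) i))
  ((y == x0)%:R * pathw (jump_prob T C) y p) E mH mE.
move=> null; exists (E `&` ~` B); split.
- apply: measurableI => //; apply: measurableC; apply: measurable_forall_le => i.
  rewrite (_ : mkset _ = [set w | 0 < H i w] `&` [set w | H i w < +oo]); last first.
    by apply/seteqP; split => w /= => [/andP[]|[-> ->]].
  apply: measurableI; rewrite -[X in measurable X]setTI.
    exact: emeasurable_fun_o_infty.
  exact: emeasurable_fun_infty_o.
- apply: null.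
  + by move=> i; exact: rate_gt0.
  + exact: (follow_law C_gt0 nbr0 X_ctmc x0 (y :: p)).
  + move=> s s0; rewrite -(prod_pathw T C y y p).
    rewrite -(ctmc_law X_ctmc x0 (size p) (nth y (y :: p)) s0); congr (PX x0 _).
    rewrite /E; under eq_set do rewrite mkseq_eq.
    apply/seteqP; split => w /= => [[yp sH] i ik|h]; last by split=> i /h[].
    by split; [exact: yp|exact: sH].
move=> w /= /not_implyP[Ew nH]; split=> // /(_ (size p) (leqnn _)).
exact: nH.
Qed.

(** [recurrent] speaks of large times, the jump chain of large indices. With finite holding times
    every jump time is finite, and a visit after the [k]-th jump time has index at least [k]. *)
Lemma visits_io : {ae PX x0, forall w, Y 0%N w = x0 /\
  forall k, exists2 l, (k <= l)%N & Y l w = x0}.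
Proof.
have start : {ae PX x0, forall w, Y 0%N w = x0}.
  exists (~` [set w | Y 0%N w = x0]); split; [exact: measurableC| |by []].
  by rewrite probability_setC// (chain_start X_ctmc) eqxx subee.
have ae := ae_filter_ringOfSetsType (PX x0).
apply: (@filterS _ _ ae _ _ _ (@filterI _ _ ae _ _ start
  (@filterI _ _ ae _ _ holding_finite (X_rec x0)))).
move=> w [/= Y0 [Hw rec]]; split=> // k.
have jt j : exists2 r : R, jump_time H j w = r%:E & (0 <= r)%R.
  exists (\sum_(i < j) fine (H i w))%R; last first.
    by apply: sumr_ge0 => i _; apply: fine_ge0; case/andP: (Hw i) => /ltW.
  rewrite -sumEFin; apply: eq_bigr => i _; rewrite fineK//.
  by case/andP: (Hw i) => h1 h2; rewrite ge0_fin_numE// ltW.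
have [r rE _] := jt k; have [t [rt [l [[_ tl] Yl]]]] := rec r.
exists l => //; rewrite leqNgt; apply/negP => lk.
have : jump_time H l.+1 w <= jump_time H k w.
  rewrite /jump_time -(subnKC lk) big_split_ord/= leeDl// sume_ge0// => i _.
  by case/andP: (Hw (l.+1 + i)%N) => /ltW.
by rewrite rE => /(lt_le_trans tl); rewrite lte_fin ltNge rt.
Qed.

Context (d : measure_display) (Omega : measurableType d) (P : probability Omega R)
  (Xbar : nat -> Omega -> V) (Xbar_law : is_jump_chain (PX x0) Y P Xbar) (m : nat).

(** [Xbar] is tied to [Y] through finite-dimensional laws. The stopped path has countably many
    values, each a cylinder event, so the almost sure finiteness of the stopping time carries over
    by summation. *)
Lemma path_good : P [set w | good_word T x0 m (path_upto_tau x0 m (Xbar^~ w))] = 1.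
Proof.
have followE p : P [set w | mkseq (Xbar^~ w) (size p).+1 = x0 :: p] =
    PX x0 [set w | mkseq (Y^~ w) (size p).+1 = x0 :: p].
  under eq_set do rewrite mkseq_eq.
  under [in RHS]eq_set do rewrite mkseq_eq.
  exact: Xbar_law.2.
have decomp (U : Type) (X : nat -> U -> V) (A : set (seq V)) : A `<=` stopped x0 m x0 ->
    [set w | exists2 p, A p & path_upto_tau x0 m (X^~ w) = x0 :: p] =
    \bigcup_(p in A) [set w | mkseq (X^~ w) (size p).+1 = x0 :: p].
  move=> As; apply/seteqP; split => w [p Ap /=].
    by move=> /(path_upto_tau_eq _ (As _ Ap)); exists p.
  by move=> /(path_upto_tau_eq _ (As _ Ap)); exists p.
have triv (U : Type) (X : nat -> U -> V) (A : set (seq V)) : A `<=` stopped x0 m x0 ->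
    trivIset A (fun p => [set w | mkseq (X^~ w) (size p).+1 = x0 :: p]).
  move=> As p q Ap Aq [w [/= /(path_upto_tau_eq _ (As _ Ap)) pE]].
  by move=> /(path_upto_tau_eq _ (As _ Aq)); rewrite pE => -[].
pose good := stopped x0 m x0 `&` [set p | path (fun u v => v \in nbr T u) x0 p].
have -> : [set w | good_word T x0 m (path_upto_tau x0 m (Xbar^~ w))] =
    \bigcup_(p in good) [set w | mkseq (Xbar^~ w) (size p).+1 = x0 :: p].
  rewrite -decomp; last by move=> p [].
  by apply/seteqP; split => w [p [h1 h2] E]; exists p.
have mX p : measurable [set w | mkseq (Xbar^~ w) (size p).+1 = x0 :: p].
  exact: (measurable_mkseq _ _ Xbar_law.1).
rewrite measure_esum//; last by apply: triv => p [].
transitivity (\esum_(p in stopped x0 m x0)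
    PX x0 [set w | mkseq (Y^~ w) (size p).+1 = x0 :: p]).
  rewrite (esum_restrict (B := [set p | path (fun u v => v \in nbr T u) x0 p])).
    by apply: eq_esum => p _; exact: followE.
  move=> p _ np; rewrite (follow_law C_gt0 nbr0 X_ctmc x0 (x0 :: p)) eqxx mul1r.
  have J0 u v : v \notin nbr T u -> jump_prob T C u v = 0%R.
    by rewrite (jump_probE C nbr0) => /negbTE ->.
  by have [->//|/(pathw_path J0)] := eqVneq (pathw (jump_prob T C) x0 p) 0%R.
rewrite -measure_esum; [|by move=> p _; exact: (measurable_mkseq _ _ mY)|exact: triv].
rewrite -decomp//.
have mE : measurable [set w | exists2 p, stopped x0 m x0 p &
    path_upto_tau x0 m (Y^~ w) = x0 :: p].
  by rewrite decomp//; apply: measurable_bigcup_count => p _; exact: (measurable_mkseq _ _ mY).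
rewrite -[RHS](probability_setT (PX x0)).
apply: (measure_eq_mod_null (N := ~` [set w | exists2 p, stopped x0 m x0 p &
    path_upto_tau x0 m (Y^~ w) = x0 :: p])) => //; first exact: measurableC.
  apply: measure_negligible; first exact: measurableC.
  apply: (@filterS _ _ (ae_filter_ringOfSetsType (PX x0))) visits_io => w [Y0 io].
  have [p sp pE] := path_upto_tau_io m Y0 io.
  by exists p.
by move=> w /contrapT.
Qed.
End recurrence.

(** * Existence of the conditional law *)

Section partial_density.
Context (R : realType) (d d2 : measure_display) (Omega : measurableType d)
  (P : probability Omega R) (T2 : measurableType d2) (g : {mfun Omega >-> T2})
  (D : set Omega) (mD : measurable D).
Local Open Scope ereal_scope.

Let nu (B : set T2) : \bar R := P (D `&` g @^-1` B).

Let mgB B : measurable B -> measurable (D `&` g @^-1` B).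
Proof. by move=> mB; apply: measurableI => //; exact: measurable_funPTI. Qed.

Let nu0 : nu set0 = 0.
Proof. by rewrite /nu preimage_set0 setI0 measure0. Qed.

Let nu_ge0 B : 0 <= nu B.
Proof. exact: measure_ge0. Qed.

Let nu_sigma_additive : semi_sigma_additive nu.
Proof.
move=> F mF tF mUF; rewrite /nu preimage_bigcup setI_bigcupr.
apply: measure_semi_sigma_additive.
- by move=> n; exact: mgB.
- by move=> i j _ _ [w [[_ Fi] [_ Fj]]]; apply: tF => //; exists (g w).
- by rewrite -setI_bigcupr -preimage_bigcup; exact: mgB.
Qed.

HB.instance Definition _ := isMeasure.Build _ _ _ nu nu0 nu_ge0 nu_sigma_additive.

Let nu_fin : fin_num_fun nu.
Proof.
move=> B mB; rewrite ge0_fin_numE// (le_lt_trans (probability_le1 P _)) ?ltry//.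
exact: mgB.
Qed.

HB.instance Definition _ := Measure_isFinite.Build _ _ _ nu nu_fin.

(** [nu] is dominated by the law of [g]; its Radon-Nikodym derivative is the conditional probability
    of [D] given [g]. *)
Lemma partial_density : exists h : T2 -> \bar R,
  [/\ forall y, 0 <= h y, forall y, h y \is a fin_num, measurable_fun setT h &
    forall B, measurable B ->
      \int[distribution P g]_(y in B) h y = P (D `&` g @^-1` B)].
Proof.
have numu : nu `<< distribution P g.
  apply/null_content_dominatesP => B mB PB0.
  apply: (subset_measure0 (mu := P) _ _ _ PB0); [exact: mgB|exact: measurable_funPTI|].
  by move=> w [].
have [h [h0 hfin hi hE]] := radon_nikodym_sigma_finite numu.
exists h; split=> //; first exact: measurable_int hi.
by move=> B mB; rewrite -hE.
Qed.
End partial_density.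

Section rcd_existence.
Context (R : realType) (d d2 : measure_display) (Omega : measurableType d)
  (P : probability Omega R) (V : countType) (T2 : measurableType d2)
  (f : Omega -> word V) (g : Omega -> T2)
  (mf : measurable_fun setT f) (mg : measurable_fun setT g).
Local Open Scope ereal_scope.

Let g_mixin := isMeasurableFun.Build _ _ _ _ _ mg.
Let g_mfun : {mfun Omega >-> T2} := HB.pack g g_mixin.
Let Q : probability T2 R := distribution P g_mfun.

(** As there are countably many words, the kernel can be built as a series of point masses, each
    weighted by the conditional probability that [f] is that word. [D n] is empty when [n] encodes
    no word. *)
Let D (n : nat) : set Omega := [set w | @pickle_inv (seq V) n = Some (f w)].

Let mD n : measurable (D n).
Proof.
rewrite -[X in measurable X]setTI.
exact: (mf measurableT (word_measurable [set u | pickle_inv n = Some u])).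
Qed.

Let h n := sval (cid (partial_density P g_mfun (mD n))).

Let hP n : [/\ forall y, 0 <= h n y, forall y, h n y \is a fin_num, measurable_fun setT (h n) &
    forall B, measurable B -> \int[Q]_(y in B) h n y = P (D n `&` g @^-1` B)].
Proof. exact: svalP (cid (partial_density P g_mfun (mD n))). Qed.

Let u n : word V := odflt [::] (pickle_inv n).

Let h_ge0 n y : 0 <= h n y. Proof. by case: (hP n). Qed.

Let fine_h_ge0 n y : (0 <= fine (h n y))%R.
Proof. exact: fine_ge0. Qed.

Let atom n y : {measure set (word V) -> \bar R} :=
  mscale (NngNum (fine_h_ge0 n y)) \d_(u n).

Let atomE n y A : atom n y A = h n y * \d_(u n) A.
Proof. by rewrite /atom/= /mscale/= fineK//; case: (hP n). Qed.

Let measurable_atom n A : measurable A -> measurable_fun setT (atom n ^~ A).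
Proof.
move=> mA; rewrite (_ : (fun y => _) = fun y => h n y * \d_(u n) A); last first.
  by apply/funext => y; exact: atomE.
by apply: emeasurable_funM => //; case: (hP n).
Qed.

HB.instance Definition _ n := isKernel.Build _ _ _ _ _ (atom n) (measurable_atom n).

Let k : R.-ker T2 ~> word V := kseries atom.

Let integral_k A B : measurable B ->
  \int[Q]_(y in B) k y A = P (f @^-1` A `&` g @^-1` B).
Proof.
move=> mB; have mA : measurable A by exact: word_measurable.
have mfA : measurable (f @^-1` A) by rewrite -[X in measurable X]setTI; exact: mf.
have mgB : measurable (g @^-1` B) by rewrite -[X in measurable X]setTI; exact: mg.
transitivity (\int[Q]_(y in B) \sum_(n <oo) (h n y * \d_(u n) A)).
  by apply: eq_integral => y _; apply: eq_eseriesr => n _; exact: atomE.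
rewrite integral_nneseries//; last 2 first.
- move=> n; apply: measurable_funTS; apply: emeasurable_funM => //.
  by case: (hP n).
- by move=> n y _; exact: mule_ge0.
transitivity (\sum_(n <oo) P (D n `&` (f @^-1` A `&` g @^-1` B))).
  apply: eq_eseriesr => n _; have [_ hfin mh hE] := hP n.
  rewrite ge0_integralZr//; last exact: measurable_funTS.
  rewrite hE// diracE; have [uA|uA] := boolP (u n \in A); last first.
    rewrite mule0 (_ : _ `&` _ = set0) ?measure0//.
    apply/seteqP; split => // w [Dn [/= Af _]]; move: uA.
    by rewrite notin_setE /u Dn /=.
  rewrite mule1; congr (P _); rewrite setIA; congr (_ `&` _).
  by apply/esym/setIidl => w Dn; move: uA; rewrite inE /u Dn.
rewrite nneseries_esumT// -measure_esum.
- rewrite -setI_bigcupl (_ : \bigcup_n D n = setT) ?setTI//.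
  by apply/seteqP; split => // w _; exists (pickle (f w : seq V)) => //; exact: pickleK_inv.
- by move=> n _; apply: measurableI => //; exact: measurableI.
- move=> n n' _ _ [w [[Dn _] [Dn' _]]].
  have inv i : @pickle_inv (seq V) i = Some (f w) -> i = pickle (f w : seq V).
    by move=> E; have := @pickle_invK (seq V) i; rewrite /= E.
  by rewrite (inv n Dn) (inv n' Dn').
Qed.

(* [knormalize] only changes [k] on a null set, where its mass is not 1. *)
Lemma rcd_exists : exists kappa : R.-pker T2 ~> word V, is_rcd P f g kappa.
Proof.
exists (knormalize k \d_([::] : word V)); split=> // A B mA mB.
have mk U : measurable U -> measurable_fun setT (k ^~ U) by exact: measurable_kernel.
have k1 : ae_eq Q setT (k ^~ setT) (cst 1).
  apply: (integral_ae_eq measurableT) => //.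
  - apply/integrableP; split; first exact: mk.
    under eq_integral do rewrite gee0_abs//.
    rewrite integral_k// preimage_setT setTI.
    by rewrite (le_lt_trans (probability_le1 P _)) ?ltry// preimage_setT.
  - by move=> E _ mE; rewrite integral_k// preimage_setT setTI integral_cst// mul1e.
transitivity (\int[Q]_(y in B) knormalize k \d_([::] : word V) y A); last first.
  rewrite ge0_integral_pushforward//.
  by apply: measurable_funTS; exact: measurable_kernel.
rewrite -integral_k//; apply: (ae_eq_integral (mu := Q)) => //.
- by apply: measurable_funTS; exact: mk.
- by apply: measurable_funTS; exact: measurable_kernel.
move: k1; rewrite /ae_eq.
apply: (@filterS _ _ (ae_filter_ringOfSetsType Q)) => y /(_ Logic.I) ky _.
have norm1 (mu : {measure set (word V) -> \bar R}) : mu setT = 1 ->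
    mnormalize mu \d_([::] : word V) A = mu A.
  by move=> mu1; rewrite /mnormalize mu1 eqe oner_eq0/= invr1 mule1.
exact/esym/(norm1 (k y) ky).
Qed.
End rcd_existence.

(** * The conditioned path *)

Section single_vertex.
Context (V : countType) (T : tree V).

Lemma single_vertex x : nbr T x = [::] -> forall u, nbr T u = [::].
Proof.
move=> x_nbr u; have [[|v p] [/= pp lp]] := tree_connected T x u.
  by rewrite -lp.
by rewrite x_nbr in pp.
Qed.
End single_vertex.

Theorem proposition3p4 (R : realType) (V : countType) (T : tree V) (x0 : V)
  (C : V -> V -> R) (C_gt0 : forall x y, y \in nbr T x -> 0 < C x y)
  (alpha : R) (alpha_ge0 : 0 <= alpha)
  (dX : measure_display) (OmegaX : measurableType dX)
  (PX : V -> probability OmegaX R)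
  (Y : nat -> OmegaX -> V) (H : nat -> OmegaX -> \bar R)
  (X_ctmc : is_ctmc T C PX Y H) (X_rec : recurrent Y H PX)
  (dL : measure_display) (OmegaL : measurableType dL)
  (PL : probability OmegaL R)
  (L : OmegaL -> {measure set (cloop R V) -> \bar R})
  (d : measure_display) (Omega : measurableType d) (P : probability Omega R)
  (Xbar : nat -> Omega -> V)
  (Lbar : Omega -> {measure set (dloop V) -> \bar R})
  (Xbar_law : is_jump_chain (PX x0) Y P Xbar)
  (Lbar_law : is_discrete_soup0 x0
     (fun A => (alpha%:E * loop_measure PX Y H A)%E) P PL L Lbar)
  (indep : independent P Xbar Lbar)
  (m : nat) :
  let path_m := fun w => path_upto_tau x0 m (fun k => Xbar k w) in
  let N_m := total_crossings T x0 m Xbar Lbar in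
  (exists kappa : R.-pker (network V) ~> (word V), is_rcd P path_m N_m kappa) /\
  forall kappa : R.-pker (network V) ~> (word V),
    is_rcd P path_m N_m kappa ->
    {ae pushforward P N_m, forall n : network V,
      frakN T alpha n -> net_at T n x0 = m ->
      is_process_law T x0 alpha n (kappa n)}.
Proof.
move=> path_m N_m; have Lbar_pp : is_point_process Lbar by case: Lbar_law.
have mpath : measurable_fun setT path_m := measurable_path_upto_tau x0 Xbar_law.1 m.
have mN : measurable_fun setT N_m :=
  measurable_total_crossings T x0 Xbar_law.1 Lbar_pp m.
split; first exact: rcd_exists.
move=> kappa kappa_rcd.
have kappa1 n : kappa n setT = 1%E by exact: prob_kernel.
have good_ae : P [set w | good_word T x0 m (path_m w)] = 1%E ->
    {ae pushforward P N_m, forall n : network V, kappa n (~` good_word T x0 m) = 0%E}.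
  move=> good1; suff : {ae pushforward P N_m, forall n : network V,
      setT n -> kappa n (~` good_word T x0 m) = 0%E}.
    by apply: (rcd_aeS kappa_rcd) => n; exact.
  apply: (rcd_null kappa_rcd) => //; first exact: word_measurable.
  rewrite preimage_setT setIT -[_ @^-1` _]/(~` (path_m @^-1` good_word T x0 m)).
  have mgood : measurable (path_m @^-1` good_word T x0 m).
    by rewrite -[X in measurable X]setTI; exact: (mpath measurableT _ (word_measurable (good_word T x0 m))).
  by rewrite probability_setC// [P _]good1 subee.
have ae_and (E E' : network V -> Prop) :
    {ae pushforward P N_m, forall n, E n} -> {ae pushforward P N_m, forall n, E' n} ->
    {ae pushforward P N_m, forall n, E n /\ E' n}.
  move=> h h'; suff : {ae pushforward P N_m, forall n, forall b : bool, if b then E n else E' n}.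
    by apply: (rcd_aeS kappa_rcd) => n hb; split; [exact: (hb true)|exact: (hb false)].
  by apply: (rcd_ae_forall kappa_rcd) => -[].
(* The tree with a single vertex has rate 0, which excludes [rate_gt0] and what rests on it. There
   [net_at T n x0] is 0, which leaves only [m = 0] and the path [[:: x0]]. *)
have [[x x_nbr]|nbr_ne] := pselect (exists x, nbr T x = [::]).
  have nbrT := single_vertex x_nbr.
  have netT (n : network V) : net_at T n x0 = 0%N by rewrite /net_at nbrT big_nil.
  have [m0|mn0] := eqVneq m 0%N; last first.
    by apply: (rcd_aeW kappa_rcd) => n _; rewrite netT => E; rewrite -E eqxx in mn0.
  apply: (rcd_aeS kappa_rcd) (good_ae _) => [n ngood _ nm|].
    apply: process_lawP => // [|g u v|a y /= _]; first by rewrite nm.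
    - by rewrite nbrT.
    - by rewrite nbrT.
  rewrite /path_m m0 (_ : [set w | _] = [set w | Xbar 0%N w = x0]).
    have := Xbar_law.2 0%N (fun=> x0).
    have E0 (U : Type) (X : nat -> U -> V) :
        [set w | forall i, (i <= 0)%N -> X i w = x0] = [set w | X 0%N w = x0].
      apply/seteqP; split => w /= h; first exact: h.
      by move=> i; rewrite leqn0 => /eqP ->.
    by rewrite !E0 (chain_start X_ctmc) eqxx.
  apply/seteqP; split => w /= => [[p _ [->]]//|->].
  by exists [::].
have nbr0 x : nbr T x != [::] by apply/eqP => xE; apply: nbr_ne; exists x.
have good1 := path_good C_gt0 nbr0 X_ctmc X_rec Xbar_law m.
apply: (rcd_aeS kappa_rcd) (ae_and _ _ (good_ae good1) (ae_and _ _
  (rcd_crossings kappa_rcd)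
  (rcd_exit C_gt0 nbr0 alpha_ge0 X_ctmc Xbar_law Lbar_law indep kappa_rcd))).
move=> n [ngood [ncross nexit]] _ nm.
by apply: process_lawP => //; rewrite nm.
Qed.
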